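(* Let $\Gamma$ be an irreducible uniform lattice in a product $G=G_1\times\cdots\times G_n$ of locally compact $\sigma$-compact groups. Let $X$ be a proper CAT(0) space, let $H<\mathrm{Is}(X)$ be a closed subgroup, and let $\tau:\Gamma\to H$ be a homomorphism with indecomposable unbounded image. Then $\tau$ extends to a continuous homomorphism $\widetilde\tau:G\to H$.
   Context: Locally compact groups are assumed Hausdorff. A lattice is a discrete subgroup of finite covolume; it is uniform if it is cocompact. A lattice $\Gamma$ in $G=G_1\times\cdots\times G_n$ is irreducible if its projection to each factor $G_i$ is dense in $G_i$. $\mathrm{Is}(X)$ is the isometry group of $X$ with the compact-open topology. A subset $L$ of $\mathrm{Is}(X)$ is unbounded if for some (equivalently any) $x\in X$ the set $Lx$ is unbounded in $X$. $\partial X$ is the boundary at infinity of $X$ with the cone topology. A subgroup $L<\mathrm{Is}(X)$ is indecomposable if for every non-empty $L$-invariant closed subset $\mathcal{C}\subseteq\partial X$, the closure $\overline{L}$ of $L$ in $\mathrm{Is}(X)$ acts faithfully on $\mathcal{C}$ and (the image of) $\overline{L}$ is closed in $\mathrm{Homeo}(\mathcal{C})$ for the topology of uniform convergence. *)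

(* Defs.v *)
From HB Require Import structures.
From mathcomp Require Import all_boot all_order all_algebra.
From mathcomp Require Import all_classical all_reals all_analysis.
Set Implicit Arguments.
Unset Strict Implicit.
Unset Printing Implicit Defensive.
Import Order.TTheory GRing.Theory Num.Theory.
Import numFieldNormedType.Exports.
Local Open Scope classical_set_scope.
Local Open Scope quotient_scope.
Local Open Scope ring_scope.

HB.mixin Record isTopologicalGroup G of Topological G & Group G := {
  mulg_continuous : continuous (fun x : G * G => (x.1 * x.2)%g) ;
  invg_continuous : continuous (fun x : G => (x^-1)%g)
}.

#[short(type="topGroupType")]
HB.structure Definition TopologicalGroup :=
  {G of Topological G & Group G & isTopologicalGroup G}.

Section product_group.
Context {I : eqType} (G : I -> topGroupType).

Definition prod_group : Type := prod_topology (fun i => G i).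

HB.instance Definition _ := Topological.on prod_group.

Definition prod_one : prod_group := fun _ => 1%g.
Definition prod_inv (x : prod_group) : prod_group := fun i => (x i)^-1%g.
Definition prod_mul (x y : prod_group) : prod_group := fun i => (x i * y i)%g.

Fact prod_mulA : associative prod_mul.
Proof. by move=> x y z; apply/functional_extensionality_dep => i; exact: mulgA. Qed.
Fact prod_mul1g : left_id prod_one prod_mul.
Proof. by move=> x; apply/functional_extensionality_dep => i; exact: mul1g. Qed.
Fact prod_mulg1 : right_id prod_one prod_mul.
Proof. by move=> x; apply/functional_extensionality_dep => i; exact: mulg1. Qed.
Fact prod_mulVg : left_inverse prod_one prod_inv prod_mul.
Proof. by move=> x; apply/functional_extensionality_dep => i; exact: mulVg. Qed.
Fact prod_mulgV : right_inverse prod_one prod_inv prod_mul.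
Proof. by move=> x; apply/functional_extensionality_dep => i; exact: mulgV. Qed.

HB.instance Definition _ :=
  isGroup.Build prod_group prod_mulA prod_mul1g prod_mulg1 prod_mulVg prod_mulgV.

Fact to_prod_continuous (T : topologicalType) (f : T -> prod_group) :
  (forall i, continuous (fun t => f t i)) -> continuous f.
Proof.
move=> fc t; apply/cvg_sup => i U [/= _ [[V /= oV <-] /= Vfti]] /filterS; apply.
by apply: (fc i t); exact: open_nbhs_nbhs.
Qed.

Fact prod_mul_continuous :
  continuous (fun x : prod_group * prod_group => (x.1 * x.2)%g).
Proof.
apply: to_prod_continuous => i -[x y].
apply: (@continuous_comp _ _ _
  (fun z : prod_group * prod_group => (z.1 i, z.2 i)) (fun z => (z.1 * z.2)%g));
  last exact: mulg_continuous.
apply: cvg_pair => /=.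
- apply: (@cvg_comp _ _ _ fst (fun z : prod_group => z i)); first exact: cvg_fst.
  exact: (@proj_continuous _ (fun i => G i) i).
- apply: (@cvg_comp _ _ _ snd (fun z : prod_group => z i)); first exact: cvg_snd.
  exact: (@proj_continuous _ (fun i => G i) i).
Qed.

Fact prod_inv_continuous : continuous (fun x : prod_group => (x^-1)%g).
Proof.
apply: to_prod_continuous => i x.
apply: (@continuous_comp _ _ _ (fun z : prod_group => z i) (fun z => (z^-1)%g));
  last exact: invg_continuous.
exact: (@proj_continuous _ (fun i => G i) i).
Qed.

HB.instance Definition _ :=
  isTopologicalGroup.Build prod_group prod_mul_continuous prod_inv_continuous.

End product_group.

Definition sigma_compact (T : topologicalType) : Prop :=
  exists K : nat -> set T, (forall i, compact (K i)) /\ \bigcup_i K i = setT.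

Definition subgroup (G : groupType) (S : set G) : Prop := group_closed [in S].

Section coset_space.
Context {G : topGroupType} (Gamma : set G).

(** Relating points with the same left coset gives an equivalence relation for
    every set [Gamma]; for a subgroup it is [Gamma (x^-1 * y)], so that
    [coset_space] is [G/Gamma] with the quotient topology. *)
Definition lcoset (x : G) : set G := [set (x * c)%g | c in Gamma].

Definition coset_rel (x y : G) : bool := `[< lcoset x = lcoset y >].

Fact coset_rel_refl : reflexive coset_rel.
Proof. by move=> x; apply/asboolP. Qed.
Fact coset_rel_sym : symmetric coset_rel.
Proof. by move=> x y; apply/asboolP/asboolP => ->. Qed.
Fact coset_rel_trans : transitive coset_rel.
Proof. by move=> y x z /asboolP xy /asboolP yz; apply/asboolP; rewrite xy. Qed.

Canonical coset_equiv :=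
  EquivRel coset_rel coset_rel_refl coset_rel_sym coset_rel_trans.

Definition coset_space : Type := quotient_topology {eq_quot coset_equiv}.

HB.instance Definition _ := Topological.on coset_space.
HB.instance Definition _ := Quotient.on coset_space.
HB.instance Definition _ :=
  isPointed.Build coset_space (\pi_coset_space 1%g)%qT.

Definition coset_act (g : G) (y : coset_space) : coset_space :=
  (\pi_coset_space (g * repr y)%g)%qT.

Definition coset_borel : Type := g_sigma_algebraType (@open coset_space).

HB.instance Definition _ := Measurable.on coset_borel.

End coset_space.

(** The quotient [G/Gamma] carries a non-zero finite [G]-invariant Radon
    measure; a finite Borel measure on a locally compact Hausdorff space is Radon
    exactly when it is inner regular with respect to compact sets. *)
Definition finite_covolume (R : realType) (G : topGroupType) (Gamma : set G) :
    Prop :=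
  exists mu : {finite_measure set (coset_borel Gamma) -> \bar R},
  [/\ mu setT != 0%E,
      forall (g : G) (A : set (coset_borel Gamma)), measurable A ->
        mu (coset_act g @` A) = mu A
    & forall A : set (coset_borel Gamma), measurable A ->
        mu A = ereal_sup [set mu K | K in
          [set K : set (coset_space Gamma) | compact K /\ K `<=` A]]].

Definition lattice (R : realType) (G : topGroupType) (Gamma : set G) : Prop :=
  [/\ subgroup Gamma, Gamma `<=` isolated Gamma & finite_covolume R Gamma].

Definition cocompact (G : topGroupType) (Gamma : set G) : Prop :=
  compact [set: coset_space Gamma].

Definition irreducible (I : eqType) (G : I -> topGroupType)
    (Gamma : set (prod_group G)) : Prop :=
  forall i, dense [set x i | x in Gamma].

Definition proper_space (R : realType) (X : metricType R) : Prop :=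
  forall (x : X) (r : R), compact [set y | mdist x y <= r].

Definition geodesic (R : realType) (X : metricType R) (x y : X) (c : R -> X) :
    Prop :=
  [/\ c 0 = x, c (mdist x y) = y
    & forall s t, 0 <= s <= mdist x y -> 0 <= t <= mdist x y ->
        mdist (c s) (c t) = `|s - t|].

Definition eucl_dist (R : realType) (p q : R * R) : R :=
  Num.sqrt ((p.1 - q.1) ^+ 2 + (p.2 - q.2) ^+ 2).

Definition eucl_segment (R : realType) (p q : R * R) : set (R * R) :=
  [set ((1 - t) * p.1 + t * q.1, (1 - t) * p.2 + t * q.2)
    | t in [set t : R | 0 <= t <= 1]].

(** Geodesic triangles are at least as thin as their Euclidean comparison
    triangles.  It suffices to compare points on two sides issuing from the same
    vertex [x], since any two sides of a triangle share a vertex, geodesics can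
    be reversed, and the inequality is trivial for points on the same side. *)
Definition CAT0 (R : realType) (X : metricType R) : Prop :=
  (forall x y : X, exists c, geodesic x y c) /\
  (forall (x y z : X) (c c' : R -> X), geodesic x y c -> geodesic x z c' ->
    forall xb yb zb : R * R,
    eucl_dist xb yb = mdist x y ->
    eucl_dist yb zb = mdist y z ->
    eucl_dist xb zb = mdist x z ->
    forall (s t : R) (pb qb : R * R),
    0 <= s <= mdist x y -> 0 <= t <= mdist x z ->
    eucl_segment xb yb pb -> eucl_dist xb pb = s ->
    eucl_segment xb zb qb -> eucl_dist xb qb = t ->
    mdist (c s) (c' t) <= eucl_dist pb qb).

Section isometry_group.
Context {R : realType} (X : metricType R).

Record isom_group := Isometry {
  isom_fun :> X -> X ;
  _ : `[< (forall x y, mdist (isom_fun x) (isom_fun y) = mdist x y) /\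
          (forall y, exists x, isom_fun x = y) >]
}.

HB.instance Definition _ := [isSub for isom_fun].
HB.instance Definition _ := [Choice of isom_group by <:].

Lemma isom_mdist (f : isom_group) x y : mdist (f x) (f y) = mdist x y.
Proof. by case: f => f /= /asboolP[]. Qed.

Lemma isom_surj (f : isom_group) y : exists x, f x = y.
Proof. by case: f => f /= /asboolP[]. Qed.

Lemma isom_inj (f : isom_group) : injective f.
Proof.
by move=> x y fxy; apply: mdist_positivity; rewrite -(isom_mdist f) fxy mdistxx.
Qed.

Lemma isom_ext (f g : isom_group) : f =1 g -> f = g.
Proof. by move=> fg; apply: val_inj; exact/funext. Qed.

Fact isom_one_subproof :
  `[< (forall x y : X, mdist (id x) (id y) = mdist x y) /\
      (forall y : X, exists x, id x = y) >].
Proof. by apply/asboolP; split=> // y; exists y. Qed.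

Definition isom_one : isom_group := Isometry isom_one_subproof.

Fact isom_mul_subproof (f g : isom_group) :
  `[< (forall x y : X, mdist ((f \o g) x) ((f \o g) y) = mdist x y) /\
      (forall y : X, exists x, (f \o g) x = y) >].
Proof.
apply/asboolP; split=> [x y /=|y]; first by rewrite !isom_mdist.
by have [z <-] := isom_surj f y; have [x <-] := isom_surj g z; exists x.
Qed.

Definition isom_mul (f g : isom_group) : isom_group :=
  Isometry (isom_mul_subproof f g).

Definition isom_inv_fun (f : isom_group) (y : X) : X := projT1 (cid (isom_surj f y)).

Fact isom_inv_funK (f : isom_group) : cancel (isom_inv_fun f) f.
Proof. by move=> y; rewrite /isom_inv_fun; case: cid. Qed.

Fact isom_inv_subproof (f : isom_group) :
  `[< (forall x y : X, mdist (isom_inv_fun f x) (isom_inv_fun f y) = mdist x y) /\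
      (forall y : X, exists x, isom_inv_fun f x = y) >].
Proof.
apply/asboolP; split=> [x y|y]; first by rewrite -(isom_mdist f) !isom_inv_funK.
by exists (f y); apply: (@isom_inj f); rewrite isom_inv_funK.
Qed.

Definition isom_inv (f : isom_group) : isom_group := Isometry (isom_inv_subproof f).

Fact isom_mulA : associative isom_mul.
Proof. by move=> f g h; exact: isom_ext. Qed.
Fact isom_mul1g : left_id isom_one isom_mul.
Proof. by move=> f; exact: isom_ext. Qed.
Fact isom_mulg1 : right_id isom_one isom_mul.
Proof. by move=> f; exact: isom_ext. Qed.
Fact isom_mulgV : right_inverse isom_one isom_inv isom_mul.
Proof. by move=> f; apply: isom_ext => x /=; rewrite isom_inv_funK. Qed.
Fact isom_mulVg : left_inverse isom_one isom_inv isom_mul.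
Proof.
by move=> f; apply: isom_ext => x /=; apply: (@isom_inj f); rewrite isom_inv_funK.
Qed.

HB.instance Definition _ := isGroup.Build isom_group
  isom_mulA isom_mul1g isom_mulg1 isom_mulVg isom_mulgV.

HB.instance Definition _ := Topological.copy isom_group
  (initial_topology (isom_fun : isom_group -> {compact-open, X -> X})).

End isometry_group.

Definition metric_bounded (R : realType) (X : metricType R) (A : set X) : Prop :=
  exists M : R, forall a b, A a -> A b -> mdist a b <= M.

Definition unbounded (R : realType) (X : metricType R) (L : set (isom_group X)) :
    Prop :=
  exists x : X, ~ metric_bounded [set g x | g in L].

Section boundary.
Context {R : realType} (X : metricType R).

(** A ray is a function on all of [R]; only its values on [[0, +oo[] matter, and
    asymptotic rays, hence in particular rays that agree there, are identified in
    [boundary]. *)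
Record ray := Ray {
  ray_fun :> R -> X ;
  _ : `[< forall s t, 0 <= s -> 0 <= t ->
            mdist (ray_fun s) (ray_fun t) = `|s - t| >]
}.

HB.instance Definition _ := [isSub for ray_fun].
HB.instance Definition _ := [Choice of ray by <:].

Lemma rayP (c : ray) s t : 0 <= s -> 0 <= t -> mdist (c s) (c t) = `|s - t|.
Proof. by case: c => c /= /asboolP; exact. Qed.

Definition asymptotic (c c' : ray) : bool :=
  `[< exists K : R, forall t, 0 <= t -> mdist (c t) (c' t) <= K >].

Fact asymptotic_refl : reflexive asymptotic.
Proof. by move=> c; apply/asboolP; exists 0 => t _; rewrite mdistxx. Qed.
Fact asymptotic_sym : symmetric asymptotic.
Proof.
by move=> c c'; apply/asboolP/asboolP => -[K cK]; exists K => t t0;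
  rewrite metric_sym; exact: cK.
Qed.
Fact asymptotic_trans : transitive asymptotic.
Proof.
move=> c2 c1 c3 /asboolP[K cK] /asboolP[K' cK']; apply/asboolP.
exists (K + K') => t t0.
by rewrite (le_trans (metric_triangle _ (c2 t) _))// lerD// ?cK ?cK'.
Qed.

Canonical asymptotic_equiv :=
  EquivRel asymptotic asymptotic_refl asymptotic_sym asymptotic_trans.

Definition boundary : Type := {eq_quot asymptotic_equiv}.

HB.instance Definition _ := Choice.on boundary.
HB.instance Definition _ := Quotient.on boundary.

(** Points at infinity of rays with the same origin as [c] that pass within
    distance [e] of [c r]. *)
Definition cone_nbhd (c : ray) (r e : R) : set boundary :=
  [set (\pi_boundary c')%qT | c' in
    [set c' : ray | c' 0 = c 0 /\ mdist (c' r) (c r) < e]].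

Definition cone_subbase : set (set boundary) :=
  [set U | exists (c : ray) (r e : R), [/\ 0 < r, 0 < e & U = cone_nbhd c r e]].

(** The cone topology.  In a complete CAT(0) space, for a fixed origin the sets
    [cone_nbhd c r e] form a neighbourhood basis of the class of [c], and the
    topology does not depend on the origin, so all origins are used at once. *)
HB.instance Definition _ := isSubBaseTopological.Build boundary cone_subbase id.

Fact ray_act_subproof (g : isom_group X) (c : ray) :
  `[< forall s t, 0 <= s -> 0 <= t -> mdist ((g \o c) s) ((g \o c) t) = `|s - t| >].
Proof. by apply/asboolP => s t s0 t0 /=; rewrite isom_mdist rayP. Qed.

Definition ray_act (g : isom_group X) (c : ray) : ray := Ray (ray_act_subproof g c).

Definition boundary_act (g : isom_group X) (xi : boundary) : boundary :=
  (\pi_boundary (ray_act g (repr xi)))%qT.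

End boundary.

(** Homeomorphisms of a subset [C] of [T] are represented by functions [T -> T],
    whose values outside of [C] are irrelevant. *)
Definition homeo_on (T : topologicalType) (C : set T) (f : T -> T) : Prop :=
  exists f' : T -> T,
  [/\ set_fun C C f /\ set_fun C C f',
      {within C, continuous f}, {within C, continuous f'},
      (forall x, C x -> f' (f x) = x) & (forall x, C x -> f (f' x) = x)].

(** For [C] a compact subset of a Hausdorff space, the unique uniform structure
    of [C] consists of the neighbourhoods of the diagonal; these are the traces on
    [C `*` C] of the neighbourhoods [V] in [T * T] of the diagonal of [C].
    [unif_closed_in_homeo C A] says that every homeomorphism of [C] in the uniform
    closure of [A] agrees on [C] with an element of [A]. *)
Definition unif_closed_in_homeo (T : topologicalType) (C : set T)
    (A : set (T -> T)) : Prop :=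
  forall f : T -> T, homeo_on C f ->
    (forall V : set (T * T), (forall x, C x -> nbhs (x, x) V) ->
      exists2 g, A g & forall x, C x -> V (f x, g x)) ->
    exists2 g, A g & forall x, C x -> f x = g x.

(** For a subgroup [L], [closure L] is a group, so faithfulness means that only
    [1] acts trivially on [C]. *)
Definition indecomposable (R : realType) (X : metricType R)
    (L : set (isom_group X)) : Prop :=
  forall C : set (boundary X), C !=set0 -> closed C ->
    (forall g xi, L g -> C xi -> C (boundary_act g xi)) ->
    (forall g, closure L g -> (forall xi, C xi -> boundary_act g xi = xi) ->
      g = 1%g) /\
    unif_closed_in_homeo C [set boundary_act g | g in closure L].

(* Main.v *)
Require Import Defs.
From mathcomp Require Import all_boot all_order all_algebra finmap.
From mathcomp Require Import all_classical all_reals all_analysis.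
From mathcomp Require Import ring lra.
Set Implicit Arguments.
Unset Strict Implicit.
Unset Printing Implicit Defensive.
Import Order.TTheory GRing.Theory Num.Theory.
Import numFieldNormedType.Exports.
Local Open Scope classical_set_scope.
Local Open Scope ring_scope.

(** Consider the continuous maps [f : G -> X] such that [f (g c) = (tau c)^-1 (f g)]
    for [c] in [Gamma].  Replacing [f g] by a barycentre of the points [f (s g)], for
    [s] with trivial [i]-th coordinate, is a nonexpanding operator that commutes with
    [G_i].  Approximate fixed points of this operator either have an ultralimit that
    is a fixed point (a "harmonic" map) or escape to infinity; in the latter case the
    variance inequality for barycentres makes the displacement of [tau c] sublinear
    along them, so that [Gamma] fixes a point of the boundary, which indecomposability
    of an unbounded image excludes.

    By the maximum principle and the density of the projection of [Gamma], two harmonic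
    maps are at constant distance.  Hence their values at [1] form a closed convex
    subset [A] of [X] on which [G_i] acts, and, by the equality case for barycentres,
    [tau c] and the [i]-th coordinate of [c] are at bounded distance on [A].  If [A] is
    unbounded, then [G_i] acts on the boundary of [A] through uniform limits of elements
    of [tau Gamma], and the closedness and faithfulness in the definition of
    indecomposability yield a homomorphism from [G_i] to the closure of [tau Gamma],
    continuous by Baire's theorem.  If [A] is bounded, then its circumcentre is the value
    of a harmonic map invariant under [G_i], and one continues with such maps and the
    next factor.  The factors cannot be exhausted, because [tau Gamma] would then fix a
    point of [X]. *)

(** * Geodesics in CAT(0) spaces *)

(** The iterates of the averaging operator have no common modulus of continuity of their own, and
    this obstacle shapes the construction. Along the kernel of the projection to [G_i] the modulus
    comes from comparing averages with translated weights, which costs only the size of the map;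
    along [G_i] it is inherited from the base map, because [G_i] commutes with that kernel. The
    decomposition [kappa_decomp] combines the two.

    The averages need a measure on the kernel that charges every element, so that extremal averages
    force equality everywhere, that has a density which can be translated, and for which squared
    displacements of the base map are integrable. It is the image of the weight [phi] on [G] under
    countably many maps [step], with dyadic coefficients divided by squared displacement bounds. The
    left invariant integral on [G] behind it comes from the lattice: sums over [Gamma] are
    integrated over [G/Gamma]. *)

Definition gpt (R : realType) (X : metricType R) (x y : X) (t : R) : X :=
  xget x [set m | mdist x m = t * mdist x y /\ mdist m y = (1 - t) * mdist x y].

Definition gconvex (R : realType) (X : metricType R) (A : set X) : Prop :=
  forall x y t, A x -> A y -> 0 <= t <= 1 -> A (gpt x y t).

Section geodesic_points.
Context {R : realType} {X : metricType R} (CAT0X : CAT0 X).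
Implicit Types (x y z m : X) (s t : R).

Lemma eucl_dist_ge0 (p q : R * R) : 0 <= eucl_dist p q.
Proof. exact: sqrtr_ge0. Qed.

Lemma sqr_eucl_dist (p q : R * R) :
  eucl_dist p q ^+ 2 = (p.1 - q.1) ^+ 2 + (p.2 - q.2) ^+ 2.
Proof. by rewrite sqr_sqrtr// addr_ge0// sqr_ge0. Qed.

Lemma eucl_distP (p q : R * R) (e : R) : 0 <= e ->
  (p.1 - q.1) ^+ 2 + (p.2 - q.2) ^+ 2 = e ^+ 2 -> eucl_dist p q = e.
Proof. by move=> e0; rewrite /eucl_dist => ->; rewrite sqrtr_sqr ger0_norm. Qed.

(** The comparison is applied to a point of one side and the opposite vertex [z]; in the Euclidean
    triangle the bound is Stewart's identity. *)
Lemma geodesic_CN x y z c t : geodesic x y c -> 0 <= t <= 1 ->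
  mdist (c (t * mdist x y)) z ^+ 2 <=
  (1 - t) * mdist x z ^+ 2 + t * mdist y z ^+ 2 - t * (1 - t) * mdist x y ^+ 2.
Proof.
move=> gc /andP[t0 t1].
have [D0|Dn0] := eqVneq (mdist x y) 0.
  have xy := mdist_positivity _ _ D0; move: gc => [c0 _ _].
  rewrite D0 mulr0 c0 -xy.
  by rewrite le_eqVlt; apply/orP; left; apply/eqP; ring.
set D := mdist x y in Dn0 *; set e := mdist x z; set f := mdist y z.
have D0 : 0 < D by rewrite lt_neqAle eq_sym Dn0 mdist_ge0.
have e0 : 0 <= e := mdist_ge0 _ _; have f0 : 0 <= f := mdist_ge0 _ _.
have T1 : D <= e + f.
  by rewrite /D (le_trans (metric_triangle _ z _))// lerD2l /f metric_sym.
have T2 : e <= D + f := metric_triangle _ _ _.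
have T3 : f <= D + e.
  by rewrite /f (le_trans (metric_triangle _ x _))// lerD2r /D metric_sym.
have [c' gc'] := CAT0X.1 x z.
(* The comparison triangle is [(0, 0)], [(D, 0)], [(p, q)]. The law of cosines gives [p], and the
   triangle inequalities give [p^2 <= e^2], which makes [q] real. *)
pose p := (D ^+ 2 + e ^+ 2 - f ^+ 2) / (2 * D).
have pE : 2 * D * p = D ^+ 2 + e ^+ 2 - f ^+ 2.
  by rewrite /p mulrC divfK// mulf_neq0// gt_eqF.
have p2 : p ^+ 2 <= e ^+ 2.
  have H1 : p <= e.
    rewrite -(ler_pM2l (_ : 0 < 2 * D)) ?mulr_gt0// pE.
    have : 0 <= (f - (D - e)) * (f + (D - e)) by apply: mulr_ge0; lra.
    by lra.
  have H2 : - e <= p.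
    rewrite -(ler_pM2l (_ : 0 < 2 * D)) ?mulr_gt0// pE.
    have : 0 <= (D + e - f) * (D + e + f) by apply: mulr_ge0; lra.
    by lra.
  by rewrite -(real_normK (num_real p)) lerXn2r ?nnegrE// ler_norml H2.
pose q := Num.sqrt (e ^+ 2 - p ^+ 2).
have q2 : q ^+ 2 = e ^+ 2 - p ^+ 2 by rewrite sqr_sqrtr// subr_ge0.
have t01 : 0 <= t * D <= D by apply/andP; split; [rewrite mulr_ge0 // ltW|rewrite ler_piMl // ltW].
have e01 : 0 <= e <= e by rewrite e0 lexx.
have H := CAT0X.2 x y z c c' gc gc' (0, 0) (D, 0) (p, q) _ _ _ (t * D) e
  (t * D, 0) (p, q) t01 e01 _ _ _ _.
have {}H : mdist (c (t * D)) (c' e) <= eucl_dist (t * D, 0) (p, q).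
  apply: H; try apply: eucl_distP => //=; rewrite ?(ltW D0)//.
  - by rewrite -/D; ring.
  - by rewrite sub0r sqrrN q2 -/f; move: pE; clear; nra.
  - by rewrite !sub0r !sqrrN q2 -/e; ring.
  - exists t; first by apply/andP.
    by congr pair => /=; ring.
  - by rewrite mulr_ge0// ltW.
  - by ring.
  - exists 1; first by rewrite /= ler01 lexx.
    by congr pair => /=; ring.
  - by rewrite !sub0r !sqrrN q2; ring.
have c'e : c' e = z by case: gc'.
rewrite c'e in H.
apply: (@le_trans _ _ (eucl_dist (t * D, 0) (p, q) ^+ 2)).
  by rewrite lerXn2r ?nnegrE// ?mdist_ge0 ?eucl_dist_ge0.
rewrite sqr_eucl_dist /= sub0r sqrrN q2.
rewrite le_eqVlt; apply/orP; left; apply/eqP.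
transitivity ((t * D) ^+ 2 - t * (2 * D * p) + e ^+ 2); first by ring.
by rewrite pE; ring.
Qed.

Lemma geodesic_param x y c t : geodesic x y c -> 0 <= t <= 1 ->
  mdist x (c (t * mdist x y)) = t * mdist x y /\
  mdist (c (t * mdist x y)) y = (1 - t) * mdist x y.
Proof.
move=> [c0 c1 cd] /andP[t0 t1].
have h0 : 0 <= (0 : R) <= mdist x y by rewrite lexx mdist_ge0.
have h1 : 0 <= mdist x y <= mdist x y by rewrite lexx mdist_ge0.
have ht : 0 <= t * mdist x y <= mdist x y.
  by rewrite mulr_ge0 ?mdist_ge0//= ler_piMl ?mdist_ge0.
split.
  by rewrite -{1}c0 cd// sub0r normrN ger0_norm//; case/andP: ht.
rewrite -{2}c1 cd// distrC ger0_norm; first by ring.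
by rewrite subr_ge0; case/andP: ht.
Qed.

Lemma gptP x y t : 0 <= t <= 1 ->
  mdist x (gpt x y t) = t * mdist x y /\
  mdist (gpt x y t) y = (1 - t) * mdist x y.
Proof.
move=> t01; rewrite /gpt; case: xgetP => [m _ //|] /(_ (projT1 (cid (CAT0X.1 x y)) (t * mdist x y))).
by case: cid => c /= gc []; exact: geodesic_param.
Qed.

(** With [z := m], the right-hand side of the CN inequality is at most [(1 - t) t^2 + t (1 - t)^2 -
    t (1 - t) = 0] times the squared length. *)
Lemma geodesic_unique x y c m t : geodesic x y c -> 0 <= t <= 1 ->
  mdist x m <= t * mdist x y -> mdist m y <= (1 - t) * mdist x y ->
  m = c (t * mdist x y).
Proof.
move=> gc t01 xm my; have := geodesic_CN m gc t01.
set a := mdist _ m; move=> H; apply/esym/mdist_positivity; rewrite -/a.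
have a0 : 0 <= a := mdist_ge0 _ _.
move: t01 => /andP[t0 t1].
have h1 : mdist x m ^+ 2 <= (t * mdist x y) ^+ 2.
  by rewrite lerXn2r ?nnegrE ?mdist_ge0// mulr_ge0 ?mdist_ge0.
have h2 : mdist y m ^+ 2 <= ((1 - t) * mdist x y) ^+ 2.
  by rewrite metric_sym lerXn2r ?nnegrE ?mdist_ge0// mulr_ge0 ?mdist_ge0// subr_ge0.
have h1' : (1 - t) * mdist x m ^+ 2 <= (1 - t) * (t * mdist x y) ^+ 2.
  by rewrite ler_wpM2l// subr_ge0.
have h2' : t * mdist y m ^+ 2 <= t * ((1 - t) * mdist x y) ^+ 2.
  by rewrite ler_wpM2l.
have {H} : a ^+ 2 <= 0 by lra.
by move=> a2; apply/eqP; rewrite -sqrf_eq0 eq_le a2 sqr_ge0.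
Qed.

Lemma gptE x y c t : geodesic x y c -> 0 <= t <= 1 ->
  gpt x y t = c (t * mdist x y).
Proof.
by move=> gc t01; have [h1 h2] := gptP x y t01;
  apply: geodesic_unique => //; rewrite ?h1 ?h2.
Qed.

(** Later identifications of geodesic points, for isometries, rays and harmonic maps, all reduce to
    these two inequalities. *)
Lemma gpt_unique x y m t : 0 <= t <= 1 ->
  mdist x m <= t * mdist x y -> mdist m y <= (1 - t) * mdist x y ->
  m = gpt x y t.
Proof.
move=> t01 h1 h2; have [c gc] := CAT0X.1 x y.
by rewrite (gptE gc)//; exact: geodesic_unique.
Qed.

Lemma CN_ineq x y z t : 0 <= t <= 1 ->
  mdist (gpt x y t) z ^+ 2 <=
  (1 - t) * mdist x z ^+ 2 + t * mdist y z ^+ 2 - t * (1 - t) * mdist x y ^+ 2.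
Proof.
by move=> t01; have [c gc] := CAT0X.1 x y; rewrite (gptE gc)//; exact: geodesic_CN.
Qed.

Lemma gpt_dist x y s t : 0 <= s <= 1 -> 0 <= t <= 1 ->
  mdist (gpt x y s) (gpt x y t) = `|s - t| * mdist x y.
Proof.
move=> s01 t01; have [c gc] := CAT0X.1 x y; rewrite !(gptE gc)//.
have hh r : 0 <= r <= 1 -> 0 <= r * mdist x y <= mdist x y.
  move=> /andP[r0 r1].
  by rewrite mulr_ge0 ?mdist_ge0//= ler_piMl ?mdist_ge0.
case: gc => _ _ ->; rewrite ?hh// -mulrBl normrM; congr (_ * _).
by rewrite ger0_norm ?mdist_ge0.
Qed.

Lemma gpt0 x y : gpt x y 0 = x.
Proof.
apply/esym/gpt_unique; rewrite ?lexx ?ler01//.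
  by rewrite mdistxx mul0r.
by rewrite subr0 mul1r.
Qed.

(** CN is applied to [gpt x y' t] seen from [gpt x y t], then to [gpt x y t] seen from [y']; all
    terms but [t^2 d(y, y')^2] cancel. *)
Lemma gpt_convex1 x y y' t : 0 <= t <= 1 ->
  mdist (gpt x y t) (gpt x y' t) <= t * mdist y y'.
Proof.
move=> t01; have /andP[t0 t1] := t01.
have H1 := CN_ineq x y' (gpt x y t) t01.
have H2 := CN_ineq x y y' t01.
have [E1 _] := gptP x y t01.
rewrite (metric_sym y') in H1; rewrite E1 in H1.
have H3 : t * mdist (gpt x y t) y' ^+ 2 <=
  t * ((1 - t) * mdist x y' ^+ 2 + t * mdist y y' ^+ 2 - t * (1 - t) * mdist x y ^+ 2).
  by rewrite ler_wpM2l.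
rewrite -[leLHS]ger0_norm ?mdist_ge0// -[leRHS]ger0_norm; last first.
  by rewrite mulr_ge0 ?mdist_ge0.
rewrite -ler_sqr ?nnegrE// !real_normK ?num_real// metric_sym.
by move: H1 H3; lra.
Qed.

Lemma gpt_rev x y t : 0 <= t <= 1 -> gpt y x (1 - t) = gpt x y t.
Proof.
move=> t01; have [h1 h2] := gptP x y t01; apply/esym/gpt_unique.
- by move: t01 => /andP[]; lra.
- by rewrite metric_sym h2 (metric_sym y).
- by rewrite metric_sym h1 (metric_sym y) subKr.
Qed.

Lemma gpt_convex x y x' y' t : 0 <= t <= 1 ->
  mdist (gpt x y t) (gpt x' y' t) <= (1 - t) * mdist x x' + t * mdist y y'.
Proof.
move=> t01; have t01' : 0 <= 1 - t <= 1 by move: t01 => /andP[]; lra.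
apply: le_trans (metric_triangle _ (gpt x' y t) _) _; rewrite lerD//.
  by rewrite -(gpt_rev x)// -(gpt_rev x')// gpt_convex1.
exact: gpt_convex1.
Qed.

Lemma gpt_isom (g : X -> X) x y t : (forall a b, mdist (g a) (g b) = mdist a b) ->
  0 <= t <= 1 -> g (gpt x y t) = gpt (g x) (g y) t.
Proof.
move=> gi t01; have [h1 h2] := gptP x y t01.
by apply: gpt_unique => //; rewrite !gi ?h1 ?h2.
Qed.

(** Reshetnyak's quadruple inequality; the weight below is the one for which the
    two applications of the CN inequality cancel the diagonal exactly. *)
Lemma quadruple x1 x2 x3 x4 :
  mdist x1 x3 ^+ 2 + mdist x2 x4 ^+ 2 <=
  mdist x2 x3 ^+ 2 + mdist x1 x4 ^+ 2 + 2 * (mdist x1 x2 * mdist x3 x4).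
Proof.
have [E12|n12] := eqVneq (mdist x1 x2) 0.
  by rewrite E12 mul0r mulr0 addr0 (mdist_positivity _ _ E12).
have [E34|n34] := eqVneq (mdist x3 x4) 0.
  rewrite E34 !mulr0 addr0 (mdist_positivity _ _ E34).
  by rewrite [leRHS]addrC.
set a := mdist x1 x2 in n12 *; set b := mdist x3 x4 in n34 *.
have a0 : 0 < a by rewrite lt_neqAle eq_sym n12 mdist_ge0.
have b0 : 0 < b by rewrite lt_neqAle eq_sym n34 mdist_ge0.
pose t := a / (a + b).
have ab0 : a + b != 0 by rewrite gt_eqF// addr_gt0.
have abt : (a + b) * t = a by rewrite mulrC divfK.
have t0 : 0 < t by rewrite divr_gt0// addr_gt0.
have t1 : t < 1 by rewrite ltr_pdivrMr ?addr_gt0// mul1r ltrDl.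
have t01 : 0 <= t <= 1 by rewrite !ltW.
have H2 := CN_ineq x1 x3 x2 t01.
have H4 := CN_ineq x1 x3 x4 t01.
set m := gpt x1 x3 t in H2 H4.
rewrite -/a -/b (metric_sym x3 x2) in H2 H4.
have T : mdist x2 x4 <= mdist m x2 + mdist m x4.
  by rewrite (metric_sym m x2) metric_triangle.
set u := mdist m x2 in H2 T; set v := mdist m x4 in H4 T.
set p := mdist x2 x4 in T *; set q := mdist x1 x3 in H2 H4 *.
set r := mdist x2 x3 in H2 *; set w := mdist x1 x4 in H4 *.
have p0 : 0 <= p := mdist_ge0 _ _.
have u0 : 0 <= u := mdist_ge0 _ _.
have v0 : 0 <= v := mdist_ge0 _ _.
have Pp : t * (1 - t) * p ^+ 2 <= (1 - t) * u ^+ 2 + t * v ^+ 2.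
  have : p ^+ 2 <= (u + v) ^+ 2 by rewrite lerXn2r ?nnegrE// addr_ge0.
  have tt : 0 <= t * (1 - t) by rewrite mulr_ge0// ?subr_ge0 ltW.
  move=> /(ler_wpM2l tt) /le_trans; apply.
  have : 0 <= ((1 - t) * u - t * v) ^+ 2 := sqr_ge0 _.
  by clear; lra.
have t1' : 0 <= 1 - t by rewrite subr_ge0 ltW.
have K2 : (1 - t) * u ^+ 2 <= (1 - t) * ((1 - t) * a ^+ 2 + t * r ^+ 2 - t * (1 - t) * q ^+ 2).
  by rewrite ler_wpM2l.
have K4 : t * v ^+ 2 <= t * ((1 - t) * w ^+ 2 + t * b ^+ 2 - t * (1 - t) * q ^+ 2).
  by rewrite ler_wpM2l// ltW.
have E : (1 - t) * a = t * b by rewrite -{1}abt; transitivity (t * ((a + b) - (a + b) * t)); [ring|rewrite abt; ring].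
have E1 : (1 - t) * ((1 - t) * a ^+ 2) = t * (1 - t) * (a * b).
  by transitivity (((1 - t) * a) * ((1 - t) * a)); [ring|rewrite {1}E; ring].
have E2 : t * (t * b ^+ 2) = t * (1 - t) * (a * b).
  by transitivity ((t * b) * (t * b)); [ring|rewrite -{1}E; ring].
have tt : 0 < t * (1 - t) by rewrite mulr_gt0// subr_gt0.
rewrite -(ler_pM2l tt).
by move: Pp K2 K4 E1 E2; clear; lra.
Qed.

End geodesic_points.

(** * Limits along ultrafilters *)

Lemma fmap_ultra (I J : Type) (f : I -> J) (U : set_system I) :
  UltraFilter U -> UltraFilter (f @ U).
Proof.
move=> FU; split; first exact: fmap_proper_filter.
move=> G PG sub; apply/seteqP; split=> // A GA.
have [//|UnA] := in_ultra_setVsetC (f @^-1` A) FU.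
have /filter_ex[? []] : G (A `&` ~` A) by apply: filterI => //; exact: sub.
by [].
Qed.

(** As [F] does not contain [B], adjoining the complement of [B] keeps the filter proper. This
    reduces statements about filters to ultrafilters, along which compactness gives limits. *)
Lemma not_cvg_ultra (I : Type) (F : set_system I) (B : set I) : Filter F -> ~ F B ->
  exists U : set_system I, [/\ UltraFilter U, F `<=` U & U (~` B)].
Proof.
move=> FF FB; pose G := [set A : set I | F (B `|` A)].
have PG : ProperFilter G.
  split; first by rewrite /G /= setU0.
  split; first by rewrite /G /= setUT; apply: (@filterT _ F).
    by move=> P Q GP GQ; rewrite /G /= setUIr; apply: (@filterI _ F).
  move=> P Q PQ; rewrite /G /=; apply: (@filterS _ F) => x [Bx|/PQ Qx].
    by left.
  by right.
have [U [UU sub]] := ultraFilterLemma PG; exists U; split=> //.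
  by move=> A FA; apply: sub; apply: filterS FA => x; right.
by apply: sub; rewrite /G /= setUv; apply: (@filterT _ F).
Qed.

Lemma cvg_ultra (I : Type) (T : topologicalType) (F : set_system I) (f : I -> T) (l : T) :
  Filter F -> (forall U, UltraFilter U -> F `<=` U -> f @ U --> l) -> f @ F --> l.
Proof.
move=> FF H B nB; apply: contrapT => nFB.
have [U [UU FU /= UB]] := not_cvg_ultra FF nFB.
have UfB : U (f @^-1` B) := H U UU FU B nB.
by have /filter_ex[? []] : U ((f @^-1` B) `&` ~` (f @^-1` B)) by exact: filterI.
Qed.

Section metric_limits.
Context {R : realType} {X : metricType R} {I : Type}.
Implicit Types (x y : I -> X) (a b : X).

Lemma cvg_mdistP {F : set_system I} {FF : Filter F} x a :
  x @ F --> a <-> forall e, 0 < e -> \forall i \near F, mdist a (x i) < e.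
Proof. exact: metricType_numDomainType.cvgrPdist_lt. Qed.

Lemma cvg_mdist_le {F : set_system I} {FF : ProperFilter F} x y a b (c : R) :
  x @ F --> a -> y @ F --> b -> (\forall i \near F, mdist (x i) (y i) <= c) ->
  mdist a b <= c.
Proof.
move=> /cvg_mdistP xa /cvg_mdistP yb xyc; apply/ler_addgt0Pr => e e0.
have e2 : 0 < e / 2 by rewrite divr_gt0.
have [i [[/ltW h1 /ltW h2] h3]] := filter_ex (filterI (filterI (xa _ e2) (yb _ e2)) xyc).
apply: (le_trans (metric_triangle _ (x i) _)).
have := metric_triangle (x i) (y i) b.
by move: h2; rewrite (metric_sym b) => h2; move: h1 h2 h3; lra.
Qed.

Lemma cvg_mdist_ge {F : set_system I} {FF : ProperFilter F} x y a b (c : R) :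
  x @ F --> a -> y @ F --> b -> (\forall i \near F, c <= mdist (x i) (y i)) ->
  c <= mdist a b.
Proof.
move=> /cvg_mdistP xa /cvg_mdistP yb xyc; apply/ler_addgt0Pr => e e0.
have e2 : 0 < e / 2 by rewrite divr_gt0.
have [i [[/ltW h1 /ltW h2] h3]] := filter_ex (filterI (filterI (xa _ e2) (yb _ e2)) xyc).
apply: (le_trans h3); apply: (le_trans (metric_triangle _ a _)).
have := metric_triangle a b (y i).
by move: h1; rewrite (metric_sym a (x i)) => h1; move: h1 h2; lra.
Qed.

Lemma cvg_unique_mdist {F : set_system I} {FF : ProperFilter F} x a b :
  x @ F --> a -> x @ F --> b -> a = b.
Proof.
move=> xa xb; apply: mdist_positivity; apply/eqP; rewrite eq_le mdist_ge0 andbT.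
by apply: cvg_mdist_le xa xb _; apply: nearW => i; rewrite mdistxx.
Qed.

Lemma cvg_mdist_cst {F : set_system I} {FF : Filter F} a : (fun _ : I => a) @ F --> a.
Proof. by apply/cvg_mdistP => e e0; apply: nearW => i; rewrite mdistxx. Qed.

Lemma cvg_mdist_lec {F : set_system I} {FF : ProperFilter F} x a b (c : R) :
  x @ F --> a -> (\forall i \near F, mdist (x i) b <= c) -> mdist a b <= c.
Proof. by move=> xa; apply: (cvg_mdist_le xa); exact: cvg_mdist_cst. Qed.

Hypothesis properX : proper_space X.

(** Takes the place of extracting subsequences, with one ultrafilter serving all points of a domain
    at once. *)
Lemma ulim_ex (U : set_system I) (UU : UltraFilter U) x p (r : R) :
  (\forall i \near U, mdist p (x i) <= r) -> exists a, x @ U --> a.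
Proof.
move=> H; have := @properX p r; rewrite compact_ultra => /(_ (x @ U) (fmap_ultra x UU)).
by move=> /(_ H)[a [_ xa]]; exists a.
Qed.

End metric_limits.

(** * Circumcentres of bounded convex sets *)

Section circumcenter.
Context {R : realType} {X : metricType R} (properX : proper_space X) (CAT0X : CAT0 X).

Lemma ultra_oo : exists U : set_system nat, UltraFilter U /\ \oo `<=` U.
Proof. exact: ultraFilterLemma. Qed.

Lemma inv_succ_small (e : R) : 0 < e -> \forall n \near \oo, n.+1%:R^-1 <= e.
Proof.
move=> e0; near=> n; rewrite ltW//; near: n.
exact: near_infty_natSinv_lt (PosNum e0).
Unshelve. all: by end_near. Qed.

(** In the last clause [r] is the exact radius of [A] about [c], and a point [c'] with no larger
    radius equals [c]. In this form uniqueness can be tested on the image of [c] under a symmetry of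
    [A]. *)
Lemma circumcenter_ex (A : set X) (r0 : R) : A !=set0 -> closed A -> gconvex A ->
  (forall x y, A x -> A y -> mdist x y <= r0) ->
  exists2 c, A c & forall c' r, A c' -> (forall y, A y -> mdist c y <= r) ->
    (forall y, A y -> mdist c' y <= r) -> (forall e, 0 < e -> exists2 y, A y & r - e < mdist c y) ->
    c' = c.
Proof.
move=> [a0 Aa0] clA cvA bA.
pose D := [set r : R | exists2 x, A x & forall y, A y -> mdist x y <= r].
have D0 : has_inf D.
  split; first by exists r0; exists a0 => // y; exact: bA.
  by exists 0 => r [x Ax /(_ x Ax)]; rewrite mdistxx.
have xex n : exists x, A x /\ forall y, A y -> mdist x y <= inf D + n.+1%:R^-1.
  have n0 : (0 : R) < n.+1%:R^-1 by rewrite invr_gt0.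
  have [r [x Ax xr] rlt] := inf_adherent n0 D0.
  by exists x; split=> // y Ay; rewrite (le_trans (xr y Ay))// ltW.
have [x xP] := choice xex.
have [U [UU sU]] := ultra_oo.
have [c xc] : exists c : X, x @ U --> c.
  apply: (@ulim_ex _ _ _ properX U UU x a0 r0).
  by apply: nearW => n; apply: bA => //; case: (xP n).
have Ac : A c.
  apply: (@closed_cvg _ _ U _ x A clA _ c xc).
  by apply: nearW => n; case: (xP n).
have cD y : A y -> mdist c y <= inf D.
  move=> Ay; apply/ler_addgt0Pr => e e0.
  apply: (cvg_mdist_lec xc).
  have : U [set n : nat | (n.+1%:R^-1 : R) <= e] by apply: sU; exact: inv_succ_small.
  by apply: filterS => n /= ne; rewrite (le_trans ((xP n).2 y Ay))// lerD2l.
exists c => // c' r Ac' cr c'r radj.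
have half01 : 0 <= (2^-1 : R) <= 1 by lra.
have rD : r <= inf D.
  apply/ler_addgt0Pr => e /radj[y Ay] ry.
  have := cD y Ay; move: ry; lra.
(* If [c'] differed from [c], CN would give the midpoint [m] a radius strictly below [r], although
   [r <= inf D]. *)
pose m := gpt c c' 2^-1.
have Am : A m by exact: cvA.
apply/eqP; apply/negPn/negP => /eqP ne.
have d0 : 0 < mdist c c'.
  by rewrite mdist_gt0; apply/eqP => h; apply: ne.
have r00 : 0 <= r by rewrite (le_trans _ (cr c Ac))// mdist_ge0.
pose q := r ^+ 2 - 4^-1 * mdist c c' ^+ 2.
have mq y : A y -> mdist m y ^+ 2 <= q.
  move=> Ay; apply: (le_trans (CN_ineq CAT0X c c' y half01)).
  have h1 : mdist c y ^+ 2 <= r ^+ 2 by rewrite lerXn2r ?nnegrE ?mdist_ge0// cr.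
  have h2 : mdist c' y ^+ 2 <= r ^+ 2 by rewrite lerXn2r ?nnegrE ?mdist_ge0// c'r.
  by rewrite /q; move: h1 h2; lra.
have q0 : 0 <= q by apply: le_trans (mq m Am); rewrite sqr_ge0.
have : inf D <= Num.sqrt q.
  apply: ge_inf => //; first by case: D0.
  exists m => // y Ay; rewrite -[leLHS]ger0_norm ?mdist_ge0// -sqrtr_sqr.
  by rewrite ler_sqrt ?mq.
have : Num.sqrt q < r.
  rewrite -(ger0_norm r00) -sqrtr_sqr ltr_sqrt.
    by rewrite /q ltrBlDr ltrDl mulr_gt0// exprn_gt0.
  rewrite lt_neqAle sqr_ge0 andbT eq_sym sqrf_eq0; apply/eqP => r0'.
  by have := cr c' Ac'; rewrite r0' leNgt d0.
by move=> h1 h2; have := lt_le_trans (le_lt_trans h2 h1) rD; rewrite ltxx.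
Qed.

(** The distance from [g h c] to [y] is the distance from [c] to [g' h y], so [g h c] has the same
    radius as [c]. *)
Lemma circumcenter_fixed (A : set X) (r0 : R) (F : Type) (g g' : F -> X -> X) :
  A !=set0 -> closed A -> gconvex A ->
  (forall x y, A x -> A y -> mdist x y <= r0) ->
  (forall h x, A x -> A (g h x)) -> (forall h x, A x -> A (g' h x)) ->
  (forall h x y, A x -> A y -> mdist (g h x) (g h y) = mdist x y) ->
  (forall h x, A x -> g h (g' h x) = x) ->
  exists2 c, A c & forall h, g h c = c.
Proof.
move=> A0 clA cvA bA Ag Ag' gi gK.
have [c Ac cP] := circumcenter_ex A0 clA cvA bA.
exists c => // h; pose D := [set mdist c y | y in A].
have D0 : has_sup D.
  split; first by exists (mdist c c); exists c.
  by exists r0 => _ [y Ay <-]; exact: bA.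
apply: (cP _ (sup D)); first exact: Ag.
- by move=> y Ay; apply: ub_le_sup; [case: D0|exists y].
- move=> y Ay; rewrite -(gK h y)// gi//; last exact: Ag'.
  by apply: ub_le_sup; [case: D0|exists (g' h y) => //; exact: Ag'].
- by move=> e e0; have [_ [y Ay <-] ?] := sup_adherent e0 D0; exists y.
Qed.

End circumcenter.

(** * Barycentres of positive functionals *)

(** An axiomatic class of integrands: the same theory of barycentres serves the averages [Lam] and
    the finite sums over [Gamma] that define the base map. *)
Record admissible (R : realType) (X : metricType R) (W : Type)
    (adm : set (W -> R)) (Q : set (W -> X)) : Prop := Admissible {
  adm_cst : forall c, adm (fun=> c) ;
  adm_lin : forall (a : R) F F', adm F -> adm F' -> adm (fun w => a * F w + F' w) ;
  Q_cst : forall x, Q (fun=> x) ;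
  Q_dist : forall q q', Q q -> Q q' -> adm (fun w => mdist (q w) (q' w)) ;
  Q_dist2 : forall q q', Q q -> Q q' -> adm (fun w => mdist (q w) (q' w) ^+ 2)
}.

(** [S] stands for a set that carries the measure. *)
Record posfun (R : realType) (W : Type) (adm : set (W -> R)) (S : set W)
    (L : (W -> R) -> R) : Prop := Posfun {
  posfun_lin : forall (a : R) F F', adm F -> adm F' ->
    L (fun w => a * F w + F' w) = a * L F + L F' ;
  posfun_mono : forall F F', adm F -> adm F' ->
    (forall w, S w -> F w <= F' w) -> L F <= L F' ;
  posfun_mass : 0 < L (fun=> 1)
}.

Definition mass (R : realType) (W : Type) (L : (W -> R) -> R) : R := L (fun=> 1).

(** Defined by the variance inequality rather than as a minimizer of the second moment: this is the
    form used below, and testing it on two candidates gives uniqueness. [x0] is a default value. *)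
Definition bar (R : realType) (X : metricType R) (W : Type) (x0 : X)
    (L : (W -> R) -> R) (q : W -> X) : X :=
  xget x0 [set b | forall x,
    L (fun w => mdist b (q w) ^+ 2) + mass L * mdist x b ^+ 2 <=
    L (fun w => mdist x (q w) ^+ 2)].

Section positive_functionals.
Context {R : realType} {W : Type} {adm : set (W -> R)} {S : set W}.
Hypothesis adm_cst : forall c, adm (fun=> c).
Hypothesis adm_lin : forall (a : R) F F', adm F -> adm F' ->
  adm (fun w => a * F w + F' w).

Lemma adm0 : adm (fun=> 0). Proof. exact: adm_cst. Qed.

Lemma adm_scale a F : adm F -> adm (fun w => a * F w).
Proof.
move=> aF; rewrite (_ : (fun _ => _) = (fun w => a * F w + 0)).
  by apply: adm_lin => //; exact: adm0.
by apply/funext => w; rewrite addr0.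
Qed.

Lemma adm_add F F' : adm F -> adm F' -> adm (fun w => F w + F' w).
Proof.
move=> aF aF'; rewrite (_ : (fun _ => _) = (fun w => 1 * F w + F' w)).
  exact: adm_lin.
by apply/funext => w; rewrite mul1r.
Qed.

Lemma adm_sub F F' : adm F -> adm F' -> adm (fun w => F w - F' w).
Proof.
move=> aF aF'; rewrite (_ : (fun _ => _) = (fun w => -1 * F' w + F w)).
  exact: adm_lin.
by apply/funext => w; rewrite mulN1r addrC.
Qed.

Context {L : (W -> R) -> R} (posL : posfun adm S L).

Lemma posfunD F F' : adm F -> adm F' -> L (fun w => F w + F' w) = L F + L F'.
Proof.
move=> aF aF'; rewrite -[in RHS](mul1r (L F)) -(posfun_lin posL)//.
by congr L; apply/funext => w; rewrite mul1r.
Qed.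

Lemma posfun0 : L (fun=> 0) = 0.
Proof.
have := posfunD adm0 adm0.
rewrite (_ : (fun _ => 0 + 0) = (fun=> 0)); last by apply/funext => w; rewrite addr0.
by move=> /eqP; rewrite -[in X in X == _](addr0 (L _)) eq_sym (inj_eq (addrI _)) => /eqP.
Qed.

Lemma posfunZ a F : adm F -> L (fun w => a * F w) = a * L F.
Proof.
move=> aF; rewrite -[RHS]addr0 -posfun0 -(posfun_lin posL)//.
by congr L; apply/funext => w; rewrite addr0.
Qed.

Lemma posfunB F F' : adm F -> adm F' -> L (fun w => F w - F' w) = L F - L F'.
Proof.
move=> aF aF'; rewrite [in RHS]addrC -[in RHS]mulN1r -(posfun_lin posL)//.
by congr L; apply/funext => w; rewrite mulN1r addrC.
Qed.

Lemma posfun_cst c : L (fun=> c) = c * mass L.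
Proof.
rewrite /mass -posfunZ; last exact: adm_cst.
by congr L; apply/funext => w; rewrite mulr1.
Qed.

Lemma posfun_ge0 F : adm F -> (forall w, S w -> 0 <= F w) -> 0 <= L F.
Proof.
by move=> aF F0; rewrite -posfun0; apply: (posfun_mono posL) => //; exact: adm0.
Qed.

Lemma posfun_le F c : adm F -> (forall w, S w -> F w <= c) -> L F <= c * mass L.
Proof. by move=> aF Fc; rewrite -posfun_cst; apply: (posfun_mono posL). Qed.

End positive_functionals.

Section barycentre.
Context {R : realType} {X : metricType R} (properX : proper_space X) (CAT0X : CAT0 X).
Context {W : Type} {adm : set (W -> R)} {Q : set (W -> X)} {S : set W}.
Hypothesis admQ : admissible adm Q.
Implicit Types (q : W -> X) (x b : X) (L : (W -> R) -> R).

Let acst := adm_cst admQ.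
Let alin := adm_lin admQ.

Lemma Q_dl2 x q : Q q -> adm (fun w => mdist x (q w) ^+ 2).
Proof. by move=> Qq; apply: (Q_dist2 admQ (Q_cst admQ x) Qq). Qed.

(** A minimizing sequence is bounded, because its squared distance to [x0] is controlled by second
    moments; its ultralimit is a minimizer by [tri]. *)
Lemma bar_min L q (x0 : X) : posfun adm S L -> Q q ->
  exists b, forall x, L (fun w => mdist b (q w) ^+ 2) <= L (fun w => mdist x (q w) ^+ 2).
Proof.
move=> pL Qq; pose Psi x := L (fun w => mdist x (q w) ^+ 2).
pose m := inf (range Psi).
have l0 : 0 < mass L := posfun_mass pL.
have Psi0 x : 0 <= Psi x.
  rewrite /Psi; apply: (posfun_ge0 acst pL); first exact: Q_dl2.
  by move=> w _; exact: sqr_ge0.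
have hi : has_inf (range Psi).
  by split; [exists (Psi x0); exists x0|exists 0 => _ [x _ <-]; exact: Psi0].
have m0 : 0 <= m by apply: lb_le_inf; [case: hi|move=> _ [x _ <-]; exact: Psi0].
have xex n : exists x, Psi x <= m + n.+1%:R^-1.
  have n0 : (0 : R) < n.+1%:R^-1 by rewrite invr_gt0.
  by have [_ [x _ <-] xlt] := inf_adherent n0 hi; exists x; exact: ltW.
have [x xP] := choice xex.
have [U [UU sU]] := ultra_oo.
(* From [(a + c)^2 <= (1 + e) c^2 + (1 + e^-1) a^2]. It gives the lower semicontinuity of [Psi]. *)
have tri e y z : 0 < e -> Psi y <= (1 + e) * Psi z + (1 + e^-1) * (mass L * mdist y z ^+ 2).
  move=> e0; have -> : (1 + e) * Psi z + (1 + e^-1) * (mass L * mdist y z ^+ 2) =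
      L (fun w => (1 + e) * mdist z (q w) ^+ 2 + (1 + e^-1) * mdist y z ^+ 2).
    by rewrite (posfun_lin pL) ?(posfun_cst acst pL)//; [rewrite /Psi; ring|exact: Q_dl2].
  apply: (posfun_mono pL) => [||w _]; first exact: Q_dl2.
    by apply: alin => //; exact: Q_dl2.
  have h1 : mdist y (q w) ^+ 2 <= (mdist y z + mdist z (q w)) ^+ 2.
    by rewrite lerXn2r ?nnegrE ?addr_ge0 ?mdist_ge0// metric_triangle.
  apply: (le_trans h1).
  set a := mdist y z; set c := mdist z _.
  have : 0 <= (e * c - a) ^+ 2 * e^-1 by rewrite mulr_ge0 ?sqr_ge0// invr_ge0 ltW.
  have -> : (e * c - a) ^+ 2 * e^-1 = e * c ^+ 2 - 2 * a * c + e^-1 * a ^+ 2.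
    by field; rewrite gt_eqF.
  by lra.
have [b xb] : exists b : X, x @ U --> b.
  pose r := Num.sqrt ((2 * (m + 1) + 2 * Psi x0) / mass L).
  apply: (@ulim_ex _ _ _ properX U UU x x0 r).
  apply: nearW => n.
  rewrite /r -[leLHS]ger0_norm ?mdist_ge0// -sqrtr_sqr ler_sqrt; last first.
    by apply: divr_ge0; [have := Psi0 x0; lra|exact: ltW].
  rewrite ler_pdivlMr// mulrC.
  have -> : mass L * mdist x0 (x n) ^+ 2 = L (fun=> mdist x0 (x n) ^+ 2).
    by rewrite (posfun_cst acst pL) mulrC.
  have h : L (fun=> mdist x0 (x n) ^+ 2) <= L (fun w => 2 * mdist (x n) (q w) ^+ 2 + 2 * mdist x0 (q w) ^+ 2).
    apply: (posfun_mono pL) => [||w _]; first exact: acst.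
      by apply: alin; [exact: Q_dl2|apply: (adm_scale acst alin); exact: Q_dl2].
    have h1 : mdist x0 (x n) ^+ 2 <= (mdist x0 (q w) + mdist (x n) (q w)) ^+ 2.
      rewrite lerXn2r ?nnegrE ?addr_ge0 ?mdist_ge0//.
      by rewrite (metric_sym (x n)) metric_triangle.
    apply: (le_trans h1); have := sqr_ge0 (mdist x0 (q w) - mdist (x n) (q w)).
    by lra.
  apply: (le_trans h); rewrite (posfun_lin pL); last 2 first.
  - exact: Q_dl2.
  - by apply: (adm_scale acst alin); exact: Q_dl2.
  rewrite (posfunZ acst pL); last exact: Q_dl2.
  have : n.+1%:R^-1 <= (1 : R) by rewrite invf_le1// ler1n.
  have := xP n; rewrite /Psi; move: n.+1%:R^-1 => v; lra.
exists b => y; rewrite -/(Psi b) -/(Psi y).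
apply: (@le_trans _ _ m); last by apply: ge_inf; [case: hi|exists y].
apply/ler_addgt0Pr => e e0.
(* When [tri] is applied with a parameter [d <= 1], the excess over [m] is at most [d * K]. *)
pose K := m + 2 + 2 * mass L.
have K0 : 0 < K by rewrite /K addr_gt0// ?mulr_gt0// ltr_wpDl.
pose d := Num.min 1 (e / K).
have d0 : 0 < d by rewrite /d lt_min ltr01 divr_gt0.
have d1 : d <= 1 by rewrite /d ge_min lexx.
have dK : d * K <= e by rewrite -ler_pdivlMr// /d ge_min lexx orbT.
have [n [h1 h2]] : exists n, Psi (x n) <= m + d /\ mdist b (x n) <= d.
  have h1 : \forall n \near U, mdist b (x n) <= d.
    by move/cvg_mdistP: xb => /(_ _ d0); apply: filterS => n /ltW.
  have h2 : \forall n \near U, n.+1%:R^-1 <= d by apply: sU; exact: inv_succ_small.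
  have [n [? ?]] := filter_ex (filterI h1 h2); exists n; split=> //.
  by rewrite (le_trans (xP n))// lerD2l.
apply: (le_trans (tri d b (x n) d0)).
have h3 : mdist b (x n) ^+ 2 <= d ^+ 2 by rewrite lerXn2r ?nnegrE ?mdist_ge0// ltW.
have h4 : (1 + d) * Psi (x n) <= (1 + d) * (m + d).
  by rewrite ler_wpM2l// addr_ge0// ltW.
have h5 : (1 + d^-1) * (mass L * mdist b (x n) ^+ 2) <= (1 + d^-1) * (mass L * d ^+ 2).
  apply: ler_wpM2l; first by rewrite addr_ge0// invr_ge0 ltW.
  by apply: ler_wpM2l => //; exact: ltW.
have h6 : (1 + d^-1) * (mass L * d ^+ 2) = mass L * (d ^+ 2 + d).
  by field; rewrite gt_eqF.
have dd : d ^+ 2 <= d by rewrite expr2 ler_piMl// ltW.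
have h7 : mass L * (d ^+ 2 + d) <= mass L * (2 * d).
  by apply: ler_wpM2l; [exact: ltW|move: dd; lra].
have h8 : d * K = d * m + 2 * d + 2 * (mass L * d) by rewrite /K; ring.
by move: h4 h5 dK h7 dd; rewrite h6 h8; lra.
Qed.

Lemma barP L q (x0 : X) : posfun adm S L -> Q q -> forall x,
  L (fun w => mdist (bar x0 L q) (q w) ^+ 2) + mass L * mdist x (bar x0 L q) ^+ 2 <=
  L (fun w => mdist x (q w) ^+ 2).
Proof.
move=> pL Qq; rewrite /bar; case: xgetP => [b _ //|H].
exfalso; have [b bP] := bar_min x0 pL Qq; apply: (H b) => x /=.
have l0 : 0 < mass L := posfun_mass pL.
set Pb := L _; set Px := L _.
(* The minimizer [b] is compared with [gpt b x t], where integrating CN gains the squared distance;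
   afterwards [t] tends to 0. *)
have key t : 0 < t < 1 -> (1 - t) * (mass L * mdist b x ^+ 2) <= Px - Pb.
  move=> /andP[t0 t1]; have t01 : 0 <= t <= 1 by rewrite !ltW.
  have : Pb <= (1 - t) * Pb + t * Px - t * (1 - t) * (mass L * mdist b x ^+ 2).
    apply: (le_trans (bP (gpt b x t))).
    have -> : (1 - t) * Pb + t * Px - t * (1 - t) * (mass L * mdist b x ^+ 2) =
      L (fun w => (1 - t) * mdist b (q w) ^+ 2 + (t * mdist x (q w) ^+ 2 + (- (t * (1 - t) * mdist b x ^+ 2)))).
      rewrite !(posfun_lin pL) ?(posfun_cst acst pL)//; first by rewrite -/Pb -/Px; ring.
      - exact: Q_dl2.
      - exact: Q_dl2.
      - by apply: alin => //; exact: Q_dl2.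
    apply: (posfun_mono pL) => [||w _]; first exact: Q_dl2.
      by do 2 (apply: alin; first exact: Q_dl2).
    by rewrite addrA; exact: CN_ineq.
  move=> h; rewrite -(ler_pM2l t0).
  by move: h; lra.
rewrite -lerBrDl metric_sym; apply/ler_addgt0Pr => e e0.
set D := mass L * _ in key *.
have D0 : 0 <= D by rewrite mulr_ge0 ?sqr_ge0// ltW.
pose t := Num.min 2^-1 (e / (D + 1)).
have t0 : 0 < t by rewrite lt_min invr_gt0 ltr0n/= divr_gt0// ltr_wpDl.
have t1 : t < 1 by rewrite /t gt_min; apply/orP; left; lra.
have tD : t * (D + 1) <= e by rewrite -ler_pdivlMr ?ltr_wpDl// /t ge_min lexx orbT.
have := key t; rewrite t0 t1 => /(_ isT).
by move: tD; lra.
Qed.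

(** The quadruple inequality for [b], [b'], [q' w], [q w] is integrated and combined with the two
    variance inequalities, each tested at the other barycentre. *)
Lemma bar_nonexp L q q' (x0 : X) : posfun adm S L -> Q q -> Q q' ->
  mass L * mdist (bar x0 L q) (bar x0 L q') <= L (fun w => mdist (q w) (q' w)).
Proof.
move=> pL Qq Qq'; set b := bar _ _ q; set b' := bar _ _ q'.
have l0 : 0 < mass L := posfun_mass pL.
have [->|bn] := eqVneq (mdist b b') 0.
  rewrite mulr0; apply: (posfun_ge0 acst pL) => [|w _]; last exact: mdist_ge0.
  exact: (Q_dist admQ).
have b0 : 0 < mdist b b' by rewrite lt_neqAle eq_sym bn mdist_ge0.
have H1 := barP x0 pL Qq b'; have H2 := barP x0 pL Qq' b.
rewrite -/b -/b' in H1 H2.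
have : L (fun w => mdist b (q' w) ^+ 2 + mdist b' (q w) ^+ 2) <=
  L (fun w => (2 * mdist b b') * mdist (q w) (q' w) + (mdist b (q w) ^+ 2 + mdist b' (q' w) ^+ 2)).
  apply: (posfun_mono pL) => [||w _].
  - by apply: (adm_add alin); exact: Q_dl2.
  - by apply: alin; [exact: (Q_dist admQ)|apply: (adm_add alin); exact: Q_dl2].
  - have := quadruple CAT0X b b' (q' w) (q w).
    by rewrite (metric_sym (q' w)); lra.
rewrite (posfun_lin pL); last 2 first.
- exact: (Q_dist admQ).
- by apply: (adm_add alin); exact: Q_dl2.
rewrite !(posfunD pL); try exact: Q_dl2.
rewrite (metric_sym b' b) in H1.
move=> H; rewrite -(ler_pM2l b0).
by move: H1 H2 H; lra.
Qed.

(** Each variance inequality is tested at the other barycentre. The right-hand side evaluates the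
    difference of two functionals at a single function, so it is small when the weights are
    close. *)
Lemma bar_weights L L' q (x0 : X) : posfun adm S L -> posfun adm S L' -> Q q ->
  (mass L + mass L') * mdist (bar x0 L q) (bar x0 L' q) ^+ 2 <=
  L (fun w => mdist (bar x0 L' q) (q w) ^+ 2 - mdist (bar x0 L q) (q w) ^+ 2) -
  L' (fun w => mdist (bar x0 L' q) (q w) ^+ 2 - mdist (bar x0 L q) (q w) ^+ 2).
Proof.
move=> pL pL' Qq; set b := bar _ L q; set b' := bar _ L' q.
have H1 := barP x0 pL Qq b'; have H2 := barP x0 pL' Qq b.
rewrite -/b -/b' in H1 H2.
rewrite (posfunB pL) ?(posfunB pL')//; try exact: Q_dl2.
rewrite (metric_sym b') in H1.
by move: H1 H2; lra.
Qed.

(** In the equality case of [bar_nonexp] every quadruple is a parallelogram. *)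
Lemma bar_parallel L q q' (x0 : X) (D : R) :
  posfun adm S L -> Q q -> Q q' -> (forall w, mdist (q w) (q' w) = D) ->
  mdist (bar x0 L q) (bar x0 L q') = D ->
  exists F, [/\ adm F, (forall w, 0 <= F w), L F <= 0 &
    forall w, F w = 0 -> mdist (bar x0 L q) (q w) = mdist (bar x0 L q') (q' w)].
Proof.
move=> pL Qq Qq' qD; set b := bar _ _ q; set b' := bar _ _ q' => bD.
(* The defect in the quadruple inequality for [b], [b'], [q' w], [q w]; the two variance
   inequalities make its integral nonpositive. *)
pose F w := 2 * D ^+ 2 + ((mdist b (q w) ^+ 2 + mdist b' (q' w) ^+ 2) -
   (mdist b (q' w) ^+ 2 + mdist b' (q w) ^+ 2)).
have H1 := barP x0 pL Qq b'; have H2 := barP x0 pL Qq' b.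
rewrite -/b -/b' in H1 H2.
rewrite (metric_sym b') bD in H1; rewrite bD in H2.
have aS : adm (fun w => mdist b (q w) ^+ 2 + mdist b' (q' w) ^+ 2).
  by apply: (adm_add alin); exact: Q_dl2.
have aS' : adm (fun w => mdist b (q' w) ^+ 2 + mdist b' (q w) ^+ 2).
  by apply: (adm_add alin); exact: Q_dl2.
exists F; split.
- by apply: (adm_add alin) => //; exact: (adm_sub alin).
- move=> w; have := quadruple CAT0X b b' (q' w) (q w).
  by rewrite (metric_sym (q' w)) qD bD /F; lra.
- rewrite /F (posfunD pL)//; last exact: (adm_sub alin).
  rewrite (posfun_cst acst pL) (posfunB pL)//.
  rewrite !(posfunD pL); try exact: Q_dl2.
  by move: H1 H2; lra.
(* The same quadrilateral with the other pair of opposite sides in the product: together with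
   [F w = 0], the square of the difference of these two sides is at most 0. *)
- move=> w F0; have := quadruple CAT0X b' (q' w) (q w) b.
  rewrite (metric_sym (q' w) (q w)) qD (metric_sym b' b) bD (metric_sym (q' w) b) (metric_sym (q w) b).
  move=> h; apply/eqP; rewrite -subr_eq0 -sqrf_eq0 eq_le sqr_ge0 andbT.
  by move: F0 h; rewrite /F; lra.
Qed.

End barycentre.

(** * The boundary at infinity *)

Section cone_topology.
Context {R : realType} {X : metricType R}.
Implicit Types (c : ray X) (xi : boundary X).

Definition ray_of (c : R -> X) (cP : forall s t, 0 <= s -> 0 <= t ->
  mdist (c s) (c t) = `|s - t|) : ray X := Ray (asboolT cP).

Lemma pi_boundaryP c c' :
  (\pi_(boundary X) c)%qT = (\pi_(boundary X) c')%qT <-> asymptotic c c'.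
Proof.
by split=> [/eqmodP //|h]; apply/eqmodP.
Qed.

Lemma boundary_repr xi : exists c, (\pi_(boundary X) c)%qT = xi.
Proof. by exists (repr xi); rewrite reprK. Qed.

Lemma asymptoticP c c' : asymptotic c c' <->
  exists K : R, forall t, 0 <= t -> mdist (c t) (c' t) <= K.
Proof. by split=> [/asboolP|h]; [|apply/asboolP]. Qed.

Lemma open_cone_subbase (U : set (boundary X)) : cone_subbase U -> open U.
Proof.
move=> cU; exists [set U]; last by rewrite bigcup_set1.
by move=> _ ->; exact: finI_from1.
Qed.

Lemma cvg_cone (F : set_system (boundary X)) xi : Filter F ->
  (forall U, cone_subbase U -> U xi -> F U) -> F --> xi.
Proof.
move=> FF H A; rewrite nbhsE => -[B [oB Bxi] BA].
apply: filterS BA _; case: oB Bxi => D' D'f <- [V D'V Vxi].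
have [E Esub EV] := D'f V D'V.
have FV : F V.
  rewrite -EV; apply: filter_bigI => W EW; apply: H; first by have := Esub W EW; rewrite inE.
  by move: Vxi; rewrite -EV => /(_ W EW).
by apply: filterS FV => y Vy; exists V.
Qed.

Lemma boundary_act_pi (g : isom_group X) c :
  boundary_act g (\pi_(boundary X) c)%qT = (\pi_(boundary X) (ray_act g c))%qT.
Proof.
apply/pi_boundaryP/asymptoticP.
have /asymptoticP[K cK] : asymptotic (repr (\pi_(boundary X) c)%qT) c.
  by apply/pi_boundaryP; rewrite reprK.
by exists K => t t0 /=; rewrite isom_mdist; exact: cK.
Qed.

Lemma boundary_actM (g h : isom_group X) xi :
  boundary_act (g * h)%g xi = boundary_act g (boundary_act h xi).
Proof.
have [c <-] := boundary_repr xi; rewrite !boundary_act_pi.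
by apply/pi_boundaryP/asymptoticP; exists 0 => t _ /=; rewrite mdistxx.
Qed.

Lemma boundary_act1 xi : boundary_act 1%g xi = xi.
Proof.
have [c <-] := boundary_repr xi; rewrite boundary_act_pi.
by apply/pi_boundaryP/asymptoticP; exists 0 => t _ /=; rewrite mdistxx.
Qed.

End cone_topology.

(** * Rays, limits of segments and fixed points at infinity *)

Section rays.
Context {R : realType} {X : metricType R} (properX : proper_space X) (CAT0X : CAT0 X).
Implicit Types (c : ray X) (xi : boundary X) (A : set X).

Lemma ray_gpt c t T : 0 <= t <= T -> 0 < T -> c t = gpt (c 0) (c T) (t / T).
Proof.
move=> /andP[t0 tT] T0.
have d0T : mdist (c 0) (c T) = T by rewrite rayP ?lexx// ?ltW// sub0r normrN gtr0_norm.
apply: gpt_unique => //; rewrite ?d0T.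
- by rewrite divr_ge0 ?(ltW T0)//= ler_pdivrMr// mul1r.
- by rewrite divfK ?gt_eqF// rayP ?lexx// sub0r normrN ger0_norm.
- by rewrite mulrBl mul1r divfK ?gt_eqF// rayP ?(ltW T0)// distrC ger0_norm ?subr_ge0.
Qed.

(** Convexity between the times 0 and [T]: the distance at [T] is at most [K] and enters with the
    factor [t / T], so a large [T] makes it negligible. *)
Lemma asymptotic_dist c c' t : asymptotic c c' -> 0 <= t ->
  mdist (c t) (c' t) <= mdist (c 0) (c' 0).
Proof.
move=> /asymptoticP[K cK] t0.
have K0 : 0 <= K by apply: le_trans (cK 0 (lexx _)); exact: mdist_ge0.
apply/ler_addgt0Pr => e e0; pose T := t + t * K / e + 1.
have tKe : 0 <= t * K / e by rewrite divr_ge0 ?mulr_ge0// ltW.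
have T0 : 0 < T by rewrite ltr_wpDl// addr_ge0.
have tT : 0 <= t <= T by rewrite t0 /T -addrA lerDl addr_ge0.
have tT1 : 0 <= t / T <= 1.
  by rewrite divr_ge0 ?(ltW T0)//= ler_pdivrMr// mul1r; case/andP: tT.
rewrite (ray_gpt c tT T0) (ray_gpt c' tT T0).
apply: (le_trans (gpt_convex CAT0X _ _ _ _ tT1)).
have h1 : t / T * mdist (c T) (c' T) <= t / T * K.
  by apply: ler_wpM2l; [case/andP: tT1|apply: cK; exact: ltW].
have h2 : t / T * K <= e.
  rewrite mulrAC ler_pdivrMr// mulrC /T mulrC mulrDr mulrDr mulrCA divff ?gt_eqF// mulr1 mulr1.
  have : 0 <= e * t by rewrite mulr_ge0// ltW.
  by move: e0; lra.
have h3 : (1 - t / T) * mdist (c 0) (c' 0) <= mdist (c 0) (c' 0).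
  rewrite ler_piMl ?mdist_ge0//.
  by case/andP: tT1; lra.
by move: h1 h2 h3; lra.
Qed.

Lemma asymptotic_same_origin c c' t : asymptotic c c' -> c 0 = c' 0 -> 0 <= t ->
  c t = c' t.
Proof.
move=> cc' c0 t0; apply: mdist_positivity; apply/eqP.
rewrite eq_le mdist_ge0 andbT (le_trans (asymptotic_dist cc' t0))//.
by rewrite c0 mdistxx.
Qed.

(** The ray is the pointwise ultralimit of the segments from [p] to the escaping points. The
    convergence is part of the statement because asymptotic properties of the ray are proved on the
    segments. *)
Lemma ray_of_segments (J : Type) (U : set_system J) (UU : UltraFilter U) (p : X)
    (x : J -> X) A : (forall B : R, \forall i \near U, B <= mdist p (x i)) ->
  closed A -> gconvex A -> A p -> (forall i, A (x i)) ->
  exists c : ray X, [/\ c 0 = p, forall t, 0 <= t -> A (c t) &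
    forall s, 0 <= s -> (fun i => gpt p (x i) (s / mdist p (x i))) @ U --> c s].
Proof.
move=> xoo clA cvA Ap Ax.
pose y s i := gpt p (x i) (s / mdist p (x i)).
have s01 s i : 0 <= s -> 0 < mdist p (x i) -> s <= mdist p (x i) -> 0 <= s / mdist p (x i) <= 1.
  move=> s0 d0 sd; rewrite divr_ge0 ?mdist_ge0//=.
  by rewrite ler_pdivrMr// mul1r.
have big s : \forall i \near U, s <= mdist p (x i) /\ 0 < mdist p (x i).
  near=> i; have : 1 + `|s| <= mdist p (x i) by near: i; exact: xoo.
  have := normr_ge0 s; have := ler_norm s; lra.
have lim s : exists a : X, 0 <= s -> (y s) @ U --> a.
  have [s0|] := leP 0 s; last by exists p.
  have [a ya] : exists a : X, y s @ U --> a.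
    apply: (@ulim_ex _ _ _ properX U UU (y s) p s).
    near=> i; have [sd d0] : s <= mdist p (x i) /\ 0 < mdist p (x i) by near: i; exact: big.
    have [-> _] := gptP CAT0X p (x i) (s01 s i s0 d0 sd).
    by rewrite divfK// gt_eqF.
  by exists a.
have [c cP] := choice lim.
have cray s t : 0 <= s -> 0 <= t -> mdist (c s) (c t) = `|s - t|.
  move=> s0 t0.
  have H : \forall i \near U, mdist (y s i) (y t i) = `|s - t|.
    near=> i; have [sd d0] : s <= mdist p (x i) /\ 0 < mdist p (x i) by near: i; exact: big.
    have [td _] : t <= mdist p (x i) /\ 0 < mdist p (x i) by near: i; exact: big.
    rewrite gpt_dist//; try exact: s01.
    by rewrite -mulrBl normrM normfV (gtr0_norm d0) divfK// gt_eqF.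
  apply/eqP; rewrite eq_le; apply/andP; split.
    by apply: (cvg_mdist_le (cP s s0) (cP t t0)); apply: filterS H => i ->.
  by apply: (cvg_mdist_ge (cP s s0) (cP t t0)); apply: filterS H => i ->.
exists (ray_of cray); split=> //=.
- have h := cP 0 (lexx _).
  apply: (cvg_unique_mdist h); apply/cvg_mdistP => e e0; apply: nearW => i.
  by rewrite /y mul0r gpt0// mdistxx.
- move=> t t0; apply: (@closed_cvg _ _ U _ (y t) A clA _ (c t) (cP t t0)).
  near=> i; have [sd d0] : t <= mdist p (x i) /\ 0 < mdist p (x i) by near: i; exact: big.
  by apply: cvA => //; exact: s01.
Unshelve. all: by end_near. Qed.

(** The new ray is a limit of segments from [o] to [c n]. In the bound [2 d(o, c 0)], one term comes
    from moving the initial point of the segment, the other from the difference between its length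
    and [n]. *)
Lemma asymptotic_ray_ex A c (o : X) : closed A -> gconvex A ->
  (forall t, 0 <= t -> A (c t)) -> A o ->
  exists c' : ray X, [/\ c' 0 = o, asymptotic c' c & forall t, 0 <= t -> A (c' t)].
Proof.
move=> clA cvA Ac Ao; have [U [UU sU]] := ultra_oo.
pose x (n : nat) := c n%:R.
have n0 (n : nat) : 0 <= (n%:R : R) by rewrite ler0n.
have xd (n : nat) : `|n%:R - mdist o (x n)| <= mdist o (c 0).
  have E : mdist (c 0) (x n) = n%:R.
    by rewrite rayP ?lexx// sub0r normrN ger0_norm.
  rewrite -{1}E ler_norml; apply/andP; split.
    by have := metric_triangle o (c 0) (x n); lra.
  by have := metric_triangle (c 0) o (x n); rewrite (metric_sym (c 0) o); lra.
have xoo (B : R) : \forall n \near U, B <= mdist o (x n).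
  have : U [set n : nat | B + mdist o (c 0) <= n%:R].
    by apply: sU; exact: nbhs_infty_ger.
  by apply: filterS => n /= h; have := xd n; rewrite ler_norml => /andP[]; move: h; lra.
have Ax n : A (x n) by exact: Ac.
have [c' [c'0 Ac' c'lim]] := ray_of_segments UU xoo clA cvA Ao Ax.
exists c'; split=> //; apply/asymptoticP; exists (2 * mdist o (c 0)) => s s0.
apply: (cvg_mdist_lec (c'lim s s0)); near=> n.
set L := mdist o (x n).
have [sL L0] : s <= L /\ 0 < L.
  have : 1 + s <= L by rewrite /L; near: n; exact: xoo.
  by move: s0; lra.
have sL01 : 0 <= s / L <= 1 by rewrite divr_ge0 ?(ltW L0)//= ler_pdivrMr// mul1r.
have np : (0 : R) < n%:R by near: n; apply: sU; exact: nbhs_infty_gtr.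
have E : c (n%:R * (s / L)) = gpt (c 0) (x n) (s / L).
  rewrite (@ray_gpt c _ n%:R)//; last first.
    rewrite mulr_ge0//=; last by case/andP: sL01.
    by rewrite ler_piMr//; case/andP: sL01.
  by rewrite mulrAC divff ?gt_eqF// mul1r.
apply: (le_trans (metric_triangle _ (c (n%:R * (s / L))) _)).
have h1 : mdist (gpt o (x n) (s / L)) (c (n%:R * (s / L))) <= mdist o (c 0).
  rewrite E; apply: (le_trans (gpt_convex CAT0X _ _ _ _ sL01)).
  rewrite mdistxx mulr0 addr0 ler_piMl ?mdist_ge0//.
  by case/andP: sL01; lra.
have h2 : mdist (c (n%:R * (s / L))) (c s) <= mdist o (c 0).
  rewrite rayP//; last by rewrite mulr_ge0//; case/andP: sL01.
  have -> : n%:R * (s / L) - s = (n%:R - L) * (s / L).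
    by rewrite mulrBl mulrCA [L * _]mulrC divfK ?gt_eqF// mulrCA.
  rewrite normrM (ger0_norm (_ : 0 <= s / L)); last by case/andP: sL01.
  apply: (@le_trans _ _ `|n%:R - L|); last exact: xd.
  by rewrite ler_piMr//; case/andP: sL01.
by move: h1 h2; set a := mdist (gpt _ _ _) _; set b := mdist (c _) (c s); lra.
Unshelve. all: by end_near. Qed.

Lemma closed_boundary1 xi : closed [set xi].
Proof.
move=> eta Heta /=; have [c cE] := boundary_repr eta.
apply: contrapT => ne.
(* Points of a cone neighbourhood about [c] are classes of rays from [c 0]. Either [xi] has such a
   ray, which differs from [c] at some time [t], or these neighbourhoods all miss [xi]. *)
have [[c' c'0 c'xi]|nex] := pselect (exists2 c' : ray X, c' 0 = c 0 & (\pi_(boundary X) c')%qT = xi).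
- have [t t0 ct] : exists2 t, 0 <= t & c t != c' t.
    apply: contrapT => h; apply: ne; rewrite -cE -c'xi; apply/pi_boundaryP/asymptoticP.
    exists 0 => t t0; have [->|ct] := eqVneq (c t) (c' t); first by rewrite mdistxx.
    by exfalso; apply: h; exists t.
  have tp : 0 < t.
    rewrite lt_neqAle t0 andbT eq_sym; apply/eqP => tE.
    by move: ct; rewrite tE c'0 eqxx.
  have nb : nbhs eta (cone_nbhd c t (mdist (c' t) (c t))).
    apply: open_nbhs_nbhs; split.
      by apply: open_cone_subbase; exists c, t, (mdist (c' t) (c t)); rewrite mdist_gt0 eq_sym.
    by exists c => //=; rewrite mdistxx mdist_gt0 eq_sym.
  have [_ [-> [c'' [/= c''0 c''t] c''E]]] := Heta _ nb.
  move: c''t; rewrite (@asymptotic_same_origin c'' c')// ?ltxx//.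
    by apply/pi_boundaryP; rewrite c''E.
  by rewrite c''0.
- have nb : nbhs eta (cone_nbhd c 1 1).
    apply: open_nbhs_nbhs; split; first by apply: open_cone_subbase; exists c, 1, 1.
    by exists c => //=; rewrite mdistxx.
  have [_ [-> [c'' [/= c''0 c''t] c''E]]] := Heta _ nb.
  by apply: nex; exists c''.
Qed.

(** Convexity: the rays from a common origin are compared far away, where their
    distance is bounded, and the bound is scaled down. *)
Lemma cvg_boundary (J : Type) (F : set_system J) (FF : Filter F) (c : J -> ray X) (c0 : ray X) :
  (forall s, 0 <= s -> (fun i => c i s) @ F --> c0 s) ->
  (fun i => (\pi_(boundary X) (c i))%qT) @ F --> (\pi_(boundary X) c0)%qT.
Proof.
move=> cc0; apply: cvg_cone => _ [c1 [r [e [r0 e0 ->]]]] [c2 [/= c20 c2r] c2E].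
have c2a : asymptotic c2 c0 by apply/pi_boundaryP.
pose o := c1 0; pose d := e - mdist (c2 r) (c1 r).
have d0 : 0 < d by rewrite subr_gt0.
(* [K] bounds the distance of [c3] and [c2] at time [T]: two changes of origin and two errors below
   1. [T] is so large that the factor [r / T] brings [K] below the margin [d]. *)
pose K := 2 * mdist o (c0 0) + 2.
have K0 : 0 < K by rewrite ltr_wpDl// mulr_ge0// mdist_ge0.
pose T := r + 2 * r * K / d.
have T0 : 0 < T by rewrite ltr_pwDl// divr_ge0 ?(ltW d0)// !mulr_ge0// ltW.
have rT : 0 <= r <= T by rewrite ltW//= lerDl divr_ge0 ?(ltW d0)// !mulr_ge0// ltW.
have rT1 : 0 <= r / T <= 1 by rewrite divr_ge0 ?(ltW r0) ?(ltW T0)//= ler_pdivrMr// mul1r; case/andP: rT.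
have rTK : r / T * K < d.
  rewrite mulrAC ltr_pdivrMr// /T (mulrDr d) (mulrCA d) divff ?gt_eqF// mulr1.
  have : 0 < r * K by rewrite mulr_gt0.
  have : 0 < d * r by rewrite mulr_gt0.
  lra.
have h1 : \forall i \near F, mdist (c0 0) (c i 0) < 1.
  by move/cvg_mdistP: (cc0 0 (lexx _)); exact.
have h2 : \forall i \near F, mdist (c0 T) (c i T) < 1.
  by move/cvg_mdistP: (cc0 T (ltW T0)); exact.
apply: filterS2 h1 h2 => i h1 h2.
have [c3 [c30 c3a _]] := asymptotic_ray_ex (@closedT _) (fun _ _ _ _ _ _ => I)
  (fun _ _ => I) (I : [set: X] o) (c := c i).
exists c3 => /=; last by apply/pi_boundaryP.
split=> //.
have D : mdist (c3 r) (c2 r) <= r / T * mdist (c3 T) (c2 T).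
  rewrite (ray_gpt c3 rT T0) (ray_gpt c2 rT T0) c30 c20.
  exact: gpt_convex1.
have a3 := asymptotic_dist c3a (ltW T0).
have a2 := asymptotic_dist c2a (ltW T0).
rewrite c30 in a3; rewrite c20 -/o in a2.
have t1 := metric_triangle o (c0 0) (c i 0).
have t2 := metric_triangle (c3 T) (c i T) (c2 T).
have t3 := metric_triangle (c i T) (c0 T) (c2 T).
rewrite (metric_sym (c0 T) (c2 T)) (metric_sym (c i T) (c0 T)) in t3.
have DK : r / T * mdist (c3 T) (c2 T) <= r / T * K.
  by apply: ler_wpM2l; [case/andP: rT1|rewrite /K; lra].
have t4 := metric_triangle (c3 r) (c2 r) (c1 r).
by move: D DK rTK t4; rewrite /d; lra.
Qed.

(** Convexity scales a sublinear displacement of the points [x i] down to a bounded displacement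
    along the limit ray. *)
Lemma fixed_at_infinity (J : Type) (U : set_system J) (UU : UltraFilter U) (p : X)
    (x : J -> X) (L : set (isom_group X)) :
  (forall B : R, \forall i \near U, B <= mdist p (x i)) ->
  (forall g e, L g -> 0 < e -> \forall i \near U,
     mdist (g (x i)) (x i) <= e * mdist p (x i)) ->
  exists xi, forall g, L g -> boundary_act g xi = xi.
Proof.
move=> xoo xg.
have [c [c0 _ clim]] := ray_of_segments UU xoo (@closedT _) (fun _ _ _ _ _ _ => I) I (fun=> I).
exists (\pi_(boundary X) c)%qT => g Lg; rewrite boundary_act_pi.
apply/pi_boundaryP/asymptoticP; exists (mdist (g p) p + 1) => s s0 /=.
have glim : (fun i => g (gpt p (x i) (s / mdist p (x i)))) @ U --> g (c s).
  apply/cvg_mdistP => e e0; have /cvg_mdistP/(_ e e0) := clim s s0.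
  by apply: filterS => i; rewrite isom_mdist.
apply: (cvg_mdist_le glim (clim s s0)).
(* With this rate the displacement at time [s] exceeds that of [p] by at most [s / (s + 1) <= 1], a
   bound uniform in [s]. *)
have e0 : 0 < (s + 1)^-1 by rewrite invr_gt0 ltr_wpDl.
near=> i; set d := mdist p (x i).
have sd : s + 1 <= d by rewrite /d; near: i; exact: xoo.
have dp : 0 < d by move: s0 sd; lra.
have gd : mdist (g (x i)) (x i) <= (s + 1)^-1 * d by rewrite /d; near: i; exact: xg.
have sd01 : 0 <= s / d <= 1.
  by rewrite divr_ge0 ?(ltW dp)//= ler_pdivrMr// mul1r; move: sd; lra.
rewrite (gpt_isom CAT0X _ _ (isom_mdist g) sd01).
apply: (le_trans (gpt_convex CAT0X _ _ _ _ sd01)).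
have h1 : (1 - s / d) * mdist (g p) p <= mdist (g p) p.
  by rewrite ler_piMl ?mdist_ge0//; case/andP: sd01; lra.
have h2 : s / d * mdist (g (x i)) (x i) <= s / d * ((s + 1)^-1 * d).
  by apply: ler_wpM2l => //; case/andP: sd01.
have h3 : s / d * ((s + 1)^-1 * d) <= 1.
  rewrite mulrCA divfK ?gt_eqF// mulrC ler_pdivrMr ?mul1r ?ltr_wpDl//.
  by rewrite lerDl.
by rewrite lerD// (le_trans h2).
Unshelve. all: by end_near. Qed.

End rays.

(** * The isometry group *)

Section isometry_limits.
Context {R : realType} {X : metricType R}.
Implicit Types (g h : isom_group X).

Lemma isom_invK g x : (g^-1)%g (g x) = x.
Proof. by have := mulVg g => /(congr1 (fun h : isom_group X => h x)). Qed.

Lemma isom_invKV g x : g ((g^-1)%g x) = x.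
Proof. by have := mulgV g => /(congr1 (fun h : isom_group X => h x)). Qed.

Lemma near_mdist (x : X) (e : R) : 0 < e -> \forall y \near x, mdist x y < e.
Proof. by move=> e0; apply/metricType_numDomainType.nbhs_mdistP; exists e. Qed.

Lemma nbhs_mdist_ex (x : X) (O : set X) : nbhs x O ->
  exists2 e : R, 0 < e & forall y, mdist x y < e -> O y.
Proof. by move=> /metricType_numDomainType.nbhs_mdistP[e e0 eO]; exists e. Qed.

(** Isometries are equicontinuous, so pointwise convergence is uniform on compact sets. *)
Lemma cvg_isomP (J : Type) (F : set_system J) (FF : Filter F) (f : J -> isom_group X) g :
  f @ F --> g <-> forall x, (fun i => f i x) @ F --> g x.
Proof.
split=> [fg x|fg].
- have : (fun i => isom_fun (f i)) @ F --> (isom_fun g : {compact-open, X -> X}).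
    apply: cvg_comp fg _.
    exact: (@initial_continuous _ _ (@isom_fun R X : isom_group X -> {compact-open, X -> X})).
  move=> /compact_open_cvgP H O; rewrite nbhsE => -[B [oB Bgx] BO].
  have gB : g @` [set x] `<=` B by move=> _ [_ -> <-].
  have : F [set i | (f i : X -> X) @` [set x] `<=` B] := H [set x] B (@compact_set1 _ x) oB gB.
  move=> HB; suff : F [set i | O (f i x)] by [].
  by apply: filterS HB => i /= fB; apply: BO; apply: fB; exists x.
- have cvgO : (fun i => isom_fun (f i)) @ F --> (isom_fun g : {compact-open, X -> X}).
    apply/compact_open_cvgP => K O cK oO gKO.
    have : \forall i \near F, K `<=` [set x | O (f i x)].
      move/compact_near_coveringP: cK; apply => x Kx.
      have Ogx : nbhs (g x) O by apply: open_nbhs_nbhs; split=> //; apply: gKO; exists x.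
      have [e e0 eO] := nbhs_mdist_ex Ogx.
      have e2 : 0 < e / 2 by rewrite divr_gt0.
      have /cvg_mdistP/(_ _ e2) := fg x.
      move=> H; near=> y i => /=.
      apply: eO; apply: (le_lt_trans (metric_triangle _ (f i x) _)).
      rewrite (isom_mdist (f i)) [ltRHS]splitr ltrD//; first by near: i.
      by near: y; exact: near_mdist.
    by apply: filterS => i KO _ [x Kx <-]; exact: KO.
  move=> A [_ [[B oB <-] Bg] BA].
  have : F [set i | B (isom_fun (f i))] by apply: cvgO; apply: open_nbhs_nbhs.
  move=> HB; suff : F [set i | A (f i)] by [].
  by apply: filterS HB => i; exact: BA.
Unshelve. all: by end_near. Qed.

Lemma closure_isomP (L : set (isom_group X)) g : closure L g <->
  exists F : set_system (isom_group X), [/\ ProperFilter F, F L &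
    forall x, (fun h : isom_group X => h x) @ F --> g x].
Proof.
split=> [Lg|[F [PF FL Fg]] B nB].
- exists (within L (nbhs g)); split.
  + split; last exact: within_filter.
    by rewrite /within /= => H; have [h [Lh]] := Lg _ H; exact.
  + by rewrite /within /=; apply: nearW.
  + apply/(@cvg_isomP _ (within L (nbhs g)) _ id); exact: cvg_within.
- have FB : F B by have /(@cvg_isomP _ F _ id) := Fg; apply.
  by have [h [? ?]] := filter_ex (filterI FL FB); exists h.
Qed.

Lemma closure_isomM (L : set (isom_group X)) g h :
  (forall a b, L a -> L b -> L (a * b)%g) ->
  closure L g -> closure L h -> closure L (g * h)%g.
Proof.
move=> LM /closure_isomP[F [PF FL Fg]] /closure_isomP[G [PG GL Gh]].
apply/closure_isomP; exists ((fun p : isom_group X * isom_group X => (p.1 * p.2)%g) @ (filter_prod F G)).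
split.
- exact: fmap_proper_filter.
- by exists (L, L) => //= -[a b] /= [La Lb]; exact: LM.
- move=> x; apply/cvg_mdistP => e e0.
  have e2 : 0 < e / 2 by rewrite divr_gt0.
  have /cvg_mdistP/(_ _ e2) H1 := Fg (h x).
  have /cvg_mdistP/(_ _ e2) H2 := Gh x.
  exists ([set a : isom_group X | mdist (g (h x)) (a (h x)) < e / 2],
          [set b : isom_group X | mdist (h x) (b x) < e / 2]) => //= -[a b] /= [ab bb].
  apply: (le_lt_trans (metric_triangle _ (a (h x)) _)).
  by rewrite isom_mdist [ltRHS]splitr ltrD.
Qed.

Lemma closure_isomV (L : set (isom_group X)) g :
  (forall a, L a -> L a^-1%g) -> closure L g -> closure L (g^-1)%g.
Proof.
move=> LV /closure_isomP[F [PF FL Fg]]; apply/closure_isomP.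
exists ((fun a : isom_group X => (a^-1)%g) @ F); split.
- exact: fmap_proper_filter.
- suff : F [set a : isom_group X | L (a^-1)%g] by [].
  by apply: filterS FL => a; exact: LV.
- move=> x; apply/cvg_mdistP => e e0.
  have /cvg_mdistP/(_ _ e0) := Fg ((g^-1)%g x).
  apply: filterS => a /=; rewrite isom_invKV -(isom_mdist (a^-1)%g) isom_invK.
  by rewrite metric_sym.
Qed.

(** The inverses satisfy the same bound at [x0] and converge as well; their limit makes the limit of
    [f] surjective. *)
Lemma ulim_isom (properX : proper_space X) (J : Type) (U : set_system J)
    (UU : UltraFilter U) (f : J -> isom_group X) (x0 : X) (r : R) :
  (\forall i \near U, mdist (f i x0) x0 <= r) ->
  exists g, forall x, (fun i => f i x) @ U --> g x.
Proof.
move=> H.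
have lex x : exists y : X, (fun i => f i x) @ U --> y.
  apply: (@ulim_ex _ _ _ properX U UU _ x0 (r + mdist x0 x)).
  apply: filterS H => i fi.
  apply: (le_trans (metric_triangle _ (f i x0) _)).
  by rewrite isom_mdist lerD2r metric_sym.
have [l lP] := choice lex.
have lex' x : exists y : X, (fun i => (f i)^-1%g x) @ U --> y.
  apply: (@ulim_ex _ _ _ properX U UU _ x0 (r + mdist x0 x)).
  apply: filterS H => i fi.
  apply: (le_trans (metric_triangle _ ((f i)^-1%g x0) _)).
  rewrite isom_mdist lerD2r -(isom_mdist (f i)) isom_invKV.
  exact: fi.
have [l' l'P] := choice lex'.
have li x y : mdist (l x) (l y) = mdist x y.
  apply/eqP; rewrite eq_le; apply/andP; split.
    by apply: (cvg_mdist_le (lP x) (lP y)); apply: nearW => i; rewrite isom_mdist.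
  by apply: (cvg_mdist_ge (lP x) (lP y)); apply: nearW => i; rewrite isom_mdist.
have lK y : l (l' y) = y.
  apply: (cvg_unique_mdist (lP (l' y))).
  apply/cvg_mdistP => e e0; have /cvg_mdistP/(_ e e0) := l'P y.
  by apply: filterS => i; rewrite -(isom_mdist (f i)) isom_invKV metric_sym.
have lP' : `[< (forall x y, mdist (l x) (l y) = mdist x y) /\ (forall y, exists x, l x = y) >].
  by apply/asboolP; split=> // y; exists (l' y).
by exists (Isometry lP').
Qed.

End isometry_limits.

(** * Extension through an action on a convex subset *)

Lemma lc_compact_nbhs (T : topologicalType) (x : T) : locally_compact [set: T] ->
  exists V : set T, [/\ nbhs x V, compact V & closed V].
Proof.
move=> lc; have [V nV [cV clV]] := lc x I; exists V; split=> //.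
by move: nV; rewrite /within /=; apply: filterS => y; exact.
Qed.

Lemma lc_regular (T : topologicalType) (x : T) (A : set T) : hausdorff_space T ->
  locally_compact [set: T] -> nbhs x A ->
  exists V : set T, [/\ nbhs x V, compact V, closed V & V `<=` A].
Proof.
move=> hT lc nA; have [V [nV cV clV]] := lc_compact_nbhs x lc.
have [W nW WA] := compact_regular hT cV nV (filterI nA nV).
exists (closure W); split.
- by apply: filterS nW; exact: subset_closure.
- by apply: (subclosed_compact (@closed_closure _ _) cV) => y /WA[].
- exact: closed_closure.
- by move=> y /WA[].
Qed.

(** Baire's theorem for a countable closed cover. If no [B n] had interior points, compact
    neighbourhoods could be nested, each avoiding one more [B n], and a limit of points chosen in
    them would lie in no [B n]. *)
Lemma lc_baire (T : topologicalType) (x0 : T) (B : nat -> set T) :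
  hausdorff_space T -> locally_compact [set: T] -> (forall n, closed (B n)) ->
  (forall x, exists n, B n x) -> exists n (x : T), nbhs x (B n).
Proof.
move=> hT lc clB covB; apply: contrapT => nB.
pose good (V : set T) := [/\ compact V, closed V & exists x : T, nbhs x V].
have step (a : nat * set T) : exists V' : set T, good a.2 ->
    [/\ good V', V' `<=` a.2 & V' `&` B a.1 = set0].
  have [[cV clV [x nx]]|ng] := pselect (good a.2); last by exists set0.
  have [y [Vy nBy]] : exists y : T, nbhs y a.2 /\ ~ B a.1 y.
    apply: contrapT => h; apply: nB; exists a.1, x.
    have : nbhs x (interior a.2) by exact: nbhs_interior.
    apply: filterS => y Vy; apply: contrapT => nBy; apply: h.
    by exists y; split.
  have nO : nbhs y (a.2 `&` ~` B a.1).
    by apply: filterI => //; apply: open_nbhs_nbhs; split=> //; exact: closed_openC.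
  have [W [nW cW clW WA]] := lc_regular hT lc nO.
  exists W => _; split.
  - by split=> //; exists y.
  - by move=> z /WA[].
  - by apply/seteqP; split=> // z [/WA[_ ?] ?].
have [f fP] := choice step.
have [V0 [nV0 cV0 clV0]] := lc_compact_nbhs x0 lc.
pose V := fix V n := if n is k.+1 then f (k, V k) else V0.
have gV n : good (V n).
  elim: n => [|n IH]; first by split=> //; exists x0.
  by have [] := fP (n, V n) IH.
have VS n : V n.+1 `<=` V n by have [] := fP (n, V n) (gV n).
have VB n : V n.+1 `&` B n = set0 by have [] := fP (n, V n) (gV n).
have Vmono n k : V (n + k)%N `<=` V n.
  elim: k => [|k IH]; first by rewrite addn0.
  by rewrite addnS => y /VS /IH.
have xex n : exists x, V n x.
  by have [_ _ [x nx]] := gV n; exists x; exact: nbhs_singleton.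
have [x xP] := choice xex.
have [U [UU sU]] := ultra_oo.
have [p [_ xp]] : V0 `&` [set p | x @ U --> p] !=set0.
  move: cV0; rewrite compact_ultra; apply; first exact: fmap_ultra.
  suff : U [set n | V0 (x n)] by [].
  by apply: nearW => n; apply: (Vmono 0%N n); exact: xP.
have [m Bm] := covB p.
have Vp : V m.+1 p.
  have [_ clV _] := gV m.+1.
  apply: (@closed_cvg _ _ U _ x (V m.+1) clV _ p xp).
  apply: sU; exists m.+1 => // n /= mn; apply: (Vmono m.+1 (n - m.+1)%N).
  by rewrite subnKC.
have : (V m.+1 `&` B m) p by [].
by rewrite VB.
Qed.

Section topological_groups.
Context {K : topGroupType}.
Implicit Types (a b : K).

Lemma cvgM_group (J : Type) (F : set_system J) (FF : Filter F) (f g : J -> K) a b :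
  f @ F --> a -> g @ F --> b -> (fun i => (f i * g i)%g) @ F --> (a * b)%g.
Proof.
move=> fa gb; apply: (@cvg_comp _ _ _ (fun i => (f i, g i)) (fun z : K * K => (z.1 * z.2)%g) F _ _ _
  (@mulg_continuous K (a, b))).
exact: cvg_pair.
Qed.

Lemma cvgV_group (J : Type) (F : set_system J) (FF : Filter F) (f : J -> K) a :
  f @ F --> a -> (fun i => (f i)^-1%g) @ F --> (a^-1)%g.
Proof. by move=> fa; apply: (@cvg_comp _ _ _ f (fun z : K => (z^-1)%g) F _ _ fa (@invg_continuous K a)). Qed.

Lemma mulg_continuousl a : continuous (fun k : K => (a * k)%g).
Proof. by move=> k; apply: cvgM_group; [exact: cvg_cst|exact: cvg_id]. Qed.

Lemma mulg_continuousr a : continuous (fun k : K => (k * a)%g).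
Proof. by move=> k; apply: cvgM_group; [exact: cvg_id|exact: cvg_cst]. Qed.

End topological_groups.

(** * The boundary of an unbounded convex set with an isometric action *)

Section extension.
Context {R : realType} {X : metricType R} (properX : proper_space X) (CAT0X : CAT0 X).
Context {K : topGroupType} (hK : hausdorff_space K) (lcK : locally_compact [set: K]).
Context {G : groupType} (Gamma : set G) (pr : G -> K) (tau : G -> isom_group X).
Hypothesis Gamma1 : Gamma 1%g.
Hypothesis GammaM : forall a b, Gamma a -> Gamma b -> Gamma (a * b)%g.
Hypothesis GammaV : forall a, Gamma a -> Gamma (a^-1)%g.
Hypothesis dense_pr : dense [set pr a | a in Gamma].
Hypothesis tauM : forall a b, Gamma a -> Gamma b -> tau (a * b)%g = (tau a * tau b)%g.
Hypothesis tau_indec : indecomposable (tau @` Gamma).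
Context (A : set X) (act : K -> X -> X).
Hypothesis clA : closed A.
Hypothesis cvA : gconvex A.
Hypothesis unbA : ~ metric_bounded A.
Hypothesis actA : forall h x, A x -> A (act h x).
Hypothesis act_isom : forall h x y, A x -> A y -> mdist (act h x) (act h y) = mdist x y.
Hypothesis actM : forall h h' x, A x -> act (h * h')%g x = act h (act h' x).
Hypothesis act1 : forall x, A x -> act 1%g x = x.
Hypothesis act_cont : forall x, A x -> continuous (fun h => act h x).
Hypothesis act_tau : forall a, Gamma a -> exists B : R, forall x, A x ->
  mdist (tau a x) (act (pr a) x) <= B.

Let L := tau @` Gamma.

Lemma tau1 : tau 1%g = 1%g.
Proof.
have := tauM Gamma1 Gamma1; rewrite mulg1 => /(congr1 (fun g => (tau 1)^-1 * g)%g).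
by rewrite mulVg mulgA mulVg mul1g.
Qed.

Lemma tauV a : Gamma a -> tau (a^-1)%g = (tau a)^-1%g.
Proof.
move=> Ga; have := tauM (GammaV Ga) Ga; rewrite mulVg tau1.
by move=> /(congr1 (fun g => g * (tau a)^-1)%g); rewrite -mulgA mulgV mulg1 mul1g.
Qed.

Let LM a b : L a -> L b -> L (a * b)%g.
Proof.
by move=> [x Gx <-] [y Gy <-]; exists (x * y)%g; [exact: GammaM|exact: tauM].
Qed.

Let LV a : L a -> L (a^-1)%g.
Proof. by move=> [x Gx <-]; exists (x^-1)%g; [exact: GammaV|exact: tauV]. Qed.

(** The boundary of [A], to which indecomposability is applied: [tau a] and [act (pr a)], being at
    bounded distance on [A], induce the same map there. *)
Let C := [set xi : boundary X |
  exists2 c : ray X, (\pi_(boundary X) c)%qT = xi & forall t, 0 <= t -> A (c t)].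

Lemma unbounded_escape : exists p (U : set_system nat) (x : nat -> X),
  [/\ UltraFilter U, A p, forall n, A (x n) &
      forall B : R, \forall i \near U, B <= mdist p (x i)].
Proof.
have [p Ap] : A !=set0.
  by apply: contrapT => A0; apply: unbA; exists 0 => a b Aa; exfalso; apply: A0; exists a.
have xex (n : nat) : exists x, A x /\ n%:R <= mdist p x.
  apply: contrapT => h; apply: unbA; exists (n%:R + n%:R) => a b Aa Ab.
  have bd x : A x -> mdist p x <= n%:R.
    by move=> Ax; rewrite leNgt; apply/negP => /ltW h'; apply: h; exists x.
  apply: (le_trans (metric_triangle _ p _)).
  by rewrite (metric_sym a) lerD// bd.
have [x xP] := choice xex.
have [U [UU sU]] := ultra_oo.
exists p, U, x; split=> // [n|B]; first by case: (xP n).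
have : U [set n : nat | B <= n%:R] by apply: sU; exact: nbhs_infty_ger.
by apply: filterS => n /= /le_trans; apply; case: (xP n).
Qed.

Let basepoint : {p : X | A p}.
Proof. by apply: cid; have [p [U [x [_ Ap _ _]]]] := unbounded_escape; exists p. Qed.
Let p := sval basepoint.
Let Ap : A p := svalP basepoint.

Lemma C_nonempty : C !=set0.
Proof.
have [q [U [x [UU Aq Ax xoo]]]] := unbounded_escape.
have [c [c0 Ac _]] := ray_of_segments properX CAT0X UU xoo clA cvA Aq Ax.
by exists (\pi_(boundary X) c)%qT; exists c.
Qed.

(** Rays from the common origin [p] turn points of [C] into maps to [A], whose limits can be taken
    pointwise. Outside [C] the value is arbitrary. *)
Lemma cray_ex xi : exists c : ray X, C xi ->
  [/\ (\pi_(boundary X) c)%qT = xi, c 0 = p & forall t, 0 <= t -> A (c t)].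
Proof.
have [[c cE Ac]|nC] := pselect (C xi); last by exists (repr xi).
have [c' [c'0 c'a Ac']] := asymptotic_ray_ex properX CAT0X clA cvA Ac Ap.
by exists c' => _; split=> //; rewrite -cE; apply/pi_boundaryP.
Qed.

Let cray xi := sval (cid (cray_ex xi)).
Let crayP xi : C xi ->
  [/\ (\pi_(boundary X) (cray xi))%qT = xi, cray xi 0 = p &
      forall t, 0 <= t -> A (cray xi t)] := svalP (cid (cray_ex xi)).

Lemma aray_ex (h : K) (c : ray X) : exists c' : ray X, (forall t, 0 <= t -> A (c t)) ->
  forall t, 0 <= t -> c' t = act h (c t).
Proof.
have [Ac|nA] := pselect (forall t, 0 <= t -> A (c t)); last by exists c.
have r s t : 0 <= s -> 0 <= t -> mdist (act h (c s)) (act h (c t)) = `|s - t|.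
  by move=> s0 t0; rewrite act_isom ?rayP//; exact: Ac.
by exists (ray_of r).
Qed.

Let aray h (c : ray X) := sval (cid (aray_ex h c)).
Let arayE h (c : ray X) : (forall t, 0 <= t -> A (c t)) ->
  forall t, 0 <= t -> aray h c t = act h (c t) := svalP (cid (aray_ex h c)).

Let Ah (h : K) (xi : boundary X) : boundary X := (\pi_(boundary X) (aray h (cray xi)))%qT.

Lemma Ah_pi h (c : ray X) : (forall t, 0 <= t -> A (c t)) ->
  Ah h (\pi_(boundary X) c)%qT = (\pi_(boundary X) (aray h c))%qT.
Proof.
move=> Ac; have Cc : C (\pi_(boundary X) c)%qT by exists c.
have [E _ Ac'] := crayP Cc.
have /asymptoticP[B cB] : asymptotic (cray (\pi_(boundary X) c)%qT) c by apply/pi_boundaryP.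
apply/pi_boundaryP/asymptoticP; exists B => t t0.
by rewrite !arayE// act_isom ?cB//; [exact: Ac'|exact: Ac].
Qed.

Lemma C_Ah h xi : C xi -> C (Ah h xi).
Proof.
move=> Cxi; have [_ _ Ac] := crayP Cxi.
by exists (aray h (cray xi)) => // t t0; rewrite arayE//; apply: actA; exact: Ac.
Qed.

Lemma AhM h h' xi : C xi -> Ah (h * h')%g xi = Ah h (Ah h' xi).
Proof.
move=> Cxi; have [E _ Ac] := crayP Cxi.
have Ac' t : 0 <= t -> A (aray h' (cray xi) t).
  by move=> t0; rewrite arayE//; apply: actA; exact: Ac.
rewrite [Ah h' xi]/Ah Ah_pi//; apply/pi_boundaryP/asymptoticP; exists 0 => t t0.
by rewrite !arayE// actM ?mdistxx//; exact: Ac.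
Qed.

Lemma Ah1 xi : C xi -> Ah 1%g xi = xi.
Proof.
move=> Cxi; have [E _ Ac] := crayP Cxi.
rewrite -[RHS]E; apply/pi_boundaryP/asymptoticP; exists 0 => t t0.
by rewrite !arayE// act1 ?mdistxx//; exact: Ac.
Qed.

Lemma Ah_tau a xi : Gamma a -> C xi -> boundary_act (tau a) xi = Ah (pr a) xi.
Proof.
move=> Ga Cxi; have [E _ Ac] := crayP Cxi; have [B aB] := act_tau Ga.
rewrite -[in LHS]E boundary_act_pi; apply/pi_boundaryP/asymptoticP; exists B => t t0 /=.
by rewrite arayE//; apply: aB; exact: Ac.
Qed.

(** The ray from [p] in a given class is unique, so cone neighbourhoods control the chosen rays
    themselves. *)
Lemma near_cray xi s e : C xi -> 0 < s -> 0 < e ->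
  \forall eta \near xi, C eta -> mdist (cray xi s) (cray eta s) < e.
Proof.
move=> Cxi s0 e0; have [E c0 Ac] := crayP Cxi.
have nb : nbhs xi (cone_nbhd (cray xi) s e).
  apply: open_nbhs_nbhs; split; first by apply: open_cone_subbase; exists (cray xi), s, e.
  by exists (cray xi) => //=; rewrite mdistxx.
apply: filterS nb => eta [c' [/= c'0 c's] c'E] Ceta.
have [E' c'0' Ac'] := crayP Ceta.
rewrite metric_sym (@asymptotic_same_origin _ _ CAT0X (cray eta) c')//.
- by apply/pi_boundaryP; rewrite E'.
- by rewrite c'0' c'0.
- exact: ltW.
Qed.

Lemma closed_C : closed C.
Proof.
move=> xi clxi.
have [c1 c1E] := boundary_repr xi.
have [c [c0 ca _]] := @asymptotic_ray_ex _ _ properX CAT0X setT c1 p (@closedT _)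
  (fun _ _ _ _ _ _ => I) (fun _ _ => I) I.
have cE : (\pi_(boundary X) c)%qT = xi by rewrite -c1E; apply/pi_boundaryP.
exists c => // t t0; have [->|tn0] := eqVneq t 0; first by rewrite c0.
have tp : 0 < t by rewrite lt_neqAle eq_sym tn0.
apply: clA => B nB; have [e e0 eB] := nbhs_mdist_ex nB.
have nb : nbhs xi (cone_nbhd c t e).
  apply: open_nbhs_nbhs; split; first by apply: open_cone_subbase; exists c, t, e.
  by exists c => //=; rewrite mdistxx.
have [eta [Ceta [c' [/= c'0 c't] c'E]]] := clxi _ nb.
have [E' c'0' Ac'] := crayP Ceta.
exists (cray eta t); split; first exact: Ac'.
apply: eB; rewrite metric_sym (@asymptotic_same_origin _ _ CAT0X (cray eta) c')//.
  by apply/pi_boundaryP; rewrite E'.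
by rewrite c'0' c'0.
Qed.

Lemma cvg_Ah (J : Type) (F : set_system J) (FF : Filter F) (h_ : J -> K)
    (xi_ : J -> boundary X) (h : K) (r : ray X) :
  (forall t, 0 <= t -> A (r t)) -> (\forall i \near F, C (xi_ i)) ->
  (forall s, 0 <= s -> (fun i => cray (xi_ i) s) @ F --> r s) -> h_ @ F --> h ->
  (fun i => Ah (h_ i) (xi_ i)) @ F --> Ah h (\pi_(boundary X) r)%qT.
Proof.
move=> Ar FC rc hh; rewrite Ah_pi//.
apply: (@cvg_boundary _ _ properX CAT0X J F FF (fun i => aray (h_ i) (cray (xi_ i))) _) => s s0.
apply/cvg_mdistP => e e0; have e2 : 0 < e / 2 by rewrite divr_gt0.
rewrite arayE//.
have /cvg_mdistP/(_ _ e2) h1 := rc s s0.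
have h2 : \forall i \near F, mdist (act h (r s)) (act (h_ i) (r s)) < e / 2.
  have cc : (fun i => act (h_ i) (r s)) @ F --> act h (r s).
    exact: (@cvg_comp _ _ _ h_ (fun k => act k (r s)) _ _ _ hh (@act_cont _ (Ar s s0) h)).
  by move/cvg_mdistP: cc; exact.
apply: filterS3 FC h1 h2 => i Ci h1 h2.
have [_ _ Ac] := crayP Ci.
rewrite arayE//; apply: (le_lt_trans (metric_triangle _ (act (h_ i) (r s)) _)).
by rewrite [ltRHS]splitr ltrD// act_isom//; [exact: Ar|exact: Ac].
Qed.

Lemma Ah_within h : {within C, continuous (Ah h)}.
Proof.
apply/subspace_continuousP => xi Cxi; have [E c0 Ac] := crayP Cxi.
rewrite -[in X in _ --> X]E.
apply: (@cvg_Ah _ _ _ (fun=> h)) => //.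
- exact: withinT.
- move=> s s0; have [->|sn0] := eqVneq s 0.
    rewrite c0; apply/cvg_mdistP => e e0; apply: filterS (withinT C (nbhs_filter xi)) => eta Ceta.
    by have [_ -> _] := crayP Ceta; rewrite mdistxx.
  have sp : 0 < s by rewrite lt_neqAle eq_sym sn0.
  by apply/cvg_mdistP => e e0; exact: near_cray.
- exact: cvg_cst.
Qed.

Lemma Ah_homeo h : homeo_on C (Ah h).
Proof.
exists (Ah (h^-1)%g); split.
- by split=> xi Cxi; exact: C_Ah.
- exact: Ah_within.
- exact: Ah_within.
- by move=> xi Cxi; rewrite -AhM// mulVg Ah1.
- by move=> xi Cxi; rewrite -AhM// mulgV Ah1.
Qed.

(** Otherwise there are violating points [xi h'] along an ultrafilter converging to [h], and their
    rays converge in [A]. By [cvg_Ah], the images under [Ah h] and [Ah h'] tend to the same point of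
    [C], where [V] is a neighbourhood of the diagonal. *)
Lemma Ah_uniform h (V : set (boundary X * boundary X)) :
  (forall xi, C xi -> nbhs (xi, xi) V) ->
  \forall h' \near h, forall xi, C xi -> V (Ah h xi, Ah h' xi).
Proof.
move=> VP; apply: contrapT => nN; have [xi0 _] := C_nonempty.
have [U [UU hU /= UB]] := not_cvg_ultra (nbhs_filter h) nN.
have xex (h' : K) : exists xi, (~ forall xi, C xi -> V (Ah h xi, Ah h' xi)) ->
    C xi /\ ~ V (Ah h xi, Ah h' xi).
  have [H|H] := pselect (forall xi, C xi -> V (Ah h xi, Ah h' xi)).
    by exists xi0.
  by move/existsNP: H => [xi /not_implyP[? ?]]; exists xi.
have [xi xiP] := choice xex.
have UC : \forall h' \near U, C (xi h').
  by apply: filterS UB => h' /= /xiP[].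
have Ud s : 0 <= s -> \forall h' \near U, mdist p (cray (xi h') s) <= s.
  move=> s0; apply: filterS UC => h' Ch'; have [_ c0 _] := crayP Ch'.
  by rewrite -c0 rayP ?lexx// sub0r normrN ger0_norm.
have lex s : exists a : X, 0 <= s -> (fun h' => cray (xi h') s) @ U --> a.
  have [s0|] := leP 0 s; last by exists p.
  by have [a aP] := ulim_ex properX UU (Ud s s0); exists a.
have [r rP] := choice lex.
have rr s t : 0 <= s -> 0 <= t -> mdist (r s) (r t) = `|s - t|.
  move=> s0 t0; apply/eqP; rewrite eq_le; apply/andP; split.
    by apply: (cvg_mdist_le (rP s s0) (rP t t0)); apply: nearW => i; rewrite rayP.
  by apply: (cvg_mdist_ge (rP s s0) (rP t t0)); apply: nearW => i; rewrite rayP.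
have rA t : 0 <= t -> A (r t).
  move=> t0; apply: (@closed_cvg _ _ U _ _ A clA _ (r t) (rP t t0)).
  by apply: filterS UC => h' Ch'; have [_ _ Ac] := crayP Ch'; exact: Ac.
pose rho := ray_of rr.
have Hc : (fun h' => Ah h (xi h')) @ U --> Ah h (\pi_(boundary X) rho)%qT.
  by apply: (@cvg_Ah _ _ _ (fun=> h)) => //; exact: cvg_cst.
have Hv : (fun h' => Ah h' (xi h')) @ U --> Ah h (\pi_(boundary X) rho)%qT.
  by apply: (@cvg_Ah _ _ _ id).
have Crho : C (Ah h (\pi_(boundary X) rho)%qT) by apply: C_Ah; exists rho.
have UV : U [set h' | V (Ah h (xi h'), Ah h' (xi h'))].
  have [[P Q] /= [nP nQ] PQV] := VP _ Crho.
  have UP : U [set h' | P (Ah h (xi h'))] := Hc P nP.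
  have UQ : U [set h' | Q (Ah h' (xi h'))] := Hv Q nQ.
  by apply: filterS2 UP UQ => h' ? ?; apply: PQV.
have [h' [h1 /= /xiP[_ h2]]] := filter_ex (filterI UV UB).
exact: h2.
Qed.

Lemma C_invariant g xi : L g -> C xi -> C (boundary_act g xi).
Proof. by move=> [a Ga <-] Cxi; rewrite Ah_tau//; exact: C_Ah. Qed.

Lemma rho_ex h : exists g, closure L g /\ forall xi, C xi -> boundary_act g xi = Ah h xi.
Proof.
have [_ uc] := tau_indec C_nonempty closed_C C_invariant.
have [|_ [g Lg <-] gE] := uc (Ah h) (Ah_homeo h).
  move=> V VP; have nN := Ah_uniform h VP.
  have [|k [Nk [a Ga aE]]] := dense_pr _ (open_interior [set h' | forall xi, C xi -> V (Ah h xi, Ah h' xi)]).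
    by exists h.
  exists (boundary_act (tau a)).
    by exists (tau a) => //; apply: subset_closure; exists a.
  move=> xi Cxi; rewrite Ah_tau// aE.
  exact: (interior_subset Nk).
by exists g; split=> // xi Cxi; rewrite gE.
Qed.

Let rho h := sval (cid (rho_ex h)).
Let rhoL h : closure L (rho h) := (svalP (cid (rho_ex h))).1.
Let rhoE h xi : C xi -> boundary_act (rho h) xi = Ah h xi :=
  (svalP (cid (rho_ex h))).2 xi.

(** Faithfulness on [C]. Multiplicativity of [rho] and its agreement with [tau] follow from it. *)
Lemma rho_unique h g : closure L g ->
  (forall xi, C xi -> boundary_act g xi = Ah h xi) -> g = rho h.
Proof.
move=> Lg gE; have [fa _] := tau_indec C_nonempty closed_C C_invariant.
have : ((rho h)^-1 * g)%g = 1%g.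
  apply: fa; first by apply: (closure_isomM LM) => //; exact: (closure_isomV LV).
  move=> xi Cxi; rewrite boundary_actM gE// -rhoE// -boundary_actM mulVg.
  exact: boundary_act1.
by move=> /(congr1 (fun k => (rho h * k)%g)); rewrite mulgA mulgV mul1g mulg1.
Qed.

Lemma rhoM h h' : rho (h * h')%g = (rho h * rho h')%g.
Proof.
apply/esym/rho_unique; first exact: (closure_isomM LM).
by move=> xi Cxi; rewrite boundary_actM !rhoE ?AhM//; exact: C_Ah.
Qed.

Lemma rho_tau a : Gamma a -> rho (pr a) = tau a.
Proof.
move=> Ga; apply/esym/rho_unique; last by move=> xi Cxi; rewrite Ah_tau.
by apply: subset_closure; exists a.
Qed.

(** Boundedness at [p] gives a limit isometry [g]. It acts on [C] as [Ah h], because [rho (h_ i)]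
    and [act (h_ i)] send a ray to asymptotic rays, whose distance is at all times bounded by that
    of their origins. *)
Lemma rho_lim (J : Type) (U : set_system J) (UU : UltraFilter U) (h_ : J -> K) (h : K)
    (m : R) : h_ @ U --> h -> (\forall i \near U, mdist (rho (h_ i) p) p <= m) ->
  forall x, (fun i => rho (h_ i) x) @ U --> rho h x.
Proof.
move=> hh bd; have [g gP] := ulim_isom properX UU bd.
suff -> : rho h = g by [].
apply/esym/rho_unique.
  have gl : (fun i => rho (h_ i)) @ U --> g by apply/cvg_isomP.
  apply: (@closed_cvg _ _ U _ (fun i => rho (h_ i)) (closure L) (@closed_closure _ _) _ g gl).
  by apply: nearW.
move=> xi Cxi; have [E c0 Ac] := crayP Cxi.
rewrite -[in LHS]E boundary_act_pi; apply/pi_boundaryP/asymptoticP.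
exists (mdist (g p) (act h p) + 1) => t t0; rewrite arayE//=.
have cact x : A x -> (fun i => act (h_ i) x) @ U --> act h x.
  by move=> Ax; exact: (@cvg_comp _ _ _ h_ (fun k => act k x) _ _ _ hh (@act_cont _ Ax h)).
apply: (cvg_mdist_le (gP (cray xi t)) (cact _ (Ac t t0))).
have e2 : (0 : R) < 1 / 2 by rewrite divr_gt0.
have /cvg_mdistP/(_ _ e2) h1 := gP p.
have /cvg_mdistP/(_ _ e2) h2 := cact p Ap.
apply: filterS2 h1 h2 => i h1 h2.
have ra : asymptotic (ray_act (rho (h_ i)) (cray xi)) (aray (h_ i) (cray xi)).
  by apply/pi_boundaryP; rewrite -boundary_act_pi E rhoE.
have := asymptotic_dist CAT0X ra t0; rewrite /= !arayE ?lexx// c0 => /le_trans; apply.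
apply: (le_trans (metric_triangle _ (g p) _)).
have := metric_triangle (g p) (act h p) (act (h_ i) p).
by rewrite (metric_sym (rho _ p)); move: h1 h2; lra.
Qed.

(** By [rho_lim], continuity holds wherever [rho] is locally bounded at [p]. The closed sets [B m]
    cover [K], so one has an interior point, and multiplicativity transports the bound to every
    point. *)
Lemma rho_continuous : continuous rho.
Proof.
pose B (m : nat) := [set h | mdist (rho h p) p <= m%:R].
have clB m : closed (B m).
  move=> h clh; pose F := within (B m) (nbhs h).
  have PF : ProperFilter F.
    split; last exact: within_filter.
    by rewrite /F /within /= => H; have [k [Bk]] := clh _ H; exact.
  have [U [UU FU]] := ultraFilterLemma PF.
  have UB : \forall k \near U, mdist (rho k p) p <= m%:R.
    by apply: FU; rewrite /F /within /=; apply: nearW.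
  have hU : id @ U --> h by move=> W nW; apply: FU; rewrite /F /within /=; apply: filterS nW.
  exact: (cvg_mdist_lec (@rho_lim _ U UU id h _ hU UB p) UB).
have covB h : exists m, B m h.
  by have [m] := filter_ex (nbhs_infty_ger (mdist (rho h p) p)); exists m.
have [m [h0 nB]] := lc_baire (1%g : K) hK lcK clB covB.
move=> h; apply: cvg_ultra => U UU hU; apply/cvg_isomP.
apply: (@rho_lim _ _ _ id h (m%:R + mdist (rho (h * h0^-1)%g p) p)); first exact: hU.
have hc : (fun k => h0 * h^-1 * k)%g @ h --> h0.
  have := @mulg_continuousl K (h0 * h^-1)%g h.
  by rewrite /continuous_at -[in X in _ --> X](mulgA h0) mulVg mulg1.
have : nbhs h [set k | B m (h0 * h^-1 * k)%g] by exact: hc nB.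
move=> /hU; apply: filterS => k /= Bk.
have -> : k = ((h * h0^-1) * (h0 * h^-1 * k))%g.
  by rewrite !mulgA -(mulgA h) mulVg mulg1 mulgV mul1g.
rewrite [rho _ p](_ : _ = rho (h * h0^-1)%g (rho (h0 * h^-1 * k)%g p)); last by rewrite rhoM.
apply: (le_trans (metric_triangle _ (rho (h * h0^-1)%g p) _)).
by rewrite isom_mdist lerD2r.
Qed.

Lemma extension_from_convex : exists r : K -> isom_group X,
  [/\ forall h, closure L (r h), forall h h', r (h * h')%g = (r h * r h')%g,
      continuous r & forall a, Gamma a -> r (pr a) = tau a].
Proof.
exists rho; split; [exact: rhoL|exact: rhoM|exact: rho_continuous|exact: rho_tau].
Qed.

End extension.

(** * Cocompact discrete subgroups and the Haar integral *)

Lemma compact_subcover (T : topologicalType) (I : eqType) (A : set T) (f : I -> set T) :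
  compact A -> (forall i, open (f i)) -> (forall x, A x -> exists i, f i x) ->
  exists D : seq I, forall x, A x -> exists2 i, i \in D & f i x.
Proof.
move=> cA of_ covf; apply: contrapT => nD.
pose F := [set B : set T | exists D : seq I,
  forall x, A x -> (forall i, i \in D -> ~ f i x) -> B x].
have PF : ProperFilter F.
  split.
    move=> [D DP]; apply: nD; exists D => x Ax; apply: contrapT => nx.
    by apply: (DP x Ax) => i iD fix_; apply: nx; exists i.
  split; first by exists [::].
    move=> P Q [D DP] [E EQ]; exists (D ++ E) => x Ax nx.
    by split; [apply: DP|apply: EQ] => // i iD; apply: nx; rewrite mem_cat iD ?orbT.
  by move=> P Q PQ [D DP]; exists D => x Ax nx; apply: PQ; exact: DP.
have FA : F A by exists [::].
have [p [Ap clp]] := cA F PF FA.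
have [i fip] := covf p Ap.
have Fi : F (~` f i) by exists [:: i] => x _ nx; apply: nx; rewrite inE.
have [x [nfx fx]] := clp _ _ Fi (open_nbhs_nbhs (conj (of_ i) fip)).
exact: nfx.
Qed.

Lemma compact_mul (G : topGroupType) (A B : set G) : compact A -> compact B ->
  compact [set (a * b)%g | a in A & b in B].
Proof.
move=> cA cB; rewrite (_ : [set _ | _ in _ & _ in _] = (fun z : G * G => (z.1 * z.2)%g) @` (A `*` B)).
  apply: continuous_compact; last exact: compact_setX.
  by apply: continuous_subspaceT; exact: mulg_continuous.
apply/seteqP; split=> [_ [a Aa [b Bb <-]]|_ [[a b] [/= Aa Bb] <-]].
  by exists (a, b).
by exists a => //; exists b.
Qed.

Lemma compact_inv (G : topGroupType) (A : set G) : compact A ->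
  compact [set (a^-1)%g | a in A].
Proof.
move=> cA; apply: continuous_compact => //.
by apply: continuous_subspaceT; exact: invg_continuous.
Qed.

Lemma open_mulgl (G : topGroupType) (a : G) (O : set G) : open O ->
  open [set x | O (a * x)%g].
Proof. by move=> oO; apply: (open_comp (f := fun x => (a * x)%g)) => // x _; exact: mulg_continuousl. Qed.

Lemma open_mulgr (G : topGroupType) (a : G) (O : set G) : open O ->
  open [set x | O (x * a)%g].
Proof. by move=> oO; apply: (open_comp (f := fun x => (x * a)%g)) => // x _; exact: mulg_continuousr. Qed.

Lemma continuous_sum (R : realType) (T : topologicalType) (I : Type) (s : seq I) (F : I -> T -> R) :
  (forall i, continuous (F i)) -> continuous (fun x => \sum_(i <- s) F i x).
Proof.
move=> cF; elim: s => [|i s IH].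
  by under eq_fun do rewrite big_nil; move=> x; exact: cvg_cst.
under eq_fun do rewrite big_cons.
by move=> x; apply: continuousD; [exact: cF|exact: IH].
Qed.

Lemma bump (R : realType) (T : topologicalType) (x : T) (O : set T) :
  hausdorff_space T -> locally_compact [set: T] -> nbhs x O ->
  exists f : T -> R, [/\ continuous f, forall y, 0 <= f y <= 1, f x = 1 &
    forall y, ~ O y -> f y = 0].
Proof.
move=> hT lc nO.
have cr := @locally_compact_completely_regular T R lc hT.
have clB : closed (~` interior O) by apply: open_closedC; exact: open_interior.
have nB : ~ (~` interior O) x by rewrite /setC /=; apply.
have /(@uniform_separatorP _ R)[f [cf f01 fx fO]] := cr x _ clB nB.
exists (fun y => 1 - f y); split.
- by move=> y; apply: continuousB; [exact: cvg_cst|exact: cf].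
- move=> y; have /= := f01 (f y) (ex_intro2 _ _ y I erefl).
  by rewrite in_itv /= => /andP[]; lra.
- by rewrite (fx (f x)) ?subr0//; exists x.
- by move=> y nOy; rewrite (fO (f y)) ?subrr//; exists y => // /interior_subset.
Qed.

Definition Cc (R : realType) (G : topGroupType) (F : G -> R) : Prop :=
  continuous F /\ exists2 K, compact K & forall x, ~ K x -> F x = 0.

Section lattice_subgroup.
Context {G : topGroupType} (hG : hausdorff_space G) (lcG : locally_compact [set: G]).
Context (Gamma : set G).
Hypothesis Gamma1 : Gamma 1%g.
Hypothesis GammaM : forall a b, Gamma a -> Gamma b -> Gamma (a * b)%g.
Hypothesis GammaV : forall a, Gamma a -> Gamma (a^-1)%g.
Hypothesis discreteGamma : Gamma `<=` isolated Gamma.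
Hypothesis cocompactGamma : cocompact Gamma.

Lemma discrete_unit : exists N : set G, nbhs 1%g N /\ forall a, Gamma a -> N a -> a = 1%g.
Proof.
have [_ [V nV VE]] := discreteGamma Gamma1; exists V; split=> // a Ga Va.
by have : (V `&` Gamma) a by []; rewrite VE.
Qed.

(** A translate of [V], where [V^-1 V] lies in [N], contains at most one element of [Gamma], and
    finitely many translates cover [K]. *)
Lemma discrete_finite (K : set G) : compact K -> finite_set (Gamma `&` K).
Proof.
move=> cK; have [N [nN N1]] := discrete_unit.
have [V nV VN] : exists2 V : set G, nbhs 1%g V & forall a b, V a -> V b -> N (a^-1 * b)%g.
  have cc : (fun z : G * G => (z.1^-1 * z.2)%g) @ (1%g, 1%g) --> (1%g : G).
    rewrite -[X in _ --> X](mulVg (1%g : G)).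
    by apply: cvgM_group; [apply: cvgV_group; exact: cvg_fst|exact: cvg_snd].
  have [[P Q] /= [nP nQ] PQ] := cc _ nN.
  by exists (P `&` Q); [exact: filterI|move=> a b [Pa _] [_ Qb]; exact: (PQ (a, b))].
pose f (x : G) := [set y : G | (interior V) (x^-1 * y)%g].
have of_ x : open (f x) by apply: open_mulgl; exact: open_interior.
have covf x : K x -> exists y, f y x by exists x; rewrite /f /= mulVg.
have [D KD] := compact_subcover cK of_ covf.
apply: (@sub_finite_set _ _ (\bigcup_(i in [set` D]) (Gamma `&` f i))).
  by move=> y [Gy Ky]; have [i Di fy] := KD y Ky; exists i.
apply: bigcup_finite => // i _.
have [[y0 [Gy0 fy0]]|ne] := pselect (Gamma `&` f i !=set0); last first.
  rewrite (_ : _ `&` _ = set0) //.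
  by apply/seteqP; split=> // y Hy; apply: ne; exists y.
apply: (@sub_finite_set _ _ [set y0]); last exact: finite_set1.
move=> y [Gy fy] /=; apply/esym.
have := VN _ _ (interior_subset fy0) (interior_subset fy).
rewrite invgM invgK -mulgA mulVKg => /N1 -/(_ (GammaM (GammaV Gy0) Gy)).
by move=> /(congr1 (fun z => (y0 * z)%g)); rewrite mulgA mulgV mul1g mulg1.
Qed.

Local Notation Q := (coset_space Gamma).
Local Notation pi := (\pi_(coset_space Gamma))%qT.

Lemma pi_cosetP (x y : G) : pi x = pi y <-> exists2 c, Gamma c & y = (x * c)%g.
Proof.
split=> [/eqmodP/asboolP E|[c Gc ->]].
  have : lcoset Gamma y y by exists 1%g => //; rewrite mulg1.
  by rewrite -E => -[c Gc <-]; exists c.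
apply/eqmodP/asboolP/seteqP; split=> _ [d Gd <-].
  exists (c^-1 * d)%g; first by apply: GammaM => //; exact: GammaV.
  by rewrite -mulgA (mulgA c) mulgV mul1g.
by exists (c * d)%g; [exact: GammaM|rewrite mulgA].
Qed.

Lemma open_pi (O : set G) : open O -> open (pi @` O : set Q).
Proof.
move=> oO; have E : pi @^-1` (pi @` O) = \bigcup_(c in Gamma) [set x | O (x * c)%g].
  apply/seteqP; split=> [x [z Oz /esym/pi_cosetP[c Gc zE]]|x [c Gc /= Oxc]].
    by exists c => //=; rewrite -zE.
  by exists (x * c)%g => //; apply/esym/pi_cosetP; exists c.
change (open (pi @^-1` (pi @` O))); rewrite E.
by apply: bigcup_open => c _; exact: open_mulgr.
Qed.

(** A finite sum of translated bumps whose images cover the compact quotient. It replaces a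
    fundamental domain, both in finding compact sets of representatives and in the base map. *)
Lemma cutoff_ex (R : realType) : exists phi : G -> R, [/\ Cc phi, forall x, 0 <= phi x &
  forall g, exists2 c, Gamma c & 0 < phi (g * c)%g].
Proof.
have [W [nW cW clW]] := lc_compact_nbhs (1%g : G) lcG.
have [f [cf f01 f1 fW]] := bump R hG lcG nW.
pose O (x : G) := pi @` [set z : G | 0 < f (x^-1 * z)%g].
have oO x : open (O x : set Q).
  apply: open_pi; apply: (open_mulgl (x^-1)%g (O := [set z | 0 < f z])).
  by apply: (open_comp (f := f) (D := [set r : R | 0 < r])) => [z _|]; [exact: cf|exact: open_gt].
have covO y : [set: Q] y -> exists x, O x y.
  move=> _; exists (repr y); exists (repr y); last by rewrite reprK.
  by rewrite /= mulVg f1.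
have [D DO] := compact_subcover cocompactGamma oO covO.
pose phi z := \sum_(x <- D) f (x^-1 * z)%g.
have phi0 z : 0 <= phi z by apply: sumr_ge0 => x _; case/andP: (f01 (x^-1 * z)%g).
exists phi; split=> //.
- split.
    apply: continuous_sum => x z.
    exact: (@cvg_comp _ _ _ (fun z => (x^-1 * z)%g) f _ _ _ (@mulg_continuousl _ _ z) (@cf _)).
  exists [set (a * b)%g | a in [set` D] & b in W].
    by apply: compact_mul => //; apply: finite_compact; exact: finite_seq.
  move=> z nz; rewrite /phi big_seq big1// => x xD; apply: fW => Wz; apply: nz.
  by exists x => //; exists (x^-1 * z)%g => //; rewrite mulgA mulgV mul1g.
- move=> g; have [x Dx [z fz /esym/pi_cosetP[c Gc zE]]] := DO (pi g) I.
  exists c => //; rewrite -zE /phi (big_rem x) //= ltr_pwDl// sumr_ge0// => y _.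
  by case/andP: (f01 (y^-1 * z)%g).
Qed.

Lemma cocompact_ex (R : realType) :
  exists2 K : set G, compact K & forall g, exists2 c, Gamma c & K (g * c)%g.
Proof.
have [phi [[_ [K cK K0]] _ phiG]] := cutoff_ex R; exists K => // g.
have [c Gc pos] := phiG g; exists c => //; apply: contrapT => nK.
by move: pos; rewrite K0// ltxx.
Qed.

Section periodization.
Context {R : realType}.
Implicit Types (F : G -> R).

(** For [F] with compact support the sum is finite by discreteness, and its right invariance under
    [Gamma] lets it descend to the coset space. *)
Definition periodize F (g : G) : R := \sum_(c \in Gamma) F (g * c)%g.

Definition fiber (K : set G) (g : G) : set G := Gamma `&` [set c | K (g * c)%g].

Lemma fiber_finite K g : compact K -> finite_set (fiber K g).
Proof.
move=> cK; apply: (@sub_finite_set _ _ (Gamma `&` [set (a * b)%g | a in [set (g^-1)%g] & b in K])).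
  move=> c [Gc Kc]; split=> //; exists (g^-1)%g => //; exists (g * c)%g => //.
  by rewrite mulgA mulVg mul1g.
by apply: discrete_finite; apply: compact_mul => //; exact: compact_set1.
Qed.

Lemma periodizeE F K s g : (forall x, ~ K x -> F x = 0) -> uniq s ->
  fiber K g `<=` [set` s] -> [set` s] `<=` Gamma ->
  periodize F g = \sum_(c <- s) F (g * c)%g.
Proof.
move=> FK us Ks sG; rewrite fsbig_seq//; apply/esym/fsbig_widen => // c [Gc nsc] /=.
by apply: FK => Kc; apply: nsc; apply: Ks.
Qed.

Lemma periodizeE1 F K g : compact K -> (forall x, ~ K x -> F x = 0) ->
  periodize F g = \sum_(c <- fset_set (fiber K g)) F (g * c)%g.
Proof.
move=> cK FK; have ff := fiber_finite g cK.
apply: (periodizeE FK) => //.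
- exact: fset_uniq.
- by move=> c Kc /=; rewrite in_fset_set// inE.
- by move=> c /=; rewrite in_fset_set// inE => -[].
Qed.

Lemma periodize_continuous F : Cc F -> continuous (periodize F).
Proof.
move=> [cF [K cK FK]] g.
have [W [nW cW _]] := lc_compact_nbhs g lcG.
(* One finite index set serves all points of the compact neighbourhood [W]. *)
pose S := Gamma `&` [set (a * b)%g | a in [set (w^-1)%g | w in W] & b in K].
have fS : finite_set S by apply: discrete_finite; apply: compact_mul => //; exact: compact_inv.
pose s : seq G := fset_set S.
have E w : W w -> periodize F w = \sum_(c <- s) F (w * c)%g.
  move=> Ww; apply: (periodizeE FK).
      exact: fset_uniq.
    move=> c [Gc /= Kc]; rewrite /s /= in_fset_set// inE; split=> //.
    exists (w^-1)%g; first by exists w.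
    by exists (w * c)%g => //; rewrite mulgA mulVg mul1g.
  by move=> c /=; rewrite in_fset_set// inE => -[].
have cs : continuous (fun w => \sum_(c <- s) F (w * c)%g).
  apply: continuous_sum => c z.
  exact: (@cvg_comp _ _ _ (fun z => (z * c)%g) F _ _ _ (@mulg_continuousr _ _ z) (@cF _)).
rewrite /continuous_at E; last exact: nbhs_singleton.
apply: cvg_trans (cs g); apply: near_eq_cvg.
by apply: filterS nW => w Ww; rewrite E.
Qed.

Lemma periodizeM F g c : Gamma c -> periodize F (g * c)%g = periodize F g.
Proof.
move=> Gc; rewrite /periodize [RHS](reindex_fsbig (fun d => (c * d)%g) Gamma Gamma).
  by apply: eq_fsbigr => d _; rewrite mulgA.
split.
- by move=> d Gd; exact: GammaM.
- move=> a b _ _ /(congr1 (fun z => (c^-1 * z)%g)).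
  by rewrite !mulgA mulVg !mul1g.
- move=> d Gd; exists (c^-1 * d)%g; last by rewrite mulgA mulgV mul1g.
  by apply: GammaM => //; exact: GammaV.
Qed.

End periodization.

End lattice_subgroup.

Lemma Cc_lin (R : realType) (G : topGroupType) (a : R) (F F' : G -> R) :
  Cc F -> Cc F' -> Cc (fun x => a * F x + F' x).
Proof.
move=> [cF [K cK FK]] [cF' [K' cK' FK']]; split.
  by move=> x; apply: cvgD; [apply: cvgM; [exact: cvg_cst|exact: cF]|exact: cF'].
exists (K `|` K'); first exact: compactU.
move=> x nx; rewrite FK ?FK' ?mulr0 ?addr0// => Kx; apply: nx; by [right|left].
Qed.

Lemma Cc_mul (R : realType) (G : topGroupType) (F F' : G -> R) :
  Cc F -> continuous F' -> Cc (fun x => F x * F' x).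
Proof.
move=> [cF [K cK FK]] cF'; split; first by move=> x; apply: cvgM; [exact: cF|exact: cF'].
by exists K => // x nK; rewrite FK// mul0r.
Qed.

Lemma Cc_shift (R : realType) (G : topGroupType) (F : G -> R) (w : G) :
  Cc F -> Cc (fun x => F (w * x)%g).
Proof.
move=> [cF [K cK FK]]; split.
  by move=> x; exact: (@cvg_comp _ _ _ (fun z => (w * z)%g) F _ _ _ (@mulg_continuousl _ _ x) (@cF _)).
exists [set (a * b)%g | a in [set (w^-1)%g] & b in K].
  by apply: compact_mul => //; exact: compact_set1.
move=> x nx; apply: FK => Kx; apply: nx; exists (w^-1)%g => //.
by exists (w * x)%g => //; rewrite mulKg.
Qed.

(** * The left invariant integral obtained from the measure on the quotient *)

Section haar_integral.
Context {R : realType} {G : topGroupType}.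
Context (hG : hausdorff_space G) (lcG : locally_compact [set: G]).
Context (Gamma : set G).
Hypothesis Gamma1 : Gamma 1%g.
Hypothesis GammaM : forall a b, Gamma a -> Gamma b -> Gamma (a * b)%g.
Hypothesis GammaV : forall a, Gamma a -> Gamma (a^-1)%g.
Hypothesis discreteGamma : Gamma `<=` isolated Gamma.
Hypothesis cocompactGamma : cocompact Gamma.

Local Notation Q := (coset_space Gamma).
Local Notation pi := (\pi_(coset_space Gamma))%qT.

Lemma invariant_repr (T : Type) (h : G -> T) (g : G) :
  (forall g c, Gamma c -> h (g * c)%g = h g) -> h (repr (pi g)) = h g.
Proof.
move=> hI; have /(pi_cosetP Gamma1 GammaM GammaV)[c Gc E] : pi (repr (pi g)) = pi g.
  by rewrite reprK.
by rewrite [in RHS]E hI.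
Qed.

Lemma invariant_continuous (T : topologicalType) (h : G -> T) :
  continuous h -> (forall g c, Gamma c -> h (g * c)%g = h g) ->
  continuous (fun y : Q => h (repr y)).
Proof.
move=> ch hI; apply/quotient_continuous.
rewrite (_ : _ \o _ = h) //; apply/funext => g /=.
by rewrite (invariant_repr g hI).
Qed.

(** This is how cocompactness is used later: distances between equivariant maps are invariant
    functions. *)
Lemma invariant_max (h : G -> R) :
  continuous h -> (forall g c, Gamma c -> h (g * c)%g = h g) ->
  exists g0, forall g, h g <= h g0.
Proof.
move=> ch hI; have cq := invariant_continuous ch hI.
have ne : [set: Q] !=set0 by exists (pi 1%g).
have [y _ ymax] := compact_EVT_max ne cocompactGamma (continuous_subspaceT cq).
exists (repr y) => g; have := ymax (pi g); rewrite inE => /(_ I).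
by rewrite (invariant_repr g hI).
Qed.

Context (mu : {finite_measure set (coset_borel Gamma) -> \bar R}).
Hypothesis mu_neq0 : mu setT != 0%E.
Hypothesis muI : forall (g : G) (A : set (coset_borel Gamma)), measurable A ->
  mu (coset_act g @` A) = mu A.

Lemma invariant_integrable (h : G -> R) :
  continuous h -> (forall g c, Gamma c -> h (g * c)%g = h g) ->
  mu.-integrable setT (EFin \o (fun y : coset_borel Gamma => h (repr (y : Q)))).
Proof.
move=> ch hI; apply: measurable_bounded_integrable => //.
- have := fin_num_measure mu setT measurableT.
  by rewrite ge0_fin_numE.
- apply: (measurability _ (measurable_realfun.RGenOpens.measurableE R)) => _ [_ [a [b ->] <-]].
  rewrite setTI; apply: sub_sigma_algebra.
  by apply: open_comp => [y _|]; [exact: (invariant_continuous ch hI)|exact: interval_open].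
- have ch' : continuous (fun g => `|h g|).
    by move=> g; apply: (@cvg_comp _ _ _ h (fun r : R => `|r|) _ _ _ (@ch g)); exact: norm_continuous.
  have hI' g c : Gamma c -> `|h (g * c)%g| = `|h g| by move=> Gc; rewrite hI.
  have [g0 g0P] := invariant_max ch' hI'.
  exists (`|h g0|); split; first exact: num_real.
  by move=> M hM y _ /=; rewrite (le_trans (g0P _))// ltW.
Qed.

(** Weil's formula read as a definition: the invariant measure on [G/Gamma] determines a left
    invariant integral on [G]. By [periodizeM] the choice of representatives is immaterial. *)
Definition haar (F : G -> R) : R :=
  Rintegral mu setT (fun y : coset_borel Gamma => periodize Gamma F (repr (y : Q))).

Let pc (F : G -> R) : Cc F -> continuous (periodize Gamma F).
Proof. by move=> cF; apply: periodize_continuous. Qed.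

Let pI (F : G -> R) g c : Gamma c -> periodize Gamma F (g * c)%g = periodize Gamma F g.
Proof. by move=> Gc; apply: periodizeM. Qed.

Lemma periodize_lin a (F F' : G -> R) g : Cc F -> Cc F' ->
  periodize Gamma (fun x => a * F x + F' x) g = a * periodize Gamma F g + periodize Gamma F' g.
Proof.
move=> [cF [K cK FK]] [cF' [K' cK' FK']].
have cU : compact (K `|` K') by exact: compactU.
have H (F0 : G -> R) : (forall x, ~ (K `|` K') x -> F0 x = 0) ->
    periodize Gamma F0 g = \sum_(c <- fset_set (fiber Gamma (K `|` K') g)) F0 (g * c)%g.
  by apply: periodizeE1.
rewrite !H; first by rewrite mulr_sumr -big_split.
- by move=> x nx; apply: FK' => Kx; apply: nx; right.
- by move=> x nx; apply: FK => Kx; apply: nx; left.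
- move=> x nx; rewrite FK ?FK' ?mulr0 ?addr0// => Kx; apply: nx; by [right|left].
Qed.

Lemma haar_lin a (F F' : G -> R) : Cc F -> Cc F' ->
  haar (fun x => a * F x + F' x) = a * haar F + haar F'.
Proof.
move=> cF cF'; rewrite /haar -RintegralZl//; last first.
  by apply: invariant_integrable; [exact: pc|exact: pI].
rewrite -RintegralD//.
- by apply: eq_Rintegral => y _; rewrite periodize_lin.
- have h1 : continuous (fun g => a * periodize Gamma F g).
    by move=> g; apply: cvgM; [exact: cvg_cst|exact: (pc cF)].
  have h2 g c : Gamma c -> a * periodize Gamma F (g * c)%g = a * periodize Gamma F g.
    by move=> Gc; rewrite pI.
  exact: (invariant_integrable h1 h2).
- by apply: invariant_integrable; [exact: pc|exact: pI].
Qed.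

Lemma haar_mono (F F' : G -> R) : Cc F -> Cc F' -> (forall x, F x <= F' x) ->
  haar F <= haar F'.
Proof.
move=> cF cF' FF'; apply: le_Rintegral => //.
- by apply: invariant_integrable; [exact: pc|exact: pI].
- by apply: invariant_integrable; [exact: pc|exact: pI].
move=> y _; have := @periodize_lin (-1) F F' (repr (y : Q)) cF cF'.
rewrite mulN1r addrC => E; rewrite -subr_ge0 -E.
by apply: fsumr_ge0 => c _; rewrite mulN1r addrC subr_ge0.
Qed.

Lemma coset_act_pi w g : coset_act w (pi g : Q) = pi (w * g)%g.
Proof.
apply/(pi_cosetP Gamma1 GammaM GammaV).
have /(pi_cosetP Gamma1 GammaM GammaV)[c Gc gE] : pi (repr (pi g)) = pi g by rewrite reprK.
by exists c => //; rewrite -mulgA -gE.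
Qed.

Lemma haar_shift w (F : G -> R) : Cc F -> haar (fun x => F (w * x)%g) = haar F.
Proof.
move=> cF.
pose act (y : coset_borel Gamma) : coset_borel Gamma := coset_act w (y : Q).
have actK (y : Q) : coset_act (w^-1)%g (coset_act w y) = y.
  change (coset_act (w^-1)%g (pi (w * repr y)%g : Q) = y).
  by rewrite coset_act_pi mulKg reprK.
have actVK (y : Q) : coset_act w (coset_act (w^-1)%g y) = y.
  change (coset_act w (pi (w^-1 * repr y)%g : Q) = y).
  by rewrite coset_act_pi mulVKg reprK.
have cact : continuous (coset_act w : Q -> Q).
  apply/quotient_continuous; rewrite (_ : _ \o _ = (fun g => pi (w * g)%g)).
    move=> g; apply: (@cvg_comp _ _ _ (fun g => (w * g)%g) (pi : G -> Q) _ _ _ (@mulg_continuousl _ _ g)).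
    exact: pi_continuous.
  by apply/funext => g /=; rewrite coset_act_pi.
have mact : measurable_fun setT act.
  apply: (@measurability _ _ _ (coset_borel Gamma) setT act (@open Q) erefl) => _ [U oU <-].
  by rewrite setTI; apply: sub_sigma_algebra; apply: open_comp => [y _|]; [exact: cact|].
(* Invariance of [mu] is given for images, while the push-forward uses preimages. *)
have pre A : act @^-1` A = coset_act (w^-1)%g @` A.
  apply/seteqP; split=> [y Ay|_ [y Ay <-]].
    by exists (act y) => //; exact: actK.
  by rewrite /act /= actVK.
have cP := pc cF.
rewrite /haar /Rintegral; congr fine.
have IG := invariant_integrable cP (pI F).
have Eq (y : Q) : periodize Gamma (fun x => F (w * x)%g) (repr y) =
    periodize Gamma F (repr (coset_act w y)).
  rewrite /coset_act (invariant_repr _ (pI F)).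
  by apply: eq_fsbigr => c _; rewrite mulgA.
pose f : coset_borel Gamma -> \bar R :=
  EFin \o (fun y : coset_borel Gamma => periodize Gamma F (repr (y : Q))).
have /integrableP[mf _] := IG.
have fE : f \o act = (fun y => (periodize Gamma (fun x => F (w * x)%g) (repr (y : Q)))%:E).
  by apply/funext => y; rewrite /f /= Eq.
have intf : mu.-integrable (act @^-1` setT) (f \o act).
  rewrite preimage_setT fE.
  have cs : Cc (fun x => F (w * x)%g) by exact: Cc_shift.
  exact: (invariant_integrable (pc cs) (pI (fun x => F (w * x)%g))).
have E := @integral_pushforward _ _ _ _ R act mact mu setT f mf intf measurableT.
rewrite preimage_setT fE in E.
apply: (etrans (esym E)).
by apply: eq_measure_integral => A mA _; cbn; rewrite pre; exact: muI.
Qed.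

Lemma haar0 : haar (fun=> 0) = 0.
Proof.
rewrite /haar (_ : (fun y : coset_borel Gamma => _) = (fun=> 0)).
  by rewrite Rintegral_cst// mul0r.
by apply/funext => y; rewrite /periodize fsbig1.
Qed.

Lemma Cc0 : Cc (fun _ : G => 0 : R).
Proof. by split; [move=> x; exact: cvg_cst|exists set0 => //; exact: compact0]. Qed.

Lemma haar_ge0 (F : G -> R) : Cc F -> (forall x, 0 <= F x) -> 0 <= haar F.
Proof. by move=> cF F0; rewrite -haar0; apply: haar_mono => //; exact: Cc0. Qed.

Lemma haar_sum (s : seq G) (F : G -> R) : Cc F ->
  Cc (fun x => \sum_(w <- s) F (w * x)%g) /\
  haar (fun x => \sum_(w <- s) F (w * x)%g) = (size s)%:R * haar F.
Proof.
move=> cF; elim: s => [|w s [IH1 IH2]].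
  rewrite (_ : (fun _ => _) = (fun=> 0)); last by apply/funext => x; rewrite big_nil.
  by rewrite haar0 mul0r; split=> //; exact: Cc0.
rewrite (_ : (fun _ => _) = (fun x => 1 * F (w * x)%g + \sum_(w <- s) F (w * x)%g)); last first.
  by apply/funext => x; rewrite big_cons mul1r.
have cs := Cc_shift w cF; split; first exact: Cc_lin.
by rewrite haar_lin// IH2 haar_shift// mul1r -natr1 mulrDl mul1r addrC.
Qed.

(** Finitely many translates of [F] sum to more than [a] on a compact set meeting every coset, so
    the periodized sum is at least [a] everywhere; by invariance each translate has the integral of
    [F]. *)
Lemma haar_gt0 (F : G -> R) x0 : Cc F -> (forall x, 0 <= F x) -> 0 < F x0 -> 0 < haar F.
Proof.
move=> cF F0 Fx0; have [cFc [K cK FK]] := cF.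
pose a := F x0 / 2; have a0 : 0 < a by rewrite divr_gt0.
pose O (w : G) : set G := [set x | a < F (w * x)%g].
have oO w : open (O w).
  apply: (open_mulgl w (O := [set z | a < F z])).
  by apply: (open_comp (f := F) (D := [set r : R | a < r])) => [z _|]; [exact: cFc|exact: open_gt].
have [K' cK' K'G] := cocompact_ex hG lcG Gamma1 GammaM GammaV cocompactGamma R.
have covO x : K' x -> exists w, O w x.
  move=> _; exists (x0 * x^-1)%g; rewrite /O /= mulgVK /a.
  by rewrite ltr_pdivrMr// mulr_natr mulr2n ltrDl.
have [D DP] := compact_subcover cK' oO covO.
have [cS HS] := haar_sum D cF.
suff : 0 < haar (fun x => \sum_(w <- D) F (w * x)%g).
  rewrite HS; have := haar_ge0 cF F0; rewrite le_eqVlt => /orP[/eqP <-|//].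
  by rewrite mulr0 ltxx.
have mu0 : 0 < fine (mu setT).
  rewrite fine_gt0// lt0e mu_neq0 measure_ge0/=.
  by have := fin_num_measure mu setT measurableT; rewrite ge0_fin_numE.
apply: (@lt_le_trans _ _ (Rintegral mu setT (fun=> a))).
  by rewrite Rintegral_cst// mulr_gt0.
apply: le_Rintegral => //.
- exact: (@invariant_integrable (fun=> a) (fun _ => cvg_cst _) (fun _ _ _ => erefl)).
- by apply: invariant_integrable; [exact: pc|exact: pI].
move=> y _; have [c Gc K'c] := K'G (repr (y : Q)).
rewrite -(pI _ _ Gc); have [w wD aw] := DP _ K'c.
set g := (_ * c)%g in aw *.
apply: (le_trans (ltW aw)).
have [_ [K1 cK1 FK1]] := cS.
rewrite (periodizeE1 Gamma1 GammaM GammaV discreteGamma g cK1 FK1).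
have S0 x : 0 <= \sum_(w <- D) F (w * x)%g by apply: sumr_ge0 => *; exact: F0.
have Fle x : F (w * x)%g <= \sum_(w <- D) F (w * x)%g.
  by rewrite (big_rem w)//= lerDl sumr_ge0.
have [H|H] := pselect (K1 g); last first.
  by rewrite (le_trans (Fle g))// FK1// sumr_ge0.
have ff := @fiber_finite _ _ Gamma1 GammaM GammaV discreteGamma K1 g cK1.
(* Since [g] has been moved into [K'], the term of the trivial element alone exceeds [a]. *)
rewrite (big_rem (1%g : G)) /=; last by rewrite in_fset_set// inE; split=> //=; rewrite mulg1.
by rewrite mulg1 (le_trans (Fle g))// lerDl sumr_ge0.
Qed.

End haar_integral.

(** * Weighted sums of integrals *)

Section weighted_sum.
Context {R : realType}.
Implicit Types (a b : nat -> R).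

(** The sequence [2^-(j + 1)]; its sum is 1, so [wsum] is a mean. *)
Definition dyadic (j : nat) : R := geometric 2^-1 2^-1 j.

Definition wsum a : R := limn (series (fun j => dyadic j * a j)).

Lemma dyadic_gt0 j : 0 < dyadic j.
Proof. by rewrite /dyadic /= mulr_gt0// exprn_gt0// invr_gt0. Qed.

Lemma series_dyadic : series dyadic @ \oo --> (1 : R).
Proof.
have h : `|2^-1 : R| < 1 by rewrite ger0_norm ?invr_ge0// invf_lt1// ltr1n.
have := @cvg_geometric_series R 2^-1 2^-1 h.
by rewrite (_ : 2^-1 * (1 - 2^-1)^-1 = 1 :> R)//; field.
Qed.

Definition bounded_by a (M : R) := forall j, `|a j| <= M.

Lemma is_cvg_wsum a M : bounded_by a M -> cvgn (series (fun j => dyadic j * a j)).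
Proof.
move=> aM; apply: (@normed_cvg R R^o).
apply: (@series_le_cvg R _ (fun j => M * dyadic j)).
- by move=> n /=.
- by move=> n; rewrite mulr_ge0 ?(le_trans _ (aM n))// ltW// dyadic_gt0.
- move=> n /=; rewrite normrM (gtr0_norm (dyadic_gt0 n)) mulrC ler_wpM2r//.
  by rewrite ltW// dyadic_gt0.
- have cd : cvgn (series dyadic) by apply/cvg_ex; exists 1; exact: series_dyadic.
  by have := @is_cvg_seriesZ R _ M cd.
Qed.

Lemma wsum_lin a b M M' c : bounded_by a M -> bounded_by b M' ->
  wsum (fun j => c * a j + b j) = c * wsum a + wsum b.
Proof.
move=> aM bM; have ca := is_cvg_wsum aM; have cb := is_cvg_wsum bM.
rewrite /wsum -[c * _]/(c *: (_ : R^o)) -(lim_seriesZ c ca) -lim_seriesD//; last exact: is_cvg_seriesZ.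
congr (limn (series _)); apply/funext => j /=.
by rewrite mulrDr /GRing.scale /= mulrCA.
Qed.

Lemma wsum_mono a b M M' : bounded_by a M -> bounded_by b M' ->
  (forall j, a j <= b j) -> wsum a <= wsum b.
Proof.
move=> aM bM ab; apply: lim_series_le; [exact: (is_cvg_wsum aM)|exact: (is_cvg_wsum bM)|].
by move=> j; rewrite ler_pM2l ?dyadic_gt0.
Qed.

Lemma wsum_cst c : wsum (fun=> c) = c.
Proof.
rewrite /wsum (_ : (fun j => _) = c *: (dyadic : nat -> R^o)).
  rewrite lim_seriesZ; last by apply/cvg_ex; exists 1; exact: series_dyadic.
  by rewrite (cvg_lim _ series_dyadic)//; apply: mulr1.
by apply/funext => j /=; rewrite mulrC.
Qed.

Lemma wsum_le a M c : bounded_by a M -> (forall j, a j <= c) -> wsum a <= c.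
Proof.
move=> aM ac; rewrite -[leRHS](wsum_cst c); exact: (@wsum_mono _ _ M `|c|).
Qed.

Lemma wsum_ge_term a M j : bounded_by a M -> (forall j, 0 <= a j) ->
  dyadic j * a j <= wsum a.
Proof.
move=> aM a0; pose s := series (fun j => dyadic j * a j).
have t0 k : 0 <= dyadic k * a k by rewrite mulr_ge0// ltW// dyadic_gt0.
have ns : nondecreasing_seq s.
  apply/nondecreasing_seqP => n.
  by rewrite /s /series /= big_nat_recr//= lerDl.
apply: (@le_trans _ _ (s j.+1)); last exact: (nondecreasing_cvgn_le ns (is_cvg_wsum aM)).
by rewrite /s /series /= big_nat_recr//= lerDr sumr_ge0.
Qed.

End weighted_sum.

(** * Averages over [G] and a countable index set *)

Section averaging.
Context {R : realType} {X : metricType R} {G : topGroupType}.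
Context (I : (G -> R) -> R).
Hypothesis I_lin : forall a F F', Cc F -> Cc F' ->
  I (fun x => a * F x + F' x) = a * I F + I F'.
Hypothesis I_mono : forall F F', Cc F -> Cc F' -> (forall x, F x <= F' x) -> I F <= I F'.
Hypothesis I_shift : forall w F, Cc F -> I (fun x => F (w * x)%g) = I F.
Hypothesis I_gt0 : forall F x0, Cc F -> (forall x, 0 <= F x) -> 0 < F x0 -> 0 < I F.
Context (K2 : set G) (b : nat -> R).
Hypothesis b0 : forall j, 0 <= b j.

Record weight (psi : G -> R) : Prop := Weight {
  weight_Cc : Cc psi ;
  weight_ge0 : forall u, 0 <= psi u ;
  weight_supp : forall u, ~ K2 u -> psi u = 0
}.

(** In the application [b j] bounds the displacement of the base map by the samples of index [j].
    Maps of linear growth in [b], as in [adq], have squared distances of quadratic growth, which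
    [adm] allows. *)
Definition adm (F : G * nat -> R) : Prop :=
  (forall j, continuous (fun u => F (u, j))) /\
  exists A, forall u j, K2 u -> `|F (u, j)| <= A * (1 + b j) ^+ 2.

Definition adq (q : G * nat -> X) : Prop :=
  (forall j, continuous (fun u => q (u, j))) /\
  exists p A, forall u j, K2 u -> mdist p (q (u, j)) <= A * (1 + b j).

(** Dividing by [(1 + b j)^2] makes the terms bounded for functions in [adm], while every index
    keeps a positive weight. *)
Definition Lam (psi : G -> R) (F : G * nat -> R) : R :=
  wsum (fun j => I (fun u => psi u * F (u, j)) / (1 + b j) ^+ 2).

Let b1 j : 0 < 1 + b j. Proof. by rewrite ltr_pwDl. Qed.
Let b2 j : 0 < (1 + b j) ^+ 2. Proof. by rewrite exprn_gt0. Qed.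

Let c0 : Cc (fun _ : G => 0 : R).
Proof. by split; [move=> x; exact: cvg_cst|exists set0 => //; exact: compact0]. Qed.

Lemma integral_zero : I (fun=> 0) = 0.
Proof.
have E0 : (fun _ : G => 1 * 0 + 0 : R) = (fun=> 0).
  by apply/funext => x; rewrite mulr0 addr0.
by have := I_lin 1 c0 c0; rewrite E0; lra.
Qed.

Lemma IZ a F : Cc F -> I (fun x => a * F x) = a * I F.
Proof.
move=> cF; rewrite -[RHS]addr0 -integral_zero -I_lin//; congr I; apply/funext => x.
by rewrite addr0.
Qed.

Lemma adm_Cc psi F j : weight psi -> adm F -> Cc (fun u => psi u * F (u, j)).
Proof. by move=> [cp _ _] [cF _]; exact: Cc_mul. Qed.

Lemma adm_le psi F c j : weight psi -> adm F -> (forall u, 0 < psi u -> F (u, j) <= c) ->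
  I (fun u => psi u * F (u, j)) <= c * I psi.
Proof.
move=> wp aF Fc; rewrite -IZ; last by case: wp.
have cp := weight_Cc wp.
apply: I_mono; first exact: adm_Cc.
  rewrite (_ : (fun _ => _) = (fun u => psi u * c)).
    by apply: Cc_mul => // x; exact: cvg_cst.
  by apply/funext => u; rewrite mulrC.
move=> u; rewrite mulrC; have := weight_ge0 wp u; rewrite le_eqVlt => /orP[/eqP <-|pu].
  by rewrite !mulr0.
by rewrite ler_pM2r// Fc.
Qed.

Lemma adm_lin2 (a : R) F F' : adm F -> adm F' -> adm (fun w => a * F w + F' w).
Proof.
move=> [cF [A FA]] [cF' [A' FA']]; split.
  by move=> j x; apply: cvgD; [apply: cvgM; [exact: cvg_cst|exact: cF]|exact: cF'].
exists (`|a| * A + A') => u j Ku; rewrite mulrDl -mulrA.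
apply: (le_trans (ler_normD _ _)); rewrite lerD ?FA'// normrM.
by rewrite ler_wpM2l// FA.
Qed.

Lemma adm_N F : adm F -> adm (fun w => - F w).
Proof.
move=> aF; rewrite (_ : (fun _ => _) = (fun w => -2 * F w + F w)); first exact: adm_lin2.
by apply/funext => w; ring.
Qed.

Lemma Lam_bounded psi F : weight psi -> adm F ->
  exists M, bounded_by (fun j => I (fun u => psi u * F (u, j)) / (1 + b j) ^+ 2) M.
Proof.
move=> wp aF; have [cF [A FA]] := aF; exists (A * I psi) => j.
rewrite normrM normfV (gtr0_norm (b2 j)) ler_pdivrMr//.
have K2p u : 0 < psi u -> K2 u.
  by move=> pu; apply: contrapT => /(weight_supp wp) p0; rewrite p0 ltxx in pu.
have h1 : I (fun u => psi u * F (u, j)) <= A * (1 + b j) ^+ 2 * I psi.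
  by apply: adm_le => // u pu; apply: (le_trans (ler_norm _)); apply: FA; exact: K2p.
have h2 : I (fun u => psi u * - F (u, j)) <= A * (1 + b j) ^+ 2 * I psi.
  apply: (adm_le (F := fun w => - F w)) => //; first exact: adm_N.
  by move=> u pu; apply: (le_trans (ler_norm _)); rewrite normrN; apply: FA; exact: K2p.
have E : I (fun u => psi u * - F (u, j)) = - I (fun u => psi u * F (u, j)).
  rewrite -mulN1r -IZ; last exact: adm_Cc.
  by congr I; apply/funext => u; ring.
rewrite mulrAC ler_norml h1 andbT lerNl -E.
exact: h2.
Qed.

Lemma Lam_lin psi a F F' : weight psi -> adm F -> adm F' ->
  Lam psi (fun w => a * F w + F' w) = a * Lam psi F + Lam psi F'.
Proof.
move=> wp aF aF'; have [M FM] := Lam_bounded wp aF; have [M' FM'] := Lam_bounded wp aF'.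
rewrite /Lam -(wsum_lin _ FM FM'); congr wsum; apply/funext => j.
rewrite mulrA -mulrDl; congr (_ / _); rewrite -I_lin; [|exact: adm_Cc|exact: adm_Cc].
by congr I; apply/funext => u; ring.
Qed.

Lemma Lam_mono psi F F' : weight psi -> adm F -> adm F' ->
  (forall w, 0 < psi w.1 -> F w <= F' w) -> Lam psi F <= Lam psi F'.
Proof.
move=> wp aF aF' FF'; have [M FM] := Lam_bounded wp aF; have [M' FM'] := Lam_bounded wp aF'.
apply: (wsum_mono FM FM') => j; rewrite ler_pM2r ?invr_gt0//.
apply: I_mono; [exact: adm_Cc|exact: adm_Cc|move=> u].
have := weight_ge0 wp u; rewrite le_eqVlt => /orP[/eqP <-|pu]; first by rewrite !mul0r.
by rewrite ler_pM2l// FF'.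
Qed.

Lemma adm_const c : adm (fun=> c).
Proof.
split; first by move=> j x; exact: cvg_cst.
exists `|c| => u j _; rewrite ler_peMr// expr2 mulr_ege1// lerDl//.
Qed.

Lemma Lam_ge_term psi F j : weight psi -> adm F -> (forall w, 0 < psi w.1 -> 0 <= F w) ->
  dyadic j * (I (fun u => psi u * F (u, j)) / (1 + b j) ^+ 2) <= Lam psi F.
Proof.
move=> wp aF F0; have [M FM] := Lam_bounded wp aF.
apply: (wsum_ge_term j FM) => k; rewrite divr_ge0 ?(ltW (b2 k))//.
rewrite -integral_zero.
apply: I_mono => //; first exact: adm_Cc.
move=> u; have := weight_ge0 wp u; rewrite le_eqVlt => /orP[/eqP <-|pu].
  by rewrite mul0r.
by rewrite mulr_ge0 ?F0// ltW.
Qed.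

Lemma Lam_posfun psi u0 : weight psi -> 0 < psi u0 ->
  posfun adm [set w | 0 < psi w.1] (Lam psi).
Proof.
move=> wp pu0; split.
- by move=> a F F'; exact: Lam_lin.
- by move=> F F'; exact: Lam_mono.
- have := @Lam_ge_term psi (fun=> 1) 0%N wp (adm_const 1) (fun _ _ => ler01).
  apply: lt_le_trans; rewrite mulr_gt0 ?dyadic_gt0// divr_gt0//.
  apply: (@I_gt0 _ u0); first exact: (adm_Cc 0%N wp (adm_const 1)).
    by move=> x; rewrite mulr1; exact: weight_ge0.
  by rewrite mulr1.
Qed.

(** At each index, every neighbourhood of a point with [psi > 0] has positive mass. This is what
    turns equality of averages into pointwise equality. *)
Lemma Lam_eq0 psi F u0 j : weight psi -> adm F -> (forall w, 0 < psi w.1 -> 0 <= F w) ->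
  Lam psi F <= 0 -> 0 < psi u0 -> F (u0, j) = 0.
Proof.
move=> wp aF F0 L0 pu0; apply: contrapT => /eqP Fn0.
have Fp : 0 < F (u0, j) by rewrite lt_neqAle eq_sym Fn0 F0.
have := Lam_ge_term j wp aF F0; rewrite leNgt => /negP; apply.
apply: (le_lt_trans L0); rewrite mulr_gt0 ?dyadic_gt0// divr_gt0//.
apply: (@I_gt0 _ u0); [exact: adm_Cc| |exact: mulr_gt0].
move=> u; have := weight_ge0 wp u; rewrite le_eqVlt => /orP[/eqP <-|pu].
  by rewrite mul0r.
by rewrite mulr_ge0 ?F0// ltW.
Qed.

(** The smoothing effect of averaging: the bound involves the size of [F], not its
    modulus of continuity. *)
Lemma Lam_sub_le psi psi' eta F M : weight psi -> weight psi' -> weight eta ->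
  (forall u, `|psi u - psi' u| <= eta u) -> adm F ->
  (forall u j, K2 u -> `|F (u, j)| <= M * (1 + b j) ^+ 2) ->
  Lam psi F - Lam psi' F <= M * I eta.
Proof.
move=> wp wp' we pe aF FM.
have [B FB] := Lam_bounded wp aF; have [B' FB'] := Lam_bounded wp' aF.
have -> : Lam psi F - Lam psi' F = - 1 * Lam psi' F + Lam psi F by ring.
rewrite /Lam -(wsum_lin _ FB' FB); apply: (@wsum_le _ _ (B + B')).
  move=> j; apply: (le_trans (ler_normD _ _)).
  by rewrite mulN1r normrN addrC lerD.
move=> j; rewrite mulrA -mulrDl ler_pdivrMr//.
rewrite -I_lin; [|exact: adm_Cc|exact: adm_Cc].
have cc : Cc (fun u => M * (1 + b j) ^+ 2 * eta u).
  rewrite (_ : (fun _ => _) = (fun u => eta u * (M * (1 + b j) ^+ 2))).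
    by apply: Cc_mul; [case: we|move=> x; exact: cvg_cst].
  by apply/funext => u; rewrite mulrC.
rewrite mulrAC -IZ; last by case: we.
apply: I_mono => //; first by apply: Cc_lin; exact: adm_Cc.
move=> u; have [Ku|nKu] := pselect (K2 u); last first.
  by rewrite (weight_supp wp)// (weight_supp wp')// (weight_supp we)// !mul0r !mulr0 addr0.
have -> : -1 * (psi' u * F (u, j)) + psi u * F (u, j) = (psi u - psi' u) * F (u, j) by ring.
apply: (le_trans (ler_norm _)); rewrite normrM mulrC.
by apply: ler_pM => //; exact: FM.
Qed.

Lemma Lam_shift w psi F : weight psi -> adm F ->
  (forall u, ~ K2 u -> psi (w * u)%g = 0) -> adm (fun z => F ((w^-1 * z.1)%g, z.2)) ->
  Lam psi (fun z => F ((w^-1 * z.1)%g, z.2)) = Lam (fun u => psi (w * u)%g) F.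
Proof.
move=> wp aF sw aF'; congr wsum; apply/funext => j; congr (_ / _).
have := I_shift w (adm_Cc j wp aF') => /= <-; congr I; apply/funext => u /=.
by rewrite mulKg.
Qed.

Lemma continuous_mdist (T : topologicalType) (f g : T -> X) :
  continuous f -> continuous g -> continuous (fun x => mdist (f x) (g x)).
Proof.
move=> cf cg x; apply/cvgrPdist_lt => e e0; have e2 : 0 < e / 2 by rewrite divr_gt0.
have /cvg_mdistP/(_ _ e2) h1 := cf x; have /cvg_mdistP/(_ _ e2) h2 := cg x.
apply: filterS2 h1 h2 => y h1 h2.
have t1 := metric_triangle (f x) (f y) (g x).
have t2 := metric_triangle (f y) (g y) (g x).
have t3 := metric_triangle (f y) (f x) (g y).
have t4 := metric_triangle (f x) (g x) (g y).
rewrite (metric_sym (f y) (f x)) in t3; rewrite (metric_sym (g y) (g x)) in t2.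
by rewrite ltr_norml; apply/andP; split; move: h1 h2 t1 t2 t3 t4; lra.
Qed.

Lemma adq_dist q q' : adq q -> adq q' -> exists2 A, 0 <= A &
  forall u j, K2 u -> mdist (q (u, j)) (q' (u, j)) <= A * (1 + b j).
Proof.
move=> [_ [p [A qA]]] [_ [p' [A' qA']]].
exists (`|A| + mdist p p' + `|A'|); first by rewrite !addr_ge0// mdist_ge0.
move=> u j Ku; have h1 := qA u j Ku; have h2 := qA' u j Ku.
have t1 := metric_triangle (q (u, j)) p (q' (u, j)).
have t2 := metric_triangle p p' (q' (u, j)).
rewrite (metric_sym _ p) in t1.
have h3 : A * (1 + b j) <= `|A| * (1 + b j) by rewrite ler_wpM2r ?ler_norm// ltW.
have h4 : A' * (1 + b j) <= `|A'| * (1 + b j) by rewrite ler_wpM2r ?ler_norm// ltW.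
have h5 : mdist p p' <= mdist p p' * (1 + b j) by rewrite ler_peMr ?mdist_ge0// lerDl.
by rewrite !mulrDl; move: h1 h2 t1 t2 h3 h4 h5; lra.
Qed.

Lemma adm_admissible : admissible adm adq.
Proof.
split.
- exact: adm_const.
- by move=> *; exact: adm_lin2.
- move=> x; split; first by move=> j u; exact: cvg_cst.
  by exists x, 0 => u j _; rewrite mdistxx mul0r.
- move=> q q' aq aq'; have [A A0 qA] := adq_dist aq aq'; split.
    by move=> j; apply: continuous_mdist; [case: aq|case: aq'].
  exists A => u j Ku; rewrite ger0_norm ?mdist_ge0//.
  apply: (le_trans (qA u j Ku)); rewrite ler_wpM2l// expr2 ler_peMr ?(ltW (b1 j))//.
  by rewrite lerDl.
- move=> q q' aq aq'; have [A A0 qA] := adq_dist aq aq'; split.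
    have cd j : continuous (fun u => mdist (q (u, j)) (q' (u, j))).
      by apply: continuous_mdist; [case: aq|case: aq'].
    by move=> j u; rewrite (_ : (fun _ => _) = (fun u => mdist (q (u, j)) (q' (u, j)) * mdist (q (u, j)) (q' (u, j)))) //; apply: cvgM; exact: cd.
  exists (A ^+ 2) => u j Ku; rewrite ger0_norm ?sqr_ge0// -exprMn.
  by rewrite lerXn2r ?nnegrE ?mdist_ge0 ?qA// mulr_ge0// ltW.
Qed.

End averaging.

(** * The averaging operator on equivariant maps *)

Section uniform_continuity.
Context {R : realType} {X : metricType R} {G : topGroupType}.

(** Points near [g] are written [w * g] with [w] near 1: for equivariant maps, moduli of continuity
    in this form are invariant under [Gamma] on the right. *)
Lemma continuous_from_left (f : G -> X) :
  (forall g e, 0 < e -> \forall w \near (1%g : G), mdist (f g) (f (w * g)%g) <= e) ->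
  continuous f.
Proof.
move=> H g; apply/cvg_mdistP => e e0; have e2 : 0 < e / 2 by rewrite divr_gt0.
have hc : (fun g' => g' * g^-1)%g @ g --> (1%g : G).
  by have := @mulg_continuousr G (g^-1)%g g; rewrite /continuous_at mulgV.
have : nbhs g [set g' | mdist (f g) (f (g' * g^-1 * g)%g) <= e / 2] by exact: hc (H g _ e2).
by apply: filterS => g' /=; rewrite mulgVK => /le_lt_trans; apply; rewrite ltr_pdivrMr// mulr_natr mulr2n ltrDl.
Qed.

Lemma near_compact_unif (f : G -> X) (C : set G) (e : R) : continuous f -> compact C -> 0 < e ->
  \forall w \near (1%g : G), forall g, C g -> mdist (f g) (f (w * g)%g) <= e.
Proof.
move=> cf cC e0; have e2 : 0 < e / 2 by rewrite divr_gt0.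
have : \forall w \near (1%g : G), C `<=` [set g | mdist (f g) (f (w * g)%g) <= e].
  move/compact_near_coveringP: cC; apply => g Cg.
  have n1 : nbhs g [set g' | mdist (f g) (f g') < e / 2].
    by have /cvg_mdistP/(_ _ e2) := cf g.
  have n2 : nbhs (g, (1%g : G)) [set z | mdist (f g) (f (z.2 * z.1)%g) < e / 2].
    have hc : (fun z : G * G => f (z.2 * z.1)%g) @ (g, (1%g : G)) --> f g.
      have hm : (fun z : G * G => (z.2 * z.1)%g) @ (g, (1%g : G)) --> (1 * g)%g.
        by apply: cvgM_group; [exact: cvg_snd|exact: cvg_fst].
      by rewrite mul1g in hm; exact: (@cvg_comp _ _ _ _ f _ _ _ hm (cf g)).
    by move/cvg_mdistP: hc; exact.
  case: n2 => -[P Q] /= [nP nQ] PQ.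
  exists ([set g' | mdist (f g) (f g') < e / 2] `&` P, Q) => /=.
    by split=> //; exact: filterI.
  move=> [g' w] /= [[h1 Pg'] Qw]; have h2 := PQ (g', w) (conj Pg' Qw); rewrite /= in h2.
  apply: (le_trans (metric_triangle _ (f g) _)); rewrite (metric_sym (f g')).
  by move: h1 h2; lra.
by [].
Qed.

End uniform_continuity.

Section operator.
Context {R : realType} {X : metricType R} (properX : proper_space X) (CAT0X : CAT0 X).
Context {G K : topGroupType} (Gamma : set G) (pr : G -> K) (em : K -> G).
Context (hG : hausdorff_space G) (lcG : locally_compact [set: G]).
Hypothesis Gamma1 : Gamma 1%g.
Hypothesis GammaM : forall a b, Gamma a -> Gamma b -> Gamma (a * b)%g.
Hypothesis GammaV : forall a, Gamma a -> Gamma (a^-1)%g.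
Hypothesis cocompactGamma : cocompact Gamma.
Hypothesis prM : forall a b, pr (a * b)%g = (pr a * pr b)%g.
Hypothesis emM : forall a b, em (a * b)%g = (em a * em b)%g.
Hypothesis prK : forall h, pr (em h) = h.
Hypothesis pr_cont : continuous pr.
Hypothesis em_cont : continuous em.
Hypothesis em_comm : forall a h, pr a = 1%g -> (a * em h)%g = (em h * a)%g.
Context (tau : G -> isom_group X) (N : set G).
Hypothesis Nconj : forall n s, N n -> N (s * n * s^-1)%g.

(** [G] is the product of the kernel of [pr] and the image of [em], which commute; [kappa] is the
    projection to the kernel. *)
Definition kappa (u : G) : G := (u * (em (pr u))^-1)%g.

Lemma hom1 (A B : groupType) (f : A -> B) :
  (forall a b, f (a * b)%g = (f a * f b)%g) -> f 1%g = 1%g.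
Proof. by move=> fM; apply: (mulgI (f 1%g)); rewrite -fM !mulg1. Qed.

Lemma homV (A B : groupType) (f : A -> B) a :
  (forall a b, f (a * b)%g = (f a * f b)%g) -> f (a^-1)%g = (f a)^-1%g.
Proof. by move=> fM; apply: (mulgI (f a)); rewrite -fM !mulgV hom1. Qed.

Lemma pr_kappa u : pr (kappa u) = 1%g.
Proof. by rewrite /kappa prM homV// prK mulgV. Qed.

Lemma kappa_id u : pr u = 1%g -> kappa u = u.
Proof. by rewrite /kappa => ->; rewrite hom1// invg1 mulg1. Qed.

Lemma kappa_decomp u : u = (kappa u * em (pr u))%g.
Proof. by rewrite /kappa mulgVK. Qed.

Lemma kappaM u v : kappa (u * v)%g = (kappa u * kappa v)%g.
Proof.
have E := em_comm (pr u) (pr_kappa v).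
apply: (mulIg (em (pr (u * v)%g))); rewrite -kappa_decomp prM emM.
rewrite mulgA -[X in (X * em (pr v))%g]mulgA E mulgA -kappa_decomp.
by rewrite -[X in _ = X]mulgA -kappa_decomp.
Qed.

Lemma kappa_continuous : continuous kappa.
Proof.
move=> u; apply: cvgM_group; first exact: cvg_id.
apply: cvgV_group; exact: (@cvg_comp _ _ _ pr em _ _ _ (@pr_cont u) (@em_cont (pr u))).
Qed.

(** [N] will be the product of the factors already treated; it grows along the induction over the
    factors. *)
Record cls (f : G -> X) : Prop := Cls {
  cls_cont : continuous f ;
  cls_equi : forall g c, Gamma c -> f (g * c)%g = (tau c)^-1%g (f g) ;
  cls_inv : forall n g, N n -> f (n * g)%g = f g
}.

Lemma cls_dist_inv f f' w w' g c : cls f -> cls f' -> Gamma c ->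
  mdist (f (w * (g * c))%g) (f' (w' * (g * c))%g) = mdist (f (w * g)%g) (f' (w' * g)%g).
Proof. by move=> cf cf' Gc; rewrite !mulgA (cls_equi cf _ Gc) (cls_equi cf' _ Gc) isom_mdist. Qed.

Lemma cls_max f f' : cls f -> cls f' ->
  exists g0, forall g, mdist (f g) (f' g) <= mdist (f g0) (f' g0).
Proof.
move=> cf cf'; apply: (invariant_max Gamma1 GammaM GammaV cocompactGamma (h := fun g => mdist (f g) (f' g))).
  by apply: continuous_mdist; exact: cls_cont.
by move=> g c Gc; have := cls_dist_inv 1%g 1%g g cf cf' Gc; rewrite !mul1g.
Qed.

(** The displacement by a left translation is invariant under [Gamma] on the right, so uniformity on
    a compact set of representatives suffices. *)
Lemma cls_unif f e : cls f -> 0 < e ->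
  \forall w \near (1%g : G), forall g, mdist (f g) (f (w * g)%g) <= e.
Proof.
move=> cf e0; have [C cC CG] := cocompact_ex hG lcG Gamma1 GammaM GammaV cocompactGamma R.
have := near_compact_unif (cls_cont cf) cC e0; apply: filterS => w H g.
have [c Gc Cgc] := CG g; have := H _ Cgc.
by have := cls_dist_inv 1%g w g cf cf Gc; rewrite !mul1g => ->.
Qed.

Context (I : (G -> R) -> R).
Hypothesis I_lin : forall a F F', Cc F -> Cc F' ->
  I (fun x => a * F x + F' x) = a * I F + I F'.
Hypothesis I_mono : forall F F', Cc F -> Cc F' -> (forall x, F x <= F' x) -> I F <= I F'.
Hypothesis I_shift : forall w F, Cc F -> I (fun x => F (w * x)%g) = I F.
Hypothesis I_gt0 : forall F x0, Cc F -> (forall x, 0 <= F x) -> 0 < F x0 -> 0 < I F.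

Context (f0 : G -> X) (phi : G -> R) (t : nat -> G) (K2 : set G) (b : nat -> R).
Hypothesis cls_f0 : cls f0.
Hypothesis b0 : forall j, 0 <= b j.
Hypothesis wphi : weight K2 phi.
Hypothesis cover_t : forall g, exists j u, 0 < phi u /\ g = (t j * u^-1)%g.
Hypothesis smooth : forall e, 0 < e -> \forall w \near (1%g : G),
  weight K2 (fun u => phi (w * u)%g) /\
  exists2 eta, weight K2 eta & (forall u, `|phi u - phi (w * u)%g| <= eta u) /\ I eta <= e.
Hypothesis bP : forall j u g, K2 u -> mdist (f0 g) (f0 (kappa (t j * u^-1) * g)%g) <= b j.

Local Notation L := (Lam I b).

Lemma phi_supp : exists u, 0 < phi u.
Proof. by have [j [u [pu _]]] := cover_t 1%g; exists u. Qed.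

Let posL : posfun (adm K2 b) [set w | 0 < phi w.1] (L phi).
Proof. by have [u pu] := phi_supp; apply: (Lam_posfun I_lin I_mono I_gt0 b0 wphi pu). Qed.

Let admQ := @adm_admissible R X G K2 b b0.

(** By [cover_t] every element of the kernel of [pr] arises from a point [u] of positive weight. The
    inverse of [u] turns left translations of [u], under which [I] is invariant, into right
    multiplications of the sample. *)
Definition step (u : G) (j : nat) : G := kappa (t j * u^-1)%g.

Lemma step_onto s : pr s = 1%g -> exists j u, 0 < phi u /\ s = step u j.
Proof.
move=> s1; have [j [u [pu sE]]] := cover_t s; exists j, u; split=> //.
by rewrite /step -sE kappa_id.
Qed.

Lemma pr_step u j : pr (step u j) = 1%g. Proof. exact: pr_kappa. Qed.

Lemma step_continuous j : continuous (fun u => step u j).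
Proof.
move=> u; apply: (@cvg_comp _ _ _ (fun u => t j * u^-1)%g kappa); last exact: kappa_continuous.
by apply: cvgM_group; [exact: cvg_cst|apply: cvgV_group; exact: cvg_id].
Qed.

Lemma step_shift w u j : pr w = 1%g -> step (w^-1 * u)%g j = (step u j * w)%g.
Proof.
by move=> w1; rewrite /step invgM invgK mulgA [RHS](_ : _ = kappa (t j * u^-1)%g * kappa w)%g ?kappaM// (kappa_id w1).
Qed.

Definition samples (f : G -> X) (g : G) (w : G * nat) : X := f (step w.1 w.2 * g)%g.

Lemma samples_bound f Rf u j g : (forall g, mdist (f g) (f0 g) <= Rf) -> K2 u ->
  mdist (f g) (samples f g (u, j)) <= (2 * Rf + 1) * (1 + b j).
Proof.
move=> fR Ku; rewrite /samples /=; set s := step u j.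
have R0 : 0 <= Rf := le_trans (mdist_ge0 _ _) (fR g).
have t1 := metric_triangle (f g) (f0 g) (f (s * g)%g).
have t2 := metric_triangle (f0 g) (f0 (s * g)%g) (f (s * g)%g).
have h1 := fR g; have h2 := fR (s * g)%g; have h3 := bP j g Ku.
rewrite (metric_sym (f0 (s * g)%g)) in t2.
have : 0 <= 2 * Rf * b j by rewrite !mulr_ge0.
move: t1 t2 h1 h2 h3; rewrite -/(step u j) -/s; lra.
Qed.

Lemma cls_bounded f f' : cls f -> cls f' -> exists2 Rf, 0 <= Rf & forall g, mdist (f g) (f' g) <= Rf.
Proof.
by move=> cf cf'; have [g0 H] := cls_max cf cf'; exists (mdist (f g0) (f' g0)) => //; exact: mdist_ge0.
Qed.

Lemma samples_adq f g : cls f -> adq K2 b (samples f g).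
Proof.
move=> cf; split=> [j u|].
  apply: (@cvg_comp _ _ _ (fun u => step u j * g)%g f _ _ _ _ (cls_cont cf (x := (step u j * g)%g))).
  by apply: cvgM_group; [exact: step_continuous|exact: cvg_cst].
have [Rf _ fR] := cls_bounded cf cls_f0.
by exists (f g), (2 * Rf + 1) => u j Ku; exact: samples_bound.
Qed.

Definition Pop (f : G -> X) (g : G) : X := bar (f0 1%g) (L phi) (samples f g).

Let lam := mass (L phi).
Let lam_gt0 : 0 < lam := posfun_mass posL.

Lemma Pop_barP f g x : cls f ->
  L phi (fun w => mdist (Pop f g) (samples f g w) ^+ 2) + lam * mdist x (Pop f g) ^+ 2 <=
  L phi (fun w => mdist x (samples f g w) ^+ 2).
Proof. by move=> cf; apply: (barP properX CAT0X admQ (f0 1%g) posL (samples_adq g cf)). Qed.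

Lemma Pop_nonexp f f' g g' : cls f -> cls f' ->
  lam * mdist (Pop f g) (Pop f' g') <= L phi (fun w => mdist (samples f g w) (samples f' g' w)).
Proof.
by move=> cf cf'; apply: (bar_nonexp properX CAT0X admQ (f0 1%g) posL (samples_adq g cf) (samples_adq g' cf')).
Qed.

Lemma samples_dist_adm f f' g g' : cls f -> cls f' ->
  adm K2 b (fun w => mdist (samples f g w) (samples f' g' w)).
Proof. by move=> cf cf'; apply: (Q_dist admQ); exact: samples_adq. Qed.

Lemma Pop_le f f' g g' D : cls f -> cls f' ->
  (forall s, pr s = 1%g -> mdist (f (s * g)%g) (f' (s * g')%g) <= D) ->
  mdist (Pop f g) (Pop f' g') <= D.
Proof.
move=> cf cf' H; rewrite -(ler_pM2l lam_gt0) (le_trans (Pop_nonexp g g' cf cf'))// mulrC.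

apply: (posfun_le (adm_cst admQ) posL); first exact: samples_dist_adm.
by move=> [u j] _ /=; apply: H; exact: pr_step.
Qed.

(** The variance inequalities at [g * c] and at [g], each tested at the barycentre transported from
    the other, bound the squared distance by 0. *)
Lemma Pop_equi f g c : cls f -> Gamma c -> Pop f (g * c)%g = (tau c)^-1%g (Pop f g).
Proof.
move=> cf Gc; apply: mdist_positivity; apply/eqP.
have H1 := Pop_barP (g * c)%g ((tau c)^-1%g (Pop f g)) cf.
have H2 := Pop_barP g (tau c (Pop f (g * c)%g)) cf.
have E x : L phi (fun w => mdist x (samples f (g * c)%g w) ^+ 2) =
    L phi (fun w => mdist (tau c x) (samples f g w) ^+ 2).
  congr (L phi _); apply/funext => w.
  by rewrite /samples mulgA (cls_equi cf _ Gc) -(isom_mdist (tau c)) isom_invKV.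
rewrite !E isom_invKV in H1.
rewrite -(isom_mdist (tau c)^-1%g) isom_invK in H2.
rewrite (metric_sym ((tau c)^-1%g _)) in H1.
have : lam * mdist (Pop f (g * c)%g) ((tau c)^-1%g (Pop f g)) ^+ 2 <= 0 by lra.
by rewrite pmulr_rle0// => h; rewrite -sqrf_eq0 eq_le h sqr_ge0.
Qed.

Lemma Pop_inv f n g : cls f -> N n -> Pop f (n * g)%g = Pop f g.
Proof.
move=> cf Nn; congr (bar _ _ _); apply/funext => w.
rewrite /samples; move: (step _ _) => s.
by rewrite -(cls_inv cf (s * g)%g (Nconj s Nn)) !mulgA mulgVK.
Qed.

(** By left invariance of [I], moving [g] by an element of the kernel amounts to translating the
    weight while keeping the samples. *)
Lemma Pop_shift f w g : cls f -> pr w = 1%g -> weight K2 (fun u => phi (w * u)%g) ->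
  Pop f (w * g)%g = bar (f0 1%g) (L (fun u => phi (w * u)%g)) (samples f g) /\
  mass (L (fun u => phi (w * u)%g)) = lam.
Proof.
move=> cf w1 wp.
have sw u : ~ K2 u -> phi (w * u)%g = 0 by exact: weight_supp wp u.
have mE : mass (L (fun u => phi (w * u)%g)) = lam.
  by rewrite /lam /mass -(Lam_shift I_shift wphi (adm_cst admQ 1) sw (adm_cst admQ 1)).
split=> //; rewrite /Pop /bar mE; congr (xget _ _); apply/funext => x.
have E y : L phi (fun z => mdist y (samples f (w * g)%g z) ^+ 2) =
    L (fun u => phi (w * u)%g) (fun z => mdist y (samples f g z) ^+ 2).
  pose F0 z := mdist y (samples f g z) ^+ 2.
  have F1 : (fun z : G * nat => mdist y (samples f (w * g)%g z) ^+ 2) =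
      (fun z => F0 ((w^-1 * z.1)%g, z.2)).
    by apply/funext => z; rewrite /F0 /samples /= step_shift// mulgA.
  rewrite F1; apply: (Lam_shift I_shift wphi) => //.
  - exact: (Q_dl2 admQ y (samples_adq g cf)).
  - by rewrite -F1; exact: (Q_dl2 admQ y (samples_adq (w * g)%g cf)).
by rewrite /= propeqE; split=> H y; have := H y; rewrite !E.
Qed.

Let c1 := L phi (fun w => 1 + b w.2).

Lemma adm_b : adm K2 b (fun w => 1 + b w.2).
Proof.
split; first by move=> j u; exact: cvg_cst.
exists 1 => u j _; have h : 1 <= 1 + b j by rewrite lerDl.
by rewrite mul1r ger0_norm ?(le_trans ler01)// expr2 ler_peMr// (le_trans ler01).
Qed.

Lemma c1_ge0 : 0 <= c1.
Proof.
apply: (posfun_ge0 (adm_cst admQ) posL adm_b) => w _ /=.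
by rewrite addr_ge0.
Qed.

(** A constant map is its own barycentre, so nonexpansion bounds the distance by the mean of
    [(2 * Rf + 1) * (1 + b)]. The weight [psi] is general in order to cover translates of [phi]. *)
Lemma bar_samples_dist psi f Rf g u0 : cls f -> weight K2 psi -> 0 < psi u0 ->
  mass (L psi) = lam -> L psi (fun w => 1 + b w.2) = c1 ->
  (forall g, mdist (f g) (f0 g) <= Rf) ->
  mdist (bar (f0 1%g) (L psi) (samples f g)) (f g) <= (2 * Rf + 1) * (c1 / lam).
Proof.
move=> cf wp pu mE cE fR.
have pL := Lam_posfun I_lin I_mono I_gt0 b0 wp pu.
have bc := barP properX CAT0X admQ (f0 1%g) pL (Q_cst admQ (f g)) (f g).
have E : bar (f0 1%g) (L psi) (fun=> f g) = f g.
  apply: mdist_positivity; apply/eqP; move: bc.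
  have -> : (fun w : G * nat => mdist (f g) (f g) ^+ 2) = (fun=> 0).
    by apply/funext => w; rewrite mdistxx expr0n.
  rewrite (posfun_cst (adm_cst admQ) pL) (posfun_cst (adm_cst admQ) pL) mE mul0r metric_sym => h.
  have : lam * mdist (f g) (bar (f0 1%g) (L psi) (fun=> f g)) ^+ 2 <= 0.
    have : 0 <= mdist (f g) (bar (f0 1%g) (L psi) (fun=> f g)) ^+ 2 * lam.
      by rewrite mulr_ge0 ?sqr_ge0// ltW.
    by move: h; lra.
  by rewrite pmulr_rle0// => h'; rewrite -sqrf_eq0 eq_le h' sqr_ge0.
have := bar_nonexp properX CAT0X admQ (f0 1%g) pL (samples_adq g cf) (Q_cst admQ (f g)).
rewrite E mE => H; rewrite mulrA ler_pdivlMr// mulrC (le_trans H)//.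
rewrite -cE -(posfunZ (adm_cst admQ) pL _ adm_b).
apply: (posfun_mono pL) => [||[u j] /= pu'].
- by apply: (Q_dist admQ); [exact: samples_adq|exact: (Q_cst admQ)].
- by apply: (adm_scale (adm_cst admQ) (adm_lin admQ)); exact: adm_b.
- rewrite metric_sym; apply: samples_bound => //; apply: contrapT => /(weight_supp wp) p0.
  by rewrite p0 ltxx in pu'.
Qed.

Lemma Pop_dist f Rf g : cls f -> (forall g, mdist (f g) (f0 g) <= Rf) ->
  mdist (Pop f g) (f g) <= (2 * Rf + 1) * (c1 / lam).
Proof. by move=> cf; have [u pu] := phi_supp; exact: (bar_samples_dist g cf wphi pu). Qed.

Let C0 := (c1 / lam + 1) / lam.

Lemma C0_ge0 : 0 <= C0.
Proof.
by rewrite divr_ge0 ?(ltW lam_gt0)// addr_ge0// divr_ge0 ?c1_ge0// ltW.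
Qed.

Lemma I_weight_ge0 eta : weight K2 eta -> 0 <= I eta.
Proof.
move=> we; rewrite -(integral_zero I_lin).
by apply: I_mono; [exact: Cc0|case: we|exact: weight_ge0 we].
Qed.

Lemma posfun_sub (adm' : set (G * nat -> R)) S S' L' : S `<=` S' ->
  posfun adm' S L' -> posfun adm' S' L'.
Proof.
move=> SS' [l m p]; split=> // F F' aF aF' FF'; apply: m => // w Sw.
by apply: FF'; exact: SS'.
Qed.

(** Only the size [Rf] of [f] enters. [bar_weights] bounds [D^2] through an integrand that is a
    difference of squares and has a factor [D]; after cancelling it the bound is linear in
    [I eta]. *)
Lemma Pop_smooth f Rf w g eta : cls f -> (forall g, mdist (f g) (f0 g) <= Rf) ->
  pr w = 1%g -> weight K2 (fun u => phi (w * u)%g) -> weight K2 eta ->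
  (forall u, `|phi u - phi (w * u)%g| <= eta u) ->
  mdist (Pop f g) (Pop f (w * g)%g) <= (2 * Rf + 1) * C0 * I eta.
Proof.
move=> cf fR w1 wp we pe; have [PE mE] := Pop_shift g cf w1 wp.
rewrite PE; set psi := (fun u => phi (w * u)%g) in wp PE mE *.
have [u pu] := phi_supp.
have pu' : 0 < psi (w^-1 * u)%g by rewrite /psi mulVKg.
have pL := Lam_posfun I_lin I_mono I_gt0 b0 wp pu'.
have cE : L psi (fun w => 1 + b w.2) = c1.
  by rewrite /c1 -(Lam_shift I_shift wphi adm_b (weight_supp wp))//; exact: adm_b.
have BW := bar_weights properX CAT0X admQ (f0 1%g)
  (posfun_sub (@subsetT _ _) posL) (posfun_sub (@subsetT _ _) pL) (samples_adq g cf).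
set q := samples f g in BW *; set x := bar _ (L phi) q in BW *; set y := bar _ (L psi) q in BW *.
rewrite mE -/lam -mulr2n in BW.
set D := mdist x y in BW *.
have D0 : 0 <= D := mdist_ge0 _ _.
(* [M * (1 + b j)] bounds the sum of the distances from [x] and [y] to a sample, each estimated
   through [f g]. *)
pose M := 2 * ((2 * Rf + 1) * (c1 / lam + 1)).
have R0 : 0 <= 2 * Rf + 1.
  by rewrite addr_ge0// mulr_ge0// (le_trans (mdist_ge0 _ _) (fR g)).
have bx : mdist x (f g) <= (2 * Rf + 1) * (c1 / lam) := Pop_dist g cf fR.
have by_ : mdist y (f g) <= (2 * Rf + 1) * (c1 / lam) := bar_samples_dist g cf wp pu' mE cE fR.
have cl0 : 0 <= c1 / lam by rewrite divr_ge0 ?c1_ge0// ltW.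
have FM v j : K2 v -> `|mdist y (q (v, j)) ^+ 2 - mdist x (q (v, j)) ^+ 2| <= D * M * (1 + b j) ^+ 2.
  move=> Kv; have qb := samples_bound j g fR Kv; rewrite -/q in qb.
  rewrite subr_sqr normrM [X in _ * X]ger0_norm ?addr_ge0 ?mdist_ge0// -mulrA.
  have h1 : `|mdist y (q (v, j)) - mdist x (q (v, j))| <= D.
    rewrite ler_norml; apply/andP; split.
      by have := metric_triangle x y (q (v, j)); rewrite -/D; lra.
    by have := metric_triangle y x (q (v, j)); rewrite (metric_sym y x) -/D; lra.
  apply: ler_pM => //; first by rewrite addr_ge0// mdist_ge0.
  have bj1 : 1 <= 1 + b j by rewrite lerDl.
  have h2 : mdist y (q (v, j)) + mdist x (q (v, j)) <= M * (1 + b j).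
    have t1 := metric_triangle y (f g) (q (v, j)).
    have t2 := metric_triangle x (f g) (q (v, j)).
    have h3 : (2 * Rf + 1) * (c1 / lam) <= (2 * Rf + 1) * (c1 / lam) * (1 + b j).
      by rewrite ler_peMr// mulr_ge0.
    have E : M * (1 + b j) = 2 * ((2 * Rf + 1) * (c1 / lam) * (1 + b j)) + 2 * ((2 * Rf + 1) * (1 + b j)).
      by rewrite /M; ring.
    by rewrite E; move: t1 t2 h3 qb bx by_; lra.
  apply: (le_trans h2); rewrite ler_wpM2l//.
    by rewrite /M !mulr_ge0// addr_ge0.
  by rewrite expr2 ler_peMr// (le_trans ler01).
have aF : adm K2 b (fun z => mdist y (q z) ^+ 2 - mdist x (q z) ^+ 2).
  by apply: (adm_sub (adm_lin admQ)); exact: (Q_dl2 admQ _ (samples_adq g cf)).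
have := Lam_sub_le I_lin I_mono b0 wphi wp we pe aF FM.
move=> /(le_trans BW) H.
have [->|Dn0] := eqVneq D 0.
  by apply: mulr_ge0; [apply: mulr_ge0; [exact: R0|exact: C0_ge0]|exact: I_weight_ge0].
have Dp : 0 < D by rewrite lt_neqAle eq_sym Dn0.
have {}H : (2 * lam) * D <= M * I eta.
  rewrite -(ler_pM2r Dp); move: H; rewrite mulr2n; lra.
have E : (2 * Rf + 1) * C0 * I eta = (M * I eta) / (2 * lam).
  by rewrite /C0 /M; field; rewrite gt_eqF.
by rewrite E ler_pdivlMr ?mulr_gt0// mulrC.
Qed.

Lemma Pop_em f g h D : cls f -> (forall g, mdist (f g) (f (em h * g)%g) <= D) ->
  mdist (Pop f g) (Pop f (em h * g)%g) <= D.
Proof.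
move=> cf H; apply: Pop_le => // s s1.
by rewrite mulgA em_comm// -mulgA.
Qed.

(** A left translation by [w] is split into [kappa w], handled by smoothing, and [em (pr w)],
    handled by uniform continuity of [f] and nonexpansion. *)
Lemma Pop_cls f : cls f -> cls (Pop f).
Proof.
move=> cf; split; [|by move=> *; exact: Pop_equi|by move=> *; exact: Pop_inv].
apply: continuous_from_left => g e e0.
have [Rf R0 fR] := cls_bounded cf cls_f0.
pose M := (2 * Rf + 1) * C0 + 1.
have M0 : 0 < M by rewrite ltr_wpDl// mulr_ge0 ?C0_ge0// addr_ge0// mulr_ge0.
have e2 : 0 < e / 2 by rewrite divr_gt0.
have em1 : 0 < e / 2 / M by rewrite divr_gt0.
have kc : kappa @ (1%g : G) --> (1%g : G).
  by have := @kappa_continuous 1%g; rewrite /continuous_at (kappa_id (hom1 prM)).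
have ec : (fun w => em (pr w)) @ (1%g : G) --> (1%g : G).
  have := @cvg_comp _ _ _ pr em _ _ _ (@pr_cont 1%g) (@em_cont (pr 1%g)).
  by rewrite (hom1 prM) (hom1 emM).
have n1 : \forall w \near (1%g : G), weight K2 (fun u => phi (kappa w * u)%g) /\
    exists2 eta, weight K2 eta & (forall u, `|phi u - phi (kappa w * u)%g| <= eta u) /\ I eta <= e / 2 / M.
  exact: (kc _ (smooth em1)).
have n2 : \forall w \near (1%g : G), forall g, mdist (f g) (f (em (pr w) * g)%g) <= e / 2.
  exact: (ec _ (cls_unif cf e2)).
apply: filterS2 n1 n2 => w [wp [eta we [pe Ie]]] H2.
rewrite {1}(kappa_decomp w) -mulgA.
apply: (le_trans (metric_triangle _ (Pop f (em (pr w) * g)%g) _)).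
rewrite [leRHS]splitr lerD//; first exact: Pop_em.
apply: (le_trans (Pop_smooth _ cf fR (pr_kappa w) wp we pe)).
apply: (@le_trans _ _ (M * (e / 2 / M))); last by rewrite mulrC divfK// gt_eqF.
apply: ler_pM => //; first by rewrite mulr_ge0 ?C0_ge0// addr_ge0// mulr_ge0.
  exact: (I_weight_ge0 we).
by rewrite /M lerDl.
Qed.

(** The maximum principle: [D] minus the distance of the samples is nonnegative with nonpositive
    mean, and every element of the kernel is sampled. *)
Lemma Pop_max f f' g D : cls f -> cls f' -> (forall g, mdist (f g) (f' g) <= D) ->
  D <= mdist (Pop f g) (Pop f' g) ->
  forall s, pr s = 1%g -> mdist (f (s * g)%g) (f' (s * g)%g) = D.
Proof.
move=> cf cf' fD DP s s1; have [j [u [pu ->]]] := step_onto s1.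
have H := Pop_nonexp g g cf cf'.
have a1 := samples_dist_adm g g cf cf'.
have LD : L phi (fun w => D - mdist (samples f g w) (samples f' g w)) <= 0.
  rewrite (posfunB posL)//; last exact: (adm_cst admQ).
  rewrite (posfun_cst (adm_cst admQ) posL) subr_le0 -/lam mulrC (le_trans _ H)//.
  by rewrite ler_pM2l.
have aD : adm K2 b (fun w => D - mdist (samples f g w) (samples f' g w)).
  by apply: (adm_sub (adm_lin admQ)) => //; exact: (adm_cst admQ).
have := @Lam_eq0 _ _ _ I_lin I_mono I_gt0 K2 b b0 phi _ u j wphi aD _ LD pu.
rewrite /samples /= => E; apply/esym/eqP; rewrite -subr_eq0 E// => w _.
by rewrite subr_ge0.
Qed.


(** That [c] does not depend on [F] matters: [F] will vary along a sequence of maps. *)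
Lemma Lam_local_pos u0 j (O : set G) : 0 < phi u0 -> nbhs u0 O ->
  exists2 c, 0 < c & forall F m, adm K2 b F -> (forall w, 0 <= F w) ->
    (forall u, O u -> m <= F (u, j)) -> c * m <= L phi F.
Proof.
move=> pu nO; have [chi [cc c01 c1' cO]] := bump R hG lcG nO.
have Ccp : Cc (fun u => phi u * chi u) by apply: Cc_mul => //; case: wphi.
have Ip : 0 < I (fun u => phi u * chi u).
  apply: (@I_gt0 _ u0) => //; last by rewrite c1' mulr1.
  by move=> u; rewrite mulr_ge0 ?(weight_ge0 wphi)//; case/andP: (c01 u).
have bj : 0 < 1 + b j by rewrite ltr_pwDl.
exists (dyadic j * (I (fun u => phi u * chi u) / (1 + b j) ^+ 2)).
  by rewrite mulr_gt0 ?dyadic_gt0// divr_gt0// exprn_gt0.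
move=> F m aF F0 Fm.
apply: (le_trans _ (Lam_ge_term I_lin I_mono b0 j wphi aF _)) => [|w _]; last exact: F0.
rewrite -mulrA ler_pM2l ?dyadic_gt0// mulrAC ler_pM2r ?invr_gt0 ?exprn_gt0//.
rewrite mulrC -(IZ I_lin)//; apply: I_mono.
- have -> : (fun x => m * (phi x * chi x)) = (fun x => (phi x * chi x) * m).
    by apply/funext => x; rewrite mulrC.
  by apply: Cc_mul => // x; exact: cvg_cst.
- exact: (adm_Cc j wphi aF).
move=> u; have p0 := weight_ge0 wphi u; have /andP[x0 x1] := c01 u.
rewrite mulrCA; apply: ler_wpM2l => //.
have [Ou|nOu] := pselect (O u); last by rewrite cO// mulr0.
have [m0|m0] := leP 0 m; first by rewrite (le_trans _ (Fm u Ou))// ler_piMr.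
by apply: (le_trans _ (F0 _)); rewrite mulr_le0_ge0// ltW.
Qed.

Lemma em_shift_cls f h : cls f -> cls (fun g => f (em h * g)%g).
Proof.
move=> cf; split.
- move=> g; apply: (@cvg_comp _ _ _ (fun g => em h * g)%g f _ _ _ _ (cls_cont cf (x := (em h * g)%g))).
  exact: mulg_continuousl.
- by move=> g c Gc; rewrite mulgA (cls_equi cf _ Gc).
- move=> n g Nn; rewrite -(cls_inv cf (em h * g)%g (Nconj (em h) Nn)).
  by rewrite !mulgA mulgVK.
Qed.

Lemma gpt_cls f f' s : cls f -> cls f' -> 0 <= s <= 1 -> cls (fun g => gpt (f g) (f' g) s).
Proof.
move=> cf cf' s01; split.
- move=> g; apply/cvg_mdistP => e e0; have e2 : 0 < e / 2 by rewrite divr_gt0.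
  have /cvg_mdistP/(_ _ e2) h1 := cls_cont cf (x := g).
  have /cvg_mdistP/(_ _ e2) h2 := cls_cont cf' (x := g).
  apply: filterS2 h1 h2 => g' h1 h2.
  apply: (le_lt_trans (gpt_convex CAT0X _ _ _ _ s01)).
  have /andP[s0 s1] := s01.
  have a1 : (1 - s) * mdist (f g) (f g') <= mdist (f g) (f g').
    by rewrite ler_piMl ?mdist_ge0// gerBl.
  have a2 : s * mdist (f' g) (f' g') <= mdist (f' g) (f' g').
    by rewrite ler_piMl ?mdist_ge0.
  by move: a1 a2 h1 h2; lra.
- move=> g c Gc; rewrite (cls_equi cf _ Gc) (cls_equi cf' _ Gc).
  by rewrite -(gpt_isom CAT0X _ _ _ s01)//; exact: isom_mdist.
- by move=> n g Nn; rewrite !(cls_inv cf, cls_inv cf').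
Qed.

Let Cd := c1 / lam.

Lemma Cd_ge0 : 0 <= Cd.
Proof. by rewrite divr_ge0 ?c1_ge0// ltW. Qed.

(** Instead of the fixed point of the [(1 - e)]-Lipschitz map [T], a finite iterate is taken: it
    stays in [cls] without a limit argument and keeps the modulus of [f0] along [em]. *)
Lemma approx_fixed (e : R) : 0 < e -> e <= 1 -> exists f, [/\ cls f,
  (forall h D, (forall g, mdist (f0 g) (f0 (em h * g)%g) <= D) ->
     forall g, mdist (f g) (f (em h * g)%g) <= D) &
  forall Rf, (forall g, mdist (f g) (f0 g) <= Rf) ->
     forall g, mdist (f g) (Pop f g) <= e * ((1 + 2 * Cd) * (1 + Rf))].
Proof.
move=> e0 e1; pose s := 1 - e.
have s01 : 0 <= s <= 1 by rewrite /s; apply/andP; split; move: e0 e1; lra.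
pose T (f : G -> X) g := gpt (f0 g) (Pop f g) s.
pose F := fix F (m : nat) : G -> X := if m is m'.+1 then T (F m') else f0.
have cF m : cls (F m).
  by elim: m => [//|m IH] /=; apply: gpt_cls => //; exact: Pop_cls.
have modF m h D : (forall g, mdist (f0 g) (f0 (em h * g)%g) <= D) ->
     forall g, mdist (F m g) (F m (em h * g)%g) <= D.
  move=> H0; elim: m => [//|m IH] g /=.
  apply: (le_trans (gpt_convex CAT0X _ _ _ _ s01)).
  have H1 := H0 g; have H2 := Pop_em g (cF m) IH.
  have /andP[s0 s1] := s01.
  have a1 : (1 - s) * mdist (f0 g) (f0 (em h * g)%g) <= (1 - s) * D.
    by rewrite ler_wpM2l// subr_ge0.
  have a2 : s * mdist (Pop (F m) g) (Pop (F m) (em h * g)%g) <= s * D by rewrite ler_wpM2l.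
  by move: a1 a2; lra.
have [D D0 FD] := cls_bounded (cF 1%N) (cF 0%N).
have contr m : forall g, mdist (F m.+1 g) (F m g) <= s ^+ m * D.
  elim: m => [|m IH] g; first by rewrite expr0 mul1r.
  apply: (le_trans (gpt_convex1 CAT0X _ _ _ s01)).
  have /andP[s0 _] := s01.
  rewrite exprS -mulrA ler_wpM2l//; by apply: (Pop_le (cF m.+1) (cF m)) => s' _; exact: IH.
have [m sm] : exists m, s ^+ m * D <= e.
  have cs : (fun m => s ^+ m) @ \oo --> (0 : R).
    apply: cvg_expr; case/andP: s01 => s0 _; rewrite ger0_norm// /s.
    by move: e0; lra.
  have D1 : 0 < D + 1 by rewrite ltr_wpDl.
  have eD : 0 < e / (D + 1) by rewrite divr_gt0.
  have /cvgrPdist_le/(_ _ eD) [m _ H] := cs.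
  exists m; have := H m (leqnn m); rewrite /= sub0r normrN ger0_norm ?exprn_ge0//; last by case/andP: s01.
  rewrite ler_pdivlMr// => h; apply: (le_trans _ h); rewrite ler_wpM2l ?lerDl//.
  by rewrite exprn_ge0//; case/andP: s01.
exists (F m); split=> // [h D' H|Rf FR g]; first exact: modF.
have h1 : mdist (F m g) (F m.+1 g) <= e by rewrite metric_sym (le_trans (contr m g)).
have [_ h2] := gptP CAT0X (f0 g) (Pop (F m) g) s01.
have h3 := Pop_dist g (cF m) FR; rewrite -/Cd in h3.
have h4 := FR g.
have t1 := metric_triangle (F m g) (F m.+1 g) (Pop (F m) g).
have t2 := metric_triangle (f0 g) (F m g) (Pop (F m) g).
rewrite (metric_sym (f0 g) (F m g)) (metric_sym (F m g) (Pop _ g)) in t2.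
have h5 : (1 - s) * mdist (f0 g) (Pop (F m) g) <= e * (Rf + (2 * Rf + 1) * Cd).
  rewrite /s subKr ler_wpM2l ?(ltW e0)//.
  by move: h3 h4 t2; lra.
have h6 : mdist (F m.+1 g) (Pop (F m) g) <= e * (Rf + (2 * Rf + 1) * Cd).
  by rewrite (_ : F m.+1 g = gpt (f0 g) (Pop (F m) g) s)// h2.
have h7 : 0 <= e * Cd by rewrite mulr_ge0 ?Cd_ge0 ?(ltW e0).
by move: h1 h6 t1 h7; lra.
Qed.

Lemma step_near u0 j (P : set G) : nbhs (1%g : G) P ->
  \forall u \near u0, P (step u j * (step u0 j)^-1)%g.
Proof.
move=> nP; have hc : (fun u => step u j * (step u0 j)^-1)%g @ u0 --> (1%g : G).
  rewrite -[X in _ --> X](mulgV (step u0 j)).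
  by apply: cvgM_group; [exact: step_continuous|exact: cvg_cst].
exact: hc nP.
Qed.

Hypothesis tau_indec : indecomposable (tau @` Gamma).
Hypothesis tau_unbounded : unbounded (tau @` Gamma).

(** Faithfulness on the closed invariant set [[set xi]] would make [tau] trivial on [Gamma], against
    unboundedness. *)
Lemma no_fixed_at_infinity (xi : boundary X) :
  ~ forall g, (tau @` Gamma) g -> boundary_act g xi = xi.
Proof.
move=> H.
have [faith _] := tau_indec (C := [set xi]) (ex_intro _ xi erefl) (closed_boundary1 CAT0X (xi := xi))
  (fun g x Lg xx => etrans (congr1 _ xx) (H g Lg)).
have [x []] := tau_unbounded; exists 0 => _ _ [_ [a Ga <-] <-] [_ [a' Ga' <-] <-].
have t1 c : Gamma c -> tau c = 1%g.
  move=> Gc; apply: faith; first by apply: subset_closure; exists c.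
  by move=> _ ->; apply: H; exists c.
by rewrite !t1// mdistxx.
Qed.

(** * Limits of approximate fixed points *)

Section harmonic_limit.
Context (f_ : nat -> G -> X) (gk : nat -> G) (Rk : nat -> R) (C : set G) (A : R)
  (U : set_system nat).
Hypothesis UU : UltraFilter U.
Hypothesis U_oo : \oo `<=` U.
Hypothesis cC : compact C.
Hypothesis CG : forall g, exists2 c, Gamma c & C (g * c)%g.
Hypothesis A0 : 0 <= A.
Hypothesis cf_ : forall k, cls (f_ k).
Hypothesis mod_f : forall k h D, (forall g, mdist (f0 g) (f0 (em h * g)%g) <= D) ->
     forall g, mdist (f_ k g) (f_ k (em h * g)%g) <= D.
Hypothesis f_Rk : forall k g, mdist (f_ k g) (f0 g) <= Rk k.
Hypothesis f_gk : forall k, C (gk k) /\ Rk k = mdist (f_ k (gk k)) (f0 (gk k)).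
Hypothesis f_Pop : forall k g, mdist (f_ k g) (Pop (f_ k) g) <= k.+1%:R^-1 * (A * (1 + Rk k)).

Lemma Rk_ge0 k : 0 <= Rk k.
Proof. by have [_ ->] := f_gk k; exact: mdist_ge0. Qed.

Lemma almost_harmonic e : 0 < e -> \forall k \near U, forall g,
  mdist (f_ k g) (Pop (f_ k) g) <= e * (1 + Rk k).
Proof.
move=> e0; have e1 : 0 < e / (A + 1) by rewrite divr_gt0// ltr_wpDl.
have /U_oo := inv_succ_small e1; apply: filterS => k hk g.
apply: (le_trans (f_Pop k g)); rewrite mulrA ler_wpM2r ?addr_ge0 ?Rk_ge0//.
have A1 : 0 < A + 1 by rewrite ltr_wpDl.
rewrite ler_pdivlMr// in hk.
apply: (le_trans _ hk); rewrite ler_wpM2l ?invr_ge0//.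
by rewrite lerDl.
Qed.

(** [f_ k] is close to its average, which is smooth along the kernel by [Pop_smooth]; along [em] the
    modulus is that of [f0]. The errors scale with [1 + Rk k]. *)
Lemma almost_equicontinuous e : 0 < e -> exists2 P, nbhs (1%g : G) P &
  \forall k \near U, forall w g, P w -> mdist (f_ k g) (f_ k (w * g)%g) <= e * (1 + Rk k).
Proof.
move=> e0; have e4 : 0 < e / 4 by rewrite divr_gt0.
have [C1 C11 CC1] : exists2 C1, 1 <= C1 & C0 <= C1.
  by exists (C0 + 1); rewrite ?lerDl// lerDr C0_ge0.
have C10 : 0 < C1 by rewrite (lt_le_trans ltr01).
have eC : 0 < e / 4 / (2 * C1) by rewrite divr_gt0// mulr_gt0.
have kc : kappa @ (1%g : G) --> (1%g : G).
  by have := @kappa_continuous 1%g; rewrite /continuous_at (kappa_id (hom1 prM)).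
have ec : (fun w => em (pr w)) @ (1%g : G) --> (1%g : G).
  have := @cvg_comp _ _ _ pr em _ _ _ (@pr_cont 1%g) (@em_cont (pr 1%g)).
  by rewrite (hom1 prM) (hom1 emM).
have n1 : \forall w \near (1%g : G), weight K2 (fun u => phi (kappa w * u)%g) /\
    exists2 eta, weight K2 eta & (forall u, `|phi u - phi (kappa w * u)%g| <= eta u) /\ I eta <= e / 4 / (2 * C1).
  exact: (kc _ (smooth eC)).
have n2 : \forall w \near (1%g : G), forall g, mdist (f0 g) (f0 (em (pr w) * g)%g) <= e / 4.
  exact: (ec _ (cls_unif cls_f0 e4)).
exists [set w | (weight K2 (fun u => phi (kappa w * u)%g) /\
    exists2 eta, weight K2 eta & (forall u, `|phi u - phi (kappa w * u)%g| <= eta u) /\ I eta <= e / 4 / (2 * C1)) /\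
    forall g, mdist (f0 g) (f0 (em (pr w) * g)%g) <= e / 4]; first exact: filterI.
have := almost_harmonic e4; apply: filterS => k hk w g [[wp [eta we [pe Ie]]] H2].
rewrite (kappa_decomp w) -mulgA; set y := (em (pr w) * g)%g.
have d1 : mdist (f_ k g) (f_ k y) <= e / 4 by exact: mod_f.
have d2 := hk y; have d3 := hk (kappa w * y)%g.
have d4 : mdist (Pop (f_ k) y) (Pop (f_ k) (kappa w * y)%g) <= e / 4 * (1 + Rk k).
  apply: (le_trans (Pop_smooth y (cf_ k) (f_Rk k) (pr_kappa w) wp we pe)).
  apply: (@le_trans _ _ ((2 * (1 + Rk k)) * C1 * (e / 4 / (2 * C1)))).
    apply: ler_pM => //.
    - by rewrite mulr_ge0 ?C0_ge0// addr_ge0// mulr_ge0// Rk_ge0.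
    - exact: I_weight_ge0.
    apply: ler_pM => //; first by rewrite addr_ge0// mulr_ge0// Rk_ge0.
      exact: C0_ge0.
    by have := Rk_ge0 k; lra.
  by rewrite le_eqVlt; apply/orP; left; apply/eqP; field; rewrite gt_eqF.
have t1 := metric_triangle (f_ k g) (f_ k y) (f_ k (kappa w * y)%g).
have t2 := metric_triangle (f_ k y) (Pop (f_ k) y) (f_ k (kappa w * y)%g).
have t3 := metric_triangle (Pop (f_ k) y) (Pop (f_ k) (kappa w * y)%g) (f_ k (kappa w * y)%g).
rewrite (metric_sym (Pop _ (kappa w * y)%g)) in t3.
have eR : 0 <= e * Rk k by rewrite mulr_ge0 ?Rk_ge0// ltW.
by move: d1 d2 d3 d4 t1 t2 t3 eR; lra.
Qed.


Section escaping.
Hypothesis Rinf : forall B, \forall k \near U, B <= Rk k.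

(** After rescaling by [Rk k], the two points agree in the limit. *)
Definition proximal (g g' : G) : Prop := forall e, 0 < e ->
  \forall k \near U, mdist (f_ k g) (f_ k g') <= e * Rk k.

(** The distance to the base map is asymptotically the maximal one; this happens at a limit of the
    points [gk k]. *)
Definition far (g : G) : Prop := forall e, 0 < e ->
  \forall k \near U, Rk k - mdist (f_ k g) (f0 g) <= e * Rk k.

Lemma small_Rk M e : 0 < e -> \forall k \near U, M <= e * Rk k.
Proof.
move=> e0; apply: filterS (Rinf (M / e)) => k; rewrite ler_pdivrMr// mulrC; exact.
Qed.

Lemma proximal_sym g g' : proximal g g' -> proximal g' g.
Proof. by move=> H e e0; apply: filterS (H e e0) => k; rewrite metric_sym. Qed.

Lemma proximal_trans g g' g'' : proximal g g' -> proximal g' g'' -> proximal g g''.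
Proof.
move=> H H' e e0; have e2 : 0 < e / 2 by rewrite divr_gt0.
apply: filterS2 (H _ e2) (H' _ e2) => k h h'.
by apply: (le_trans (metric_triangle _ (f_ k g') _)); move: h h'; lra.
Qed.

Lemma far_proximal g g' : far g -> proximal g g' -> far g'.
Proof.
move=> H H' e e0; have e3 : 0 < e / 3 by rewrite divr_gt0.
apply: filterS3 (H _ e3) (H' _ e3) (small_Rk (mdist (f0 g) (f0 g')) e3) => k h1 h2 h3.
have t1 := metric_triangle (f_ k g) (f_ k g') (f0 g).
have t2 := metric_triangle (f_ k g') (f0 g') (f0 g).
rewrite (metric_sym (f0 g')) in t2.
by move: h1 h2 h3 t1 t2; lra.
Qed.

Lemma almost_equicontinuous' e : 0 < e -> exists2 P, nbhs (1%g : G) P &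
  \forall k \near U, forall w g, P w -> mdist (f_ k g) (f_ k (w * g)%g) <= e * Rk k.
Proof.
move=> e0; have e2 : 0 < e / 2 by rewrite divr_gt0.
have [P nP H] := almost_equicontinuous e2; exists P => //.
apply: filterS2 H (Rinf 1) => k H R1 w g Pw; apply: (le_trans (H w g Pw)).
have : e / 2 * 1 <= e / 2 * Rk k by rewrite ler_wpM2l// ltW.
by lra.
Qed.

Lemma far_ex : exists g, far g.
Proof.
have UUk := fmap_ultra gk UU.
have [g [Cg gkg]] : exists g, C g /\ gk @ U --> g.
  move: cC; rewrite compact_ultra => /(_ (gk @ U) UUk).
  have CU : \forall k \near U, C (gk k) by apply: nearW => k; case: (f_gk k).
  by move=> /(_ CU)[g [Cg gg]]; exists g.
exists g => e e0; have e2 : 0 < e / 2 by rewrite divr_gt0.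
have [P nP HP] := almost_equicontinuous' e2.
have hc : (fun k => gk k * g^-1)%g @ U --> (1%g : G).
  rewrite -[X in _ --> X](mulgV g).
  by apply: cvgM_group => //; exact: cvg_cst.
have n1 : \forall k \near U, P (gk k * g^-1)%g by exact: hc nP.
have n2 : \forall k \near U, forall y, mdist (f0 y) (f0 (gk k * g^-1 * y)%g) <= 1.
  exact: (hc _ (cls_unif cls_f0 ltr01)).
have n3 : \forall k \near U, 1 <= e / 2 * Rk k := small_Rk 1 e2.
have n12 : \forall k \near U, P (gk k * g^-1)%g /\
  forall y, mdist (f0 y) (f0 (gk k * g^-1 * y)%g) <= 1 by exact: filterI.
apply: filterS3 n12 HP n3 => k [p1 p2] p3 p4.
have [_ Re] := f_gk k.
have := p3 _ g p1; have := p2 g; rewrite mulgVK => q1 q2.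
have t1 := metric_triangle (f_ k (gk k)) (f_ k g) (f0 (gk k)).
have t2 := metric_triangle (f_ k g) (f0 g) (f0 (gk k)).
rewrite (metric_sym (f_ k (gk k)) (f_ k g)) in t1.
by move: Re p4 q1 q2 t1 t2; lra.
Qed.

(** The displacement by [em h] is bounded by that of [f0], independently of [k]. *)
Lemma proximal_em g h : proximal g (em h * g)%g.
Proof.
have [D _ fD] := cls_bounded (em_shift_cls h cls_f0) cls_f0.
move=> e e0; apply: filterS (small_Rk D e0) => k; apply: le_trans.
by apply: mod_f => g'; rewrite metric_sym.
Qed.

(** The base point [f0 g] is almost equidistant from [f_ k g] and, by the
    maximality of [Rk k], not closer to the averaged points; the variance
    inequality then forces the averaged points to be close to their barycentre. *)
Lemma proximal_step g s : far g -> pr s = 1%g -> proximal g (s * g)%g.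
Proof.
move=> Zg /step_onto[j [u0 [pu0 ->]]] e e0.
pose d := e / 4; have d0 : 0 < d by rewrite divr_gt0.
have [P nP HP] := almost_equicontinuous' d0.
have [c c0 Hc] := Lam_local_pos j pu0 (step_near u0 j nP).
have ab : adm K2 b (fun w => b w.2).
  split; first by move=> i x; exact: cvg_cst.
  exists 1 => u i _; rewrite mul1r ger0_norm//.
  have h1 : 0 <= b i * b i by rewrite mulr_ge0.
  by have h2 := b0 i; rewrite expr2; move: h1 h2; lra.
have ab2 : adm K2 b (fun w => b w.2 ^+ 2).
  split; first by move=> i x; exact: cvg_cst.
  exists 1 => u i _; rewrite mul1r ger0_norm ?sqr_ge0//.
  by rewrite lerXn2r ?nnegrE ?addr_ge0// lerDr.
pose M1 := L phi (fun w => b w.2); pose M2 := L phi (fun w => b w.2 ^+ 2).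
have M10 : 0 <= M1 by apply: (posfun_ge0 (adm_cst admQ) posL ab) => w _; exact: b0.
(* The aim is [c (a - 2 d Rk)^2 <= c d^2 Rk^2]: the deficit [d'] may use half of the right-hand
   side, the terms with [M1] and [M2] a quarter each. It yields [a <= 3 d Rk], where [d = e / 4]. *)
pose d' := Num.min 1 (c * d ^+ 2 / (4 * lam)).
have cd : 0 < c * d ^+ 2 by rewrite mulr_gt0// exprn_gt0.
have d'0 : 0 < d' by rewrite lt_min ltr01/= divr_gt0// mulr_gt0.
have d'1 : d' <= 1 by rewrite /d' ge_min lexx.
have d'2 : 4 * lam * d' <= c * d ^+ 2.
  by rewrite mulrC -ler_pdivlMr ?mulr_gt0// /d' ge_min lexx orbT.
have n1 := Zg _ (divr_gt0 d'0 (ltr0n _ 2)).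
have d'4 : 0 < Num.min d d' / 4 by rewrite divr_gt0// lt_min d0.
have n2 := almost_harmonic d'4.
have n3 := small_Rk (8 * M1) cd.
have n4 := small_Rk (4 * M2) cd.
have n12 : \forall k \near U, Rk k - mdist (f_ k g) (f0 g) <= d' / 2 * Rk k /\
    ((forall g, mdist (f_ k g) (Pop (f_ k) g) <= Num.min d d' / 4 * (1 + Rk k)) /\ 1 <= Rk k).
  exact: (filterI n1 (filterI n2 (Rinf 1))).
have n34 : \forall k \near U, 8 * M1 <= c * d ^+ 2 * Rk k /\ 4 * M2 <= c * d ^+ 2 * Rk k.
  by apply: filterI.
apply: filterS3 HP n12 n34 => k HP' [h1 [h2 h3]] [h4 h5].
set q := samples (f_ k) g; set x := Pop (f_ k) g.
have hx : mdist (f_ k g) x <= Num.min d d' / 2 * Rk k.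
  apply: (le_trans (h2 g)).
  have : Num.min d d' / 4 * 1 <= Num.min d d' / 4 * Rk k by rewrite ler_wpM2l// ltW.
  by lra.
have hxd : mdist (f_ k g) x <= d / 2 * Rk k.
  apply: (le_trans hx); apply: (ler_wpM2r (Rk_ge0 k)).
  by rewrite ler_pM2r ?invr_gt0// ge_min lexx.
have hxd' : mdist (f_ k g) x <= d' / 2 * Rk k.
  apply: (le_trans hx); apply: (ler_wpM2r (Rk_ge0 k)).
  by rewrite ler_pM2r ?invr_gt0// ge_min lexx orbT.
have far_x : (1 - d') * Rk k <= mdist (f0 g) x.
  have t1 := metric_triangle (f_ k g) x (f0 g).
  rewrite (metric_sym x) in t1.
  by move: h1 hxd' t1; lra.
have BP := Pop_barP g (f0 g) (cf_ k); rewrite -/x -/q in BP.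
(* The distance from [f0 g] to a sample of index [i] is at most [b i + Rk k]; expanding the square
   produces [M1] and [M2] with lower powers of [Rk k]. *)
have up : L phi (fun w => mdist (f0 g) (q w) ^+ 2) <= lam * Rk k ^+ 2 + 2 * Rk k * M1 + M2.
  have ac := adm_cst admQ (Rk k ^+ 2).
  have a1 := adm_lin admQ (2 * Rk k) ab ab2.
  have a2 : adm K2 b (fun w => Rk k ^+ 2 + (2 * Rk k * b w.2 + b w.2 ^+ 2)).
    have := adm_lin admQ 1 ac a1; congr (adm _ _ _).
    by apply/funext => w; rewrite mul1r.
  have -> : lam * Rk k ^+ 2 + 2 * Rk k * M1 + M2 =
      L phi (fun w => Rk k ^+ 2 + (2 * Rk k * b w.2 + b w.2 ^+ 2)).
    rewrite (posfunD posL ac a1) (posfun_cst (adm_cst admQ) posL) (posfun_lin posL)//.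
    by rewrite -/lam -/M1 -/M2; ring.
  apply: (posfun_mono posL) => // [|[u i] /= pu].
    exact: (Q_dl2 admQ _ (samples_adq g (cf_ k))).
  have Ku : K2 u by apply: contrapT => /(weight_supp wphi) p0; rewrite p0 ltxx in pu.
  have -> : Rk k ^+ 2 + (2 * Rk k * b i + b i ^+ 2) = (b i + Rk k) ^+ 2 by ring.
  rewrite lerXn2r ?nnegrE ?mdist_ge0 ?addr_ge0 ?Rk_ge0//.

  apply: (le_trans (metric_triangle _ (f0 (step u i * g)%g) _)).
  by rewrite lerD ?bP// metric_sym; exact: f_Rk.
have low : lam * ((1 - d') * Rk k) ^+ 2 <= lam * mdist (f0 g) x ^+ 2.
  rewrite ler_pM2l// lerXn2r ?nnegrE ?mdist_ge0//.
  by apply: mulr_ge0; [rewrite subr_ge0|exact: Rk_ge0].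
set a := mdist (f_ k g) (f_ k (step u0 j * g)%g).
have [big|] := leP (2 * d * Rk k) a; last first.
  by move=> /ltW; rewrite /d; have := mulr_ge0 (ltW e0) (Rk_ge0 k); lra.
have qfar u : P (step u j * (step u0 j)^-1)%g -> (a - 2 * d * Rk k) ^+ 2 <= mdist x (q (u, j)) ^+ 2.
  move=> Pu; have := HP' _ (step u0 j * g)%g Pu; rewrite mulgA mulgVK => h.
  rewrite lerXn2r ?nnegrE ?subr_ge0 ?mdist_ge0//.
  have t1 := metric_triangle (f_ k g) x (f_ k (step u0 j * g)%g).
  have t2 := metric_triangle x (q (u, j)) (f_ k (step u0 j * g)%g).
  rewrite (metric_sym (q (u, j))) in t2.
  rewrite -/a in t1; rewrite {2}/q /samples /= in t2.
  by move: h t1 t2 hxd big; rewrite /q /samples /=; have := mulr_ge0 (ltW d0) (Rk_ge0 k); lra.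
have := Hc (fun w => mdist x (q w) ^+ 2) ((a - 2 * d * Rk k) ^+ 2).
move=> /(_ (Q_dl2 admQ _ (samples_adq g (cf_ k))) (fun w => sqr_ge0 _) qfar) fin.
have E : (a - 2 * d * Rk k) ^+ 2 <= (d * Rk k) ^+ 2.
  rewrite -(ler_pM2l c0).
  have r1 : c * d ^+ 2 * (Rk k) * Rk k >= 8 * M1 * Rk k by exact: (ler_wpM2r (Rk_ge0 k)).
  have r2 : c * d ^+ 2 * (Rk k) * Rk k >= 4 * M2.
    by apply: (le_trans h5); rewrite ler_peMr// mulr_ge0 ?Rk_ge0// ltW.
  have r3 : 4 * lam * d' * Rk k ^+ 2 <= c * d ^+ 2 * Rk k ^+ 2 by rewrite ler_wpM2r ?sqr_ge0.
  have r4 : 0 <= lam * d' ^+ 2 * Rk k ^+ 2.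
    exact: (mulr_ge0 (mulr_ge0 (ltW lam_gt0) (sqr_ge0 _)) (sqr_ge0 _)).
  have := le_trans (lerD fin low) (le_trans BP up).
  have -> : c * (d * Rk k) ^+ 2 = c * d ^+ 2 * Rk k ^+ 2 by ring.
  by move: r1 r2 r3 r4; rewrite !expr2; lra.
have : a - 2 * d * Rk k <= d * Rk k.
  by rewrite -(ler_sqr _ _) ?nnegrE// ?subr_ge0// mulr_ge0 ?Rk_ge0// ltW.
by rewrite /d => h; have := Rk_ge0 k; have := mulr_ge0 (ltW e0) (Rk_ge0 k); move: h; lra.
Qed.

(** Any point is reached from a far point by a translation along [em] followed by one in the kernel,
    and the first keeps the point far. *)
Lemma proximal_all g g' : proximal g g'.
Proof.
have [y Zy] := far_ex.
have H g1 : proximal y g1.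
  pose w := (g1 * y^-1)%g.
  have yw := proximal_em y (pr w).
  have -> : g1 = (kappa w * (em (pr w) * y))%g by rewrite mulgA -kappa_decomp /w mulgVK.
  apply: (proximal_trans yw); apply: proximal_step (pr_kappa w).
  exact: far_proximal Zy yw.
exact: proximal_trans (proximal_sym (H g)) (H g').
Qed.

(** The points [f_ k 1] escape at a rate comparable to [Rk k], while [tau a] sends them to the
    proximal points [f_ k (a^-1)]: the displacement is sublinear. *)
Lemma not_escaping : False.
Proof.
have [y Zy] := far_ex.
have Z1 : \forall k \near U, Rk k / 2 <= mdist (f0 1%g) (f_ k 1%g).
  have h2 : 0 < (2^-1 : R) by rewrite invr_gt0.
  apply: filterS (far_proximal Zy (proximal_all y 1%g) h2) => k.
  by rewrite (metric_sym (f0 _)); lra.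
have [|g e [a Ga <-] e0|xi] := @fixed_at_infinity _ _ properX CAT0X _ U UU (f0 1%g) (fun k => f_ k 1%g) (tau @` Gamma).
- move=> B; apply: filterS2 Z1 (Rinf (2 * B)) => k; lra.
- have e2 : 0 < e / 2 by rewrite divr_gt0.
  apply: filterS2 Z1 (proximal_all (a^-1)%g 1%g e2) => k h1 h2.
  have : tau a (f_ k 1%g) = f_ k (a^-1)%g.
    rewrite -(isom_invKV (tau a) (f_ k a^-1%g)); congr (tau a _).
    by rewrite -(cls_equi (cf_ k) (a^-1)%g Ga) mulVg.
  move=> ->; apply: (le_trans h2).
  by have : e * (Rk k / 2) <= e * mdist (f0 1%g) (f_ k 1%g); [rewrite ler_wpM2l// ltW|lra].
- exact: no_fixed_at_infinity.
Qed.

End escaping.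

Section bounded_limit.
Context (B : R).
Hypothesis RB : \forall k \near U, Rk k <= B.

(** Equicontinuity makes the ultralimit uniform on the compact set [C], hence on [G] by
    equivariance; [Pop] is nonexpanding for the uniform distance, so the limit is fixed. *)
Lemma bounded_limit : exists2 f, cls f & forall g, Pop f g = f g.
Proof.
have B0 : 0 <= B by have [k] := filter_ex RB; apply: le_trans; exact: Rk_ge0.
have lim g : exists a : X, (fun k => f_ k g) @ U --> a.
  apply: (@ulim_ex _ _ _ properX U UU _ (f0 g) B); apply: filterS RB => k; apply: le_trans.
  by rewrite metric_sym; exact: f_Rk.
pose f g := projT1 (cid (lim g)).
have fl g : (fun k => f_ k g) @ U --> f g by rewrite /f; case: cid.
have equi e : 0 < e -> exists2 P, nbhs (1%g : G) P &
    \forall k \near U, forall w g, P w -> mdist (f_ k g) (f_ k (w * g)%g) <= e.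
  move=> e0; have e1 : 0 < e / (1 + B) by rewrite divr_gt0// ltr_pwDl.
  have [P nP HP] := almost_equicontinuous e1; exists P => //.
  apply: filterS2 HP RB => k HP hB w g Pw; apply: (le_trans (HP w g Pw)).
  rewrite mulrAC ler_pdivrMr ?ltr_pwDl// ler_wpM2l ?(ltW e0)//.
  by rewrite lerD2l.
have cf : cls f.
  split.
  - apply: continuous_from_left => g e e0; have [P nP HP] := equi e e0.
    apply: filterS nP => w Pw /=.
    have H : \forall k \near U, mdist (f_ k g) (f_ k (w * g)%g) <= e.
      by apply: filterS HP => k; apply.
    have Q := cvg_mdist_le (fl g) (fl (w * g)%g) H.
    exact: Q.
  - move=> g c Gc; apply: (cvg_unique_mdist (fl (g * c)%g)).
    apply/cvg_mdistP => e e0; have /cvg_mdistP/(_ _ e0) := fl g; apply: filterS => k.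
    by rewrite (cls_equi (cf_ k) g Gc) isom_mdist.
  - move=> n g Nn; apply: (cvg_unique_mdist (fl (n * g)%g)).
    apply/cvg_mdistP => e e0; have /cvg_mdistP/(_ _ e0) := fl g; apply: filterS => k.
    by rewrite (cls_inv (cf_ k) g Nn).
exists f => // g.
have unif e : 0 < e -> \forall k \near U, forall g, mdist (f_ k g) (f g) <= e.
  move=> e0; have e3 : 0 < e / 3 by rewrite divr_gt0.
  have [P nP HP] := equi _ e3.
  have : \forall k \near U, C `<=` [set g | mdist (f_ k g) (f g) <= e].
    move/compact_near_coveringP: cC; apply => g1 Cg1.
    have n1 : \forall g' \near g1, P (g' * g1^-1)%g /\ mdist (f g1) (f g') < e / 3.
      have hc : (fun g' => g' * g1^-1)%g @ g1 --> (1%g : G).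
        by have := @mulg_continuousr G (g1^-1)%g g1; rewrite /continuous_at mulgV.
      apply: filterI; first exact: hc nP.
      by have /cvg_mdistP/(_ _ e3) := cls_cont cf (x := g1).
    have /cvg_mdistP/(_ _ e3) n2 := fl g1.
    have n3 := filterI HP n2.
    exists ([set g' | P (g' * g1^-1)%g /\ mdist (f g1) (f g') < e / 3],
      [set k | (forall w g, P w -> mdist (f_ k g) (f_ k (w * g)%g) <= e / 3) /\ mdist (f g1) (f_ k g1) < e / 3]) => /=.
      by split; [exact: n1|exact: n3].
    move=> [g' k] /= [[p1 p2] [p3 p4]].
    have := p3 _ g1 p1; rewrite mulgVK => p5.
    have t1 := metric_triangle (f_ k g') (f_ k g1) (f g').
    have t2 := metric_triangle (f_ k g1) (f g1) (f g').
    rewrite (metric_sym (f_ k g') (f_ k g1)) in t1; rewrite (metric_sym (f_ k g1) (f g1)) in t2.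
    by move: p2 p4 p5 t1 t2; lra.
  apply: filterS => k H g1; have [c Gc Cgc] := CG g1; have := H _ Cgc.
  by have := cls_dist_inv 1%g 1%g g1 (cf_ k) cf Gc; rewrite /= !mul1g => ->.
apply: mdist_positivity; apply/eqP; rewrite eq_le mdist_ge0 andbT.
apply/ler_addgt0Pr => e e0; rewrite add0r.
have e3 : 0 < e / 3 by rewrite divr_gt0.
have e3B : 0 < e / 3 / (1 + B) by rewrite divr_gt0// ltr_pwDl.
have nn : \forall k \near U, (forall g, mdist (f_ k g) (f g) <= e / 3) /\
    ((forall g, mdist (f_ k g) (Pop (f_ k) g) <= e / 3 / (1 + B) * (1 + Rk k)) /\ Rk k <= B).
  exact: (filterI (unif _ e3) (filterI (almost_harmonic e3B) RB)).
have [k [h1 [h2 h3]]] := filter_ex nn.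
have p1 : mdist (Pop f g) (Pop (f_ k) g) <= e / 3.
  by apply: (Pop_le cf (cf_ k)) => s _; rewrite metric_sym.
have p2 : mdist (f_ k g) (Pop (f_ k) g) <= e / 3.
  apply: (le_trans (h2 g)); rewrite mulrAC ler_pdivrMr ?ltr_pwDl// ler_wpM2l ?(ltW e3)//.
  by rewrite lerD2l.
have t1 := metric_triangle (Pop f g) (Pop (f_ k) g) (f g).
have t2 := metric_triangle (Pop (f_ k) g) (f_ k g) (f g).
rewrite (metric_sym (Pop (f_ k) g) (f_ k g)) in t2.
by have := h1 g; move: p1 p2 t1 t2; lra.
Qed.

End bounded_limit.

End harmonic_limit.

Theorem harmonic_ex : exists2 f, cls f & forall g, Pop f g = f g.
Proof.
have [C cC CG] := cocompact_ex hG lcG Gamma1 GammaM GammaV cocompactGamma R.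
have [U [UU U_oo]] := ultra_oo.
have e01 k : 0 < (k.+1%:R^-1 : R) /\ (k.+1%:R^-1 : R) <= 1.
  by split; [rewrite invr_gt0|rewrite invf_le1// ler1n].
have [f_ fP] := choice (fun k => approx_fixed (e01 k).1 (e01 k).2).
have cf_ k : cls (f_ k) by have [] := fP k.
have gk_ex k : exists g1, C g1 /\ forall g, mdist (f_ k g) (f0 g) <= mdist (f_ k g1) (f0 g1).
  have [g1 g1P] := cls_max (cf_ k) cls_f0; have [c Gc Cgc] := CG g1.
  exists (g1 * c)%g; split=> // g; apply: (le_trans (g1P g)).
  by have := cls_dist_inv 1%g 1%g g1 (cf_ k) cls_f0 Gc; rewrite !mul1g => ->.
have [gk gkP] := choice gk_ex.
pose Rk k := mdist (f_ k (gk k)) (f0 (gk k)).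
have f_Rk k g : mdist (f_ k g) (f0 g) <= Rk k by have [_] := gkP k; exact.
have f_gk k : C (gk k) /\ Rk k = mdist (f_ k (gk k)) (f0 (gk k)).
  by have [] := gkP k.
have A0 : 0 <= 1 + 2 * Cd by rewrite addr_ge0// mulr_ge0// Cd_ge0.
have mod_f k h D : (forall g, mdist (f0 g) (f0 (em h * g)%g) <= D) ->
    forall g, mdist (f_ k g) (f_ k (em h * g)%g) <= D by have [_ + _] := fP k; exact.
have f_Pop k g : mdist (f_ k g) (Pop (f_ k) g) <= k.+1%:R^-1 * ((1 + 2 * Cd) * (1 + Rk k)).
  by have [_ _] := fP k; apply; exact: f_Rk.
have [[B RB]|nB] := pselect (exists B, \forall k \near U, Rk k <= B).
  exact: (bounded_limit UU U_oo cC CG A0 cf_ mod_f f_Rk f_gk f_Pop RB).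
exfalso; apply: (not_escaping UU U_oo cC A0 cf_ mod_f f_Rk f_gk f_Pop) => B.
have [//|H] := in_ultra_setVsetC [set k | B <= Rk k] UU.
exfalso; apply: nB; exists B; apply: filterS H => k /= /negP.
by rewrite -ltNge => /ltW.
Qed.

(** * Harmonic maps and their mutual distances *)

Definition harmonic (f : G -> X) : Prop := cls f /\ forall g, Pop f g = f g.

Context (hK : hausdorff_space K) (lcK : locally_compact [set: K]).
Hypothesis dense_pr : dense [set pr a | a in Gamma].
Hypothesis tauM : forall a a', Gamma a -> Gamma a' -> tau (a * a')%g = (tau a * tau a')%g.

Lemma harmonic_dist_step f f' g s : harmonic f -> harmonic f' ->
  (forall y, mdist (f y) (f' y) <= mdist (f g) (f' g)) -> pr s = 1%g ->
  mdist (f (s * g)%g) (f' (s * g)%g) = mdist (f g) (f' g).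
Proof.
move=> [cf Pf] [cf' Pf'] H s1.
by apply: (Pop_max (g := g) cf cf' H _ s1); rewrite Pf Pf'.
Qed.

(** The set where the distance of two harmonic maps is maximal is closed, and
    invariant under [Gamma] on the right and the kernel of [pr] on the left. *)
Lemma harmonic_dist f f' g : harmonic f -> harmonic f' ->
  mdist (f g) (f' g) = mdist (f 1%g) (f' 1%g).
Proof.
move=> hf hf'; have [cf Pf] := hf; have [cf' Pf'] := hf'.
have [g0 g0P] := cls_max cf cf'; pose D := mdist (f g0) (f' g0).
suff H y : mdist (f y) (f' y) = D by rewrite !H.
apply: contrapT => nD.
(* The point inside has projection [pr g0 * z]. It is [y] for one value of [z], whereas for
   [z = pr c] with [c] in [Gamma] the distance there is [D]; density then contradicts [nD]. *)
have cd : continuous (fun z => mdist (f (em (pr g0 * z * (pr y)^-1) * y)%g) (f' (em (pr g0 * z * (pr y)^-1) * y)%g)).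
  have ce : continuous (fun z => em (pr g0 * z * (pr y)^-1) * y)%g.
    move=> z; apply: cvgM_group; last exact: cvg_cst.
    apply: (@cvg_comp _ _ _ (fun z => pr g0 * z * (pr y)^-1)%g em); last exact: em_cont.
    by apply: cvgM_group; [apply: cvgM_group; [exact: cvg_cst|exact: cvg_id]|exact: cvg_cst].
  apply: continuous_mdist => z; apply: (@cvg_comp _ _ _ _ _ _ _ _ (ce z)); exact: cls_cont.
pose O := (fun z => mdist (f (em (pr g0 * z * (pr y)^-1) * y)%g) (f' (em (pr g0 * z * (pr y)^-1) * y)%g)) @^-1` [set x | x != D].
have oO : open O.
  move/continuousP: cd; apply; rewrite (_ : [set x | x != D] = ~` [set D]).
    by apply: closed_openC; exact: closed_eq.
  by apply/seteqP; split=> x /eqP.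
have Oy : O ((pr g0)^-1 * pr y)%g.
  by rewrite /O /= mulVKg mulgV (hom1 emM) mul1g; apply/eqP.
have [z [Oz [c Gc cz]]] := dense_pr (ex_intro _ _ Oy) oO.
move: Oz; rewrite /O /= -cz => /eqP; apply.
set x := (em _ * y)%g.
have sx : pr (x * c^-1 * g0^-1)%g = 1%g.
  by rewrite /x !prM !(homV _ prM) prK mulgVK mulgK mulgV.
have := harmonic_dist_step hf hf' g0P sx; rewrite mulgVK => E.
have := cls_dist_inv 1%g 1%g (x * c^-1)%g cf cf' Gc.
by rewrite !mul1g mulgVK => ->.
Qed.

Lemma harmonic_eq f f' : harmonic f -> harmonic f' -> f 1%g = f' 1%g -> f = f'.
Proof.
move=> hf hf' E; apply/funext => g; apply: mdist_positivity.
by rewrite (harmonic_dist g hf hf') E mdistxx.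
Qed.

(** The samples of [f] and [f'] and their barycentres all have the same mutual distance, so
    [bar_parallel] applies. This provides one bound on the displacement for all harmonic maps. *)
Lemma harmonic_displacement f f' g s : harmonic f -> harmonic f' -> pr s = 1%g ->
  mdist (f g) (f (s * g)%g) = mdist (f' g) (f' (s * g)%g).
Proof.
move=> hf hf' /step_onto[j [u [pu ->]]]; have [cf Pf] := hf; have [cf' Pf'] := hf'.
have qD w : mdist (samples f g w) (samples f' g w) = mdist (f 1%g) (f' 1%g).
  exact: harmonic_dist.
have bD : mdist (bar (f0 1%g) (L phi) (samples f g)) (bar (f0 1%g) (L phi) (samples f' g)) = mdist (f 1%g) (f' 1%g).
  by rewrite -/(Pop f g) -/(Pop f' g) Pf Pf'; exact: harmonic_dist.
have [F [aF F0 LF FE]] := bar_parallel properX CAT0X admQ posL (samples_adq g cf) (samples_adq g cf') qD bD.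
have := FE (u, j); rewrite -/(Pop f g) -/(Pop f' g) Pf Pf'; apply.
exact: (@Lam_eq0 _ _ _ I_lin I_mono I_gt0 K2 b b0 phi F u j wphi aF (fun w _ => F0 w) LF pu).
Qed.

(** As the distance of [f] and [f'] is constant, nonexpansion puts the average of the interpolated
    map at the right distances from both, and [gpt_unique] identifies it. *)
Lemma harmonic_gpt f f' s : harmonic f -> harmonic f' -> 0 <= s <= 1 ->
  harmonic (fun g => gpt (f g) (f' g) s).
Proof.
move=> hf hf' s01; have [cf Pf] := hf; have [cf' Pf'] := hf'.
have ch := gpt_cls cf cf' s01; split=> // g.
apply: (gpt_unique CAT0X s01).
- rewrite -{1}Pf; apply: (Pop_le cf ch) => s' _.
  by rewrite (gptP CAT0X _ _ s01).1 !(harmonic_dist _ hf hf').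
- rewrite -{1}Pf'; apply: (Pop_le ch cf') => s' _.
  by rewrite (gptP CAT0X _ _ s01).2 !(harmonic_dist _ hf hf').
Qed.

Lemma harmonic_em f h : harmonic f -> harmonic (fun g => f (em h * g)%g).
Proof.
move=> [cf Pf]; split; first exact: em_shift_cls.
move=> g; rewrite -Pf /Pop; congr (bar _ _ _); apply/funext => w.
rewrite /samples; have := em_comm h (pr_step w.1 w.2); move: (step _ _) => s E.
by rewrite !mulgA E.
Qed.

Lemma harmonic_uniform_limit f :
  (forall e, 0 < e -> exists2 f', harmonic f' & forall g, mdist (f g) (f' g) <= e) ->
  harmonic f.
Proof.
move=> H.
have cf : cls f.
  split.
  - apply: continuous_from_left => g e e0; have e3 : 0 < e / 3 by rewrite divr_gt0.
    have [f' [cf' _] ff'] := H _ e3.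
    apply: filterS (cls_unif cf' e3) => w /(_ g) h1.
    have h2 := ff' g; have h3 := ff' (w * g)%g.
    have t1 := metric_triangle (f g) (f' g) (f (w * g)%g).
    have t2 := metric_triangle (f' g) (f' (w * g)%g) (f (w * g)%g).
    rewrite (metric_sym (f' (w * g)%g)) in t2.
    by move: h1 h2 h3 t1 t2; lra.
  - move=> g c Gc; apply: mdist_positivity; apply/eqP; rewrite eq_le mdist_ge0 andbT.
    apply/ler_addgt0Pr => e e0; rewrite add0r; have e2 : 0 < e / 2 by rewrite divr_gt0.
    have [f' [cf' _] ff'] := H _ e2.
    apply: (le_trans (metric_triangle _ (f' (g * c)%g) _)).
    rewrite [leRHS]splitr lerD//.
    by rewrite (cls_equi cf' _ Gc) isom_mdist metric_sym.
  - move=> n g Nn; apply: mdist_positivity; apply/eqP; rewrite eq_le mdist_ge0 andbT.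
    apply/ler_addgt0Pr => e e0; rewrite add0r; have e2 : 0 < e / 2 by rewrite divr_gt0.
    have [f' [cf' _] ff'] := H _ e2.
    apply: (le_trans (metric_triangle _ (f' (n * g)%g) _)).
    rewrite [leRHS]splitr lerD//.
    by rewrite (cls_inv cf' _ Nn) metric_sym.
split=> // g; apply: mdist_positivity; apply/eqP; rewrite eq_le mdist_ge0 andbT.
apply/ler_addgt0Pr => e e0; rewrite add0r; have e2 : 0 < e / 2 by rewrite divr_gt0.
have [f' [cf' Pf'] ff'] := H _ e2.
apply: (le_trans (metric_triangle _ (f' g) _)); rewrite [leRHS]splitr lerD//.
  by rewrite -Pf'; apply: Pop_le => // s _; exact: ff'.
by rewrite metric_sym.
Qed.

Let XM := [set f 1%g | f in harmonic].

(** Mutual distances are constant, so harmonic maps whose values at 1 converge do so uniformly. *)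
Lemma closed_harmonic_values : closed XM.
Proof.
move=> x clx.
have xk_ex k : exists f, harmonic f /\ mdist x (f 1%g) <= k.+1%:R^-1.
  have k0 : 0 < (k.+1%:R^-1 : R) by rewrite invr_gt0.
  have [_ [[f hf <-] /= xf]] := clx _ (near_mdist x k0).
  by exists f; split=> //; exact: ltW.
have [f_ fP] := choice xk_ex.
have hf k : harmonic (f_ k) by have [] := fP k.
have [U [UU U_oo]] := ultra_oo.
have near_x e : 0 < e -> \forall k \near U, mdist x (f_ k 1%g) <= e.
  move=> e0; have /U_oo := inv_succ_small e0; apply: filterS => k; apply: le_trans.
  by have [] := fP k.
have dk f' : harmonic f' -> forall e, 0 < e ->
    \forall k \near U, forall g, mdist (f_ k g) (f' g) <= mdist x (f' 1%g) + e.
  move=> hf' e e0; apply: filterS (near_x e e0) => k h g.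
  rewrite (harmonic_dist g (hf k) hf').
  have := metric_triangle (f_ k 1%g) x (f' 1%g); rewrite (metric_sym _ x); move: h; lra.
have lim g : exists a : X, (fun k => f_ k g) @ U --> a.
  apply: (@ulim_ex _ _ _ properX U UU _ (f_ 0%N g) (mdist x (f_ 0%N 1%g) + 1)).
  by apply: filterS (dk _ (hf 0%N) 1 ltr01) => k /(_ g); rewrite metric_sym.
pose f g := projT1 (cid (lim g)).
have fl g : (fun k => f_ k g) @ U --> f g by rewrite /f; case: cid.
have fd f' : harmonic f' -> forall g, mdist (f g) (f' g) <= mdist x (f' 1%g).
  move=> hf' g; apply/ler_addgt0Pr => e e0.
  have h : \forall k \near U, mdist (f_ k g) (f' g) <= mdist x (f' 1%g) + e.
    by apply: filterS (dk _ hf' e e0) => k; exact.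
  exact: cvg_mdist_lec (fl g) h.
exists f.
  apply: harmonic_uniform_limit => e e0; have [k h] := filter_ex (near_x e e0).
  by exists (f_ k) => // g; exact: le_trans (fd _ (hf k) g) h.
apply: (cvg_unique_mdist (fl 1%g)); apply/cvg_mdistP => e e0.
have e2 : 0 < e / 2 by rewrite divr_gt0.
apply: filterS (near_x _ e2) => k /le_lt_trans; apply.
by rewrite ltr_pdivrMr// mulr_natr mulr2n ltrDl.
Qed.

Theorem extension_or_invariant :
  (exists r : K -> isom_group X, [/\ forall h, closure (tau @` Gamma) (r h),
     forall h h', r (h * h')%g = (r h * r h')%g, continuous r &
     forall a, Gamma a -> r (pr a) = tau a]) \/
  exists2 f, cls f & forall h g, f (em h * g)%g = f g.
Proof.
have cvM : gconvex XM.
  move=> _ _ s [f hf <-] [f' hf' <-] s01.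
  by exists (fun g => gpt (f g) (f' g) s) => //; exact: harmonic_gpt.
have [f1 cf1 Pf1] := harmonic_ex; have hf1 : harmonic f1 by split.
pose mx (x : X) : G -> X := xget f1 [set f | harmonic f /\ f 1%g = x].
have mxP x : XM x -> harmonic (mx x) /\ mx x 1%g = x.
  by move=> [f hf fx]; rewrite /mx; case: xgetP => [y _ [] //|/(_ f) []].
(* The value at 1 of a translate of the harmonic map [mx x]; the inverse makes it a left action. *)
pose act (h : K) (x : X) := mx x (em h^-1)%g.
have mx_eq f : harmonic f -> mx (f 1%g) = f.
  move=> hf; have [h1 h2] := mxP (f 1%g) (ex_intro2 _ _ f hf erefl).
  exact: harmonic_eq.
have mx_act h x : XM x -> mx (act h x) = (fun g => mx x (em h^-1 * g)%g).
  move=> Ax; have [h1 h2] := mxP x Ax.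
  have := mx_eq _ (harmonic_em (h^-1)%g h1); rewrite mulg1; exact.
have actA h x : XM x -> XM (act h x).
  move=> Ax; have [h1 h2] := mxP x Ax.
  by exists (fun g => mx x (em h^-1 * g)%g); [exact: harmonic_em|rewrite mulg1].
have act_isom h x y : XM x -> XM y -> mdist (act h x) (act h y) = mdist x y.
  move=> /mxP[hx xE] /mxP[hy yE].
  by rewrite /act (harmonic_dist _ hx hy) xE yE.
have actM h h' x : XM x -> act (h * h')%g x = act h (act h' x).
  by move=> Ax; rewrite {2}/act mx_act// /act invgM emM.
have act1 x : XM x -> act 1%g x = x.
  by move=> /mxP[_ xE]; rewrite /act invg1 (hom1 emM).
have [[B XB]|unb] := pselect (metric_bounded XM).
  right.
  have actVK h x : XM x -> act h (act (h^-1)%g x) = x.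
    by move=> Ax; rewrite -actM// mulgV act1.
  have [c Ac cfix] := circumcenter_fixed properX CAT0X (ex_intro _ _ (ex_intro2 _ _ f1 hf1 erefl))
    closed_harmonic_values cvM XB actA (fun h => actA (h^-1)%g) act_isom actVK.
  have [hc cE] := mxP c Ac; exists (mx c); first by case: hc.
  move=> h g; have := cfix (h^-1)%g; rewrite /act invgK => E.
  have := @harmonic_eq _ _ (harmonic_em h hc) hc; rewrite mulg1 E cE => /(_ erefl) H.
  by rewrite -[in RHS]H.
left; apply: (extension_from_convex properX CAT0X hK lcK Gamma1 GammaM GammaV dense_pr tauM
  tau_indec closed_harmonic_values cvM unb actA act_isom actM act1).
  move=> x Ax h; have [[ch _] _] := mxP x Ax.
  apply: (@cvg_comp _ _ _ (fun h => em h^-1)%g (mx x)); last exact: cls_cont.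
  by apply: (@cvg_comp _ _ _ (fun h => h^-1)%g em); [apply: cvgV_group; exact: cvg_id|exact: em_cont].
(* [tau a x] and [act (pr a) x] are the values of [mx x] at [a^-1 = kappa (a^-1) * y] and at [y].
   Their distance is thus a displacement by an element of the kernel, equal to that of [f1]. *)
move=> a Ga; pose y := (em (pr a)^-1)%g.
exists (mdist (f1 y) (f1 (kappa (a^-1) * y)%g)) => x Ax.
have [hx xE] := mxP x Ax.
have -> : tau a x = mx x (kappa (a^-1) * y)%g.
  rewrite /y -(homV _ prM) -kappa_decomp -{1}xE -(isom_invKV (tau a) (mx x a^-1%g)); congr (tau a _).
  by rewrite -(cls_equi (proj1 hx) (a^-1)%g Ga) mulVg.
rewrite metric_sym /act -/y (harmonic_displacement y hx hf1)//.
exact: pr_kappa.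
Qed.

End operator.

(** * Weights and base maps *)

Section weights.
Context {R : realType} {G : topGroupType}.
Context (hG : hausdorff_space G) (lcG : locally_compact [set: G]).

Lemma Cc_ge1 (A : set G) : compact A -> exists chi : G -> R,
  [/\ Cc chi, forall x, 0 <= chi x & forall x, A x -> 1 <= chi x].
Proof.
move=> cA; have [W [nW cW clW]] := lc_compact_nbhs (1%g : G) lcG.
have [f [cf f01 f1 fW]] := bump R hG lcG nW.
pose O (x : G) := [set z : G | 2^-1 < f (x^-1 * z)%g].
have oO x : open (O x).
  apply: (open_mulgl (x^-1)%g (O := [set z | 2^-1 < f z])).
  by apply: (open_comp (f := f) (D := [set r : R | 2^-1 < r])) => [z _|]; [exact: cf|exact: open_gt].
have covO y : A y -> exists x, O x y.
  by move=> _; exists y; rewrite /O /= mulVg f1 invf_lt1// ltr1n.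
have [D DO] := compact_subcover cA oO covO.
have t0 x z : 0 <= 2 * f (x^-1 * z)%g by rewrite mulr_ge0//; case/andP: (f01 (x^-1 * z)%g).
exists (fun z => \sum_(x <- D) 2 * f (x^-1 * z)%g); split.
- split.
    apply: continuous_sum => x z; apply: cvgM; first exact: cvg_cst.
    exact: (@cvg_comp _ _ _ (fun z => (x^-1 * z)%g) f _ _ _ (@mulg_continuousl _ _ z) (@cf _)).
  exists [set (a * b)%g | a in [set` D] & b in W].
    by apply: compact_mul => //; apply: finite_compact; exact: finite_seq.
  move=> z nz; rewrite big_seq big1// => x xD; rewrite fW ?mulr0// => Wz; apply: nz.
  by exists x => //; exists (x^-1 * z)%g => //; rewrite mulgA mulgV mul1g.
- by move=> z; apply: sumr_ge0.
- move=> z /DO[x Dx xz]; rewrite (big_rem x) //= -[leLHS]addr0 lerD ?sumr_ge0//.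
  by move: xz; rewrite /O /=; lra.
Qed.

Context (I : (G -> R) -> R).
Hypothesis I_lin : forall a F F', Cc F -> Cc F' ->
  I (fun x => a * F x + F' x) = a * I F + I F'.
Hypothesis I_mono : forall F F', Cc F -> Cc F' -> (forall x, F x <= F' x) -> I F <= I F'.

(** [K2 = W^-1 W] contains the supports of all translates of the bump by elements of [W], so one
    compact set serves all nearby weights. *)
Lemma smoothing_weight_ex : exists phi K2, [/\ compact K2, weight K2 phi, 0 < phi 1%g &
  forall e, 0 < e -> \forall w \near (1%g : G),
    weight K2 (fun u => phi (w * u)%g) /\
    exists2 eta, weight K2 eta & (forall u, `|phi u - phi (w * u)%g| <= eta u) /\ I eta <= e].
Proof.
have [W [nW cW clW]] := lc_compact_nbhs (1%g : G) lcG.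
have [f [cf f01 f1 fW]] := bump R hG lcG nW.
pose K2 := [set (a * b)%g | a in [set (w^-1)%g | w in W] & b in W].
have cK2 : compact K2 by apply: compact_mul => //; exact: compact_inv.
have W1 : W 1%g := nbhs_singleton nW.
have f0 u : 0 <= f u by case/andP: (f01 u).
have KW w u : W w -> ~ K2 u -> f (w * u)%g = 0.
  move=> Ww nK; apply: fW => Wu; apply: nK; exists (w^-1)%g; first by exists w.
  by exists (w * u)%g => //; rewrite mulKg.
have Cf : Cc f by split=> //; exists W.
have wf w : W w -> weight K2 (fun u => f (w * u)%g).
  by move=> Ww; split=> //; [exact: Cc_shift|move=> u; exact: KW].
have wf1 : weight K2 f by have := wf _ W1; under eq_fun do rewrite mul1g.
exists f, K2; split=> //; first by rewrite f1.
move=> e e0; have [chi [Cchi chi0 chi1]] := Cc_ge1 cK2.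
have I0 : 0 <= I chi.
  by rewrite -(integral_zero I_lin); apply: I_mono => //; exact: Cc0.
have I1 : 0 < I chi + 1 by rewrite ltr_wpDl.
(* [eta] will be at most [d * chi], because [chi >= 1] on [K2]. *)
pose d := e / (I chi + 1); have d0 : 0 < d by rewrite divr_gt0.
have unif : \forall w \near (1%g : G), K2 `<=` [set u | `|f u - f (w * u)%g| <= d].
  move/compact_near_coveringP: cK2; apply => u Ku.
  have d2 : 0 < d / 2 by rewrite divr_gt0.
  have n1 : nbhs u [set u' | `|f u - f u'| < d / 2].
    by have /cvgrPdist_lt/(_ _ d2) := cf u.
  have n2 : nbhs (u, (1%g : G)) [set z | `|f u - f (z.2 * z.1)%g| < d / 2].
    have hm : (fun z : G * G => (z.2 * z.1)%g) @ (u, (1%g : G)) --> (1 * u)%g.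
      by apply: cvgM_group; [exact: cvg_snd|exact: cvg_fst].
    rewrite mul1g in hm.
    have hc := @cvg_comp _ _ _ _ f _ _ _ hm (cf u).
    by move/cvgrPdist_lt: hc; exact.
  case: n2 => -[P Q] /= [nP nQ] PQ.
  exists ([set u' | `|f u - f u'| < d / 2] `&` P, Q) => /=.
    by split=> //; exact: filterI.
  move=> [u' w] /= [[h1 Pu'] Qw]; have h2 := PQ (u', w) (conj Pu' Qw); rewrite /= in h2.
  move: h1 h2; rewrite !ltr_norml ler_norml => /andP[? ?] /andP[? ?].
  by apply/andP; split; lra.
apply: filterS2 nW unif => w Ww H; split; first exact: wf.
have Ceta : Cc (fun u => `|f u - f (w * u)%g|).
  split.
    move=> u; apply: (@cvg_norm _ R^o); apply: cvgB; first exact: cf.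
    exact: (@cvg_comp _ _ _ (fun z => (w * z)%g) f _ _ _ (@mulg_continuousl _ _ u) (@cf _)).
  by exists K2 => // u nK; rewrite (KW w)// (weight_supp wf1)// subrr normr0.
exists (fun u => `|f u - f (w * u)%g|).
  by split=> // u nK; rewrite (KW w)// (weight_supp wf1)// subrr normr0.
split=> //; apply: (@le_trans _ _ (d * I chi)).
  rewrite -(IZ I_lin)//; apply: I_mono => //.
    rewrite (_ : (fun x => d * chi x) = (fun x => chi x * d)); last first.
      by apply/funext => x; rewrite mulrC.
    by apply: Cc_mul => // x; exact: cvg_cst.
  move=> u; have [Ku|nK] := pselect (K2 u).
    by apply: (le_trans (H u Ku)); rewrite ler_peMr ?(ltW d0)// chi1.
  by rewrite (KW w)// (weight_supp wf1)// subrr normr0 mulr_ge0// ltW.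
by rewrite /d mulrAC ler_pdivrMr// ler_wpM2l ?(ltW e0)// lerDl.
Qed.

(** [t] enumerates the centres of finite covers of the compact sets [Ks i] through a coding of
    pairs; a code of no pair, or a position beyond the list, gives 1. *)
Lemma countable_translates (phi : G -> R) : sigma_compact G -> continuous phi -> 0 < phi 1%g ->
  exists t : nat -> G, forall g, exists j u, 0 < phi u /\ g = (t j * u^-1)%g.
Proof.
move=> [Ks [cKs Ks_cover]] cphi phi1.
pose O (x : G) := [set z : G | 0 < phi (z^-1 * x)%g].
have oO x : open (O x).
  apply: (open_comp (f := fun z => phi (z^-1 * x)%g) (D := [set r : R | 0 < r])); last exact: open_gt.
  move=> z _; apply: (@cvg_comp _ _ _ (fun z => z^-1 * x)%g phi _ _ _ _ (cphi _)).
  by apply: cvgM_group; [apply: cvgV_group; exact: cvg_id|exact: cvg_cst].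
have covO i y : Ks i y -> exists x, O x y by move=> _; exists y; rewrite /O /= mulVg.
have [D DO] := choice (fun i => compact_subcover (cKs i) oO (covO i)).
exists (fun n => if (choice.unpickle n : option (nat * nat)) is Some (i, k) then nth 1%g (D i) k else 1%g) => g.
have [i _ Kg] : (\bigcup_i Ks i) g by rewrite Ks_cover.
have [x Dx Oxg] := DO i g Kg.
exists (choice.pickle (i, index x (D i) : nat)), (g^-1 * x)%g; split=> //.
by rewrite choice.pickleK nth_index// invgM invgK mulgA mulgV mul1g.
Qed.

End weights.

(** * The base map as a barycentre of a weighted orbit *)

Section base_map.
Context {R : realType} {X : metricType R} (properX : proper_space X) (CAT0X : CAT0 X).
Context {G : topGroupType} (Gamma : set G).
Context (hG : hausdorff_space G) (lcG : locally_compact [set: G]).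
Hypothesis Gamma1 : Gamma 1%g.
Hypothesis GammaM : forall a b, Gamma a -> Gamma b -> Gamma (a * b)%g.
Hypothesis GammaV : forall a, Gamma a -> Gamma (a^-1)%g.
Hypothesis discreteGamma : Gamma `<=` isolated Gamma.
Hypothesis cocompactGamma : cocompact Gamma.
Context (tau : G -> isom_group X).

(** Supplies the numbers [b j]: compactness bounds the displacement on [A] times a compact set of
    representatives, and invariance under [Gamma] does the rest. *)
Lemma displacement_bound N (f : G -> X) (A : set G) (s : G -> G) :
  cls Gamma tau N f -> compact A -> continuous s ->
  exists2 B : R, 0 <= B & forall u g, A u -> mdist (f g) (f (s u * g)%g) <= B.
Proof.
move=> cf cA cs; have [C cC CG] := cocompact_ex hG lcG Gamma1 GammaM GammaV cocompactGamma R.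
have cAC : compact (A `*` C) by exact: compact_setX.
have cd : continuous (fun z : G * G => mdist (f z.2) (f (s z.1 * z.2)%g)).
  apply: continuous_mdist => z.
    by apply: (@cvg_comp _ _ _ snd f _ _ _ _ (cls_cont cf (x := z.2))); exact: cvg_snd.
  apply: (@cvg_comp _ _ _ (fun z : G * G => s z.1 * z.2)%g f _ _ _ _ (cls_cont cf (x := (s z.1 * z.2)%g))).
  apply: cvgM_group; last exact: cvg_snd.
  by apply: (@cvg_comp _ _ _ fst s _ _ _ _ (cs z.1)); exact: cvg_fst.
have [n _ /(_ n (leqnn n)) nP] : \forall n \near \oo,
    (A `*` C) `<=` [set z | mdist (f z.2) (f (s z.1 * z.2)%g) <= n%:R].
  move/compact_near_coveringP: cAC; apply => z _.
  have n1 : nbhs z [set z' | mdist (f z'.2) (f (s z'.1 * z'.2)%g) < mdist (f z.2) (f (s z.1 * z.2)%g) + 1].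
    have /cvgrPdist_lt/(_ _ ltr01) := cd z; apply: filterS => z' /=.
    by rewrite ltr_norml => /andP[]; lra.
  exists ([set z' | mdist (f z'.2) (f (s z'.1 * z'.2)%g) < mdist (f z.2) (f (s z.1 * z.2)%g) + 1],
    [set n | mdist (f z.2) (f (s z.1 * z.2)%g) + 1 <= n%:R]) => /=.
    by split=> //; exact: nbhs_infty_ger.
  by move=> [z' n] /= [h1 h2]; apply: ltW; exact: lt_le_trans h1 h2.
exists n%:R => // u g Au; have [c Gc Cgc] := CG g.
have := nP (u, (g * c)%g) (conj Au Cgc) => /=.
by have := cls_dist_inv 1%g (s u) g cf cf Gc; rewrite !mul1g => ->.
Qed.

Hypothesis tauM : forall a a', Gamma a -> Gamma a' -> tau (a * a')%g = (tau a * tau a')%g.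

Section orbit_barycentre.
Context (phi : G -> R) (x0 : X).
Hypothesis Cc_phi : Cc phi.
Hypothesis phi0 : forall x, 0 <= phi x.
Hypothesis phi_pos : forall g, exists2 c, Gamma c & 0 < phi (g * c)%g.

(** A measure on [Gamma] cut off by [phi]. Replacing [g] by [g * c] only reindexes it, which makes
    the barycentre of the orbit equivariant. *)
Let orb (g : G) (F : G -> R) : R := \sum_(c \in Gamma) phi (g * c)%g * F c.

Let adm_all : admissible (X := X) [set: G -> R] [set: G -> X].
Proof. by []. Qed.

Let orb_finite g : finite_set (Gamma `&` [set c | phi (g * c)%g != 0]).
Proof.
have [_ [A cA A0]] := Cc_phi.
apply: (@sub_finite_set _ _ (fiber Gamma A g)); last exact: fiber_finite.
move=> c [Gc /= nz]; split=> //=; apply: contrapT => nA.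
by rewrite A0 ?eqxx// in nz.
Qed.

Lemma orbE g s F : uniq s -> (forall c, Gamma c -> phi (g * c)%g != 0 -> c \in s) ->
  [set` s] `<=` Gamma -> orb g F = \sum_(c <- s) phi (g * c)%g * F c.
Proof.
move=> us cs sG; rewrite fsbig_seq//; apply/esym/fsbig_widen => // c [Gc nsc] /=.
have [->|nz] := eqVneq (phi (g * c)%g) 0; first by rewrite mul0r.
by case: nsc; exact: cs.
Qed.

Let fs g : seq G := fset_set (Gamma `&` [set c | phi (g * c)%g != 0]).

Let orbE1 g F : orb g F = \sum_(c <- fs g) phi (g * c)%g * F c.
Proof.
apply: orbE; first exact: fset_uniq.
- by move=> c Gc nz; rewrite /fs in_fset_set ?inE.
- by move=> c; rewrite /fs /= in_fset_set// inE => -[].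
Qed.

Let orb_pos g : posfun [set: G -> R] Gamma (orb g).
Proof.
split.
- move=> a F F' _ _; rewrite !orbE1 mulr_sumr -big_split/=.
  by apply: eq_bigr => c _; ring.
- move=> F F' _ _ H; rewrite !orbE1 big_seq [leRHS]big_seq; apply: ler_sum => c.
  rewrite /fs in_fset_set// inE => -[Gc _]; apply: ler_wpM2l => //; exact: H.
- have [c Gc pc] := phi_pos g; rewrite orbE1 (big_rem c)/=; last first.
    by rewrite /fs in_fset_set// inE; split=> //=; rewrite gt_eqF.
  by rewrite mulr1 ltr_pwDl// sumr_ge0// => c' _; rewrite mulr1.
Qed.

Definition orbit_bar (g : G) : X := bar x0 (orb g) (fun c => tau c x0).

Let orbit_barP g x := barP properX CAT0X adm_all x0 (orb_pos g) (q := fun c => tau c x0) I x.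

Let orb_shift g c F F' : Gamma c -> (forall d, Gamma d -> F d = F' (c * d)%g) ->
  orb (g * c)%g F = orb g F'.
Proof.
move=> Gc FF'; rewrite /orb [RHS](reindex_fsbig (fun d => (c * d)%g) Gamma Gamma).
  by apply: eq_fsbigr => d; rewrite inE => Gd; rewrite mulgA FF'.
split.
- by move=> d Gd; exact: GammaM.
- by move=> a a' _ _; exact: mulgI.
- move=> d Gd; exists (c^-1 * d)%g; last by rewrite mulgA mulgV mul1g.
  by apply: GammaM => //; exact: GammaV.
Qed.

Lemma orbit_bar_equi g c : Gamma c -> orbit_bar (g * c)%g = (tau c)^-1%g (orbit_bar g).
Proof.
move=> Gc; apply: mdist_positivity; apply/eqP.
have H1 := orbit_barP (g * c)%g ((tau c)^-1%g (orbit_bar g)).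
have H2 := orbit_barP g (tau c (orbit_bar (g * c)%g)).
have E x : orb (g * c)%g (fun d => mdist x (tau d x0) ^+ 2) =
    orb g (fun d => mdist (tau c x) (tau d x0) ^+ 2).
  by apply: orb_shift => // d Gd; rewrite tauM// isom_mdist.
have mE : mass (orb (g * c)%g) = mass (orb g) by exact: orb_shift.
rewrite -/(orbit_bar _) !E isom_invKV mE in H1.
rewrite -/(orbit_bar _) -(isom_mdist (tau c)^-1%g) isom_invK in H2.
rewrite (metric_sym ((tau c)^-1%g _)) in H1.
have l0 : 0 < mass (orb g) := posfun_mass (orb_pos g).
have : mass (orb g) * mdist (orbit_bar (g * c)%g) ((tau c)^-1%g (orbit_bar g)) ^+ 2 <= 0 by lra.
by rewrite pmulr_rle0// => h; rewrite -sqrf_eq0 eq_le h sqr_ge0.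
Qed.

(** Near [g] all sums run over one finite set [s], whose orbit points have mutual distances at most
    [M]; by [bar_weights] the barycentre then moves in proportion to the change [h] of the
    weights. *)
Lemma orbit_bar_continuous : continuous orbit_bar.
Proof.
move=> g; have [_ [A cA A0]] := Cc_phi.
have [W [nW cW _]] := lc_compact_nbhs g lcG.
pose S := Gamma `&` [set (a * b)%g | a in [set (w^-1)%g | w in W] & b in A].
have fS : finite_set S.
  by apply: discrete_finite => //; apply: compact_mul => //; exact: compact_inv.
pose s : seq G := fset_set S.
have sG : [set` s] `<=` Gamma by move=> c; rewrite /s /= in_fset_set// inE => -[].
have E w F : W w -> orb w F = \sum_(c <- s) phi (w * c)%g * F c.
  move=> Ww; apply: orbE => //; first exact: fset_uniq.
  move=> c Gc nz; rewrite /s in_fset_set// inE; split=> //.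
  have Awc : A (w * c)%g by apply: contrapT => nA; rewrite A0 ?eqxx// in nz.
  by exists (w^-1)%g; [exists w|exists (w * c)%g => //; rewrite mulKg].
pose M := \sum_(c <- s) \sum_(d <- s) mdist (tau c x0) (tau d x0).
have M0 : 0 <= M by apply: sumr_ge0 => c _; apply: sumr_ge0 => d _; exact: mdist_ge0.
have Mcd c d : c \in s -> d \in s -> mdist (tau c x0) (tau d x0) <= M.
  move=> cs ds; rewrite /M (big_rem c)//= (big_rem d)//= -addrA lerDl addr_ge0//.
    by apply: sumr_ge0 => *; exact: mdist_ge0.
  by apply: sumr_ge0 => *; apply: sumr_ge0 => *; exact: mdist_ge0.
have Ww : W g := nbhs_singleton nW.
have l0 w : 0 < mass (orb w) := posfun_mass (orb_pos w).
have near_orb w c : W w -> c \in s -> mdist (orbit_bar w) (tau c x0) <= M.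
  move=> Wg cs; have bc := barP properX CAT0X adm_all x0 (orb_pos w) (q := fun=> tau c x0) I (tau c x0).
  have E1 : bar x0 (orb w) (fun=> tau c x0) = tau c x0.
    apply: mdist_positivity; apply/eqP; move: bc; rewrite !(posfun_cst (adm_cst adm_all) (orb_pos w)) mdistxx.
    rewrite expr0n /= mul0r mulrC metric_sym -mulrDr pmulr_rle0// => h.
    have s0 := sqr_ge0 (mdist (tau c x0) (bar x0 (orb w) (fun=> tau c x0))).
    by rewrite -sqrf_eq0 eq_le s0 andbT; move: h s0; lra.
  have := bar_nonexp properX CAT0X adm_all x0 (orb_pos w) (q := fun c => tau c x0) (q' := fun=> tau c x0) I I.
  rewrite E1 -/(orbit_bar w) => H; rewrite -(ler_pM2l (l0 w)) (le_trans H)//.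
  rewrite mulrC -(posfun_cst (adm_cst adm_all) (orb_pos w)) !E//.
  rewrite big_seq [leRHS]big_seq; apply: ler_sum => d ds.
  by rewrite ler_wpM2l// Mcd.
pose h w := \sum_(c <- s) `|phi (g * c)%g - phi (w * c)%g|.
have ch : h @ g --> (0 : R).
  rewrite [X in _ --> X](_ : 0 = h g); last first.
    by rewrite /h big1// => c _; rewrite subrr normr0.
  apply: (continuous_sum (F := fun c w => `|phi (g * c)%g - phi (w * c)%g|)) => c w.
  apply: (@cvg_norm _ R^o); apply: cvgB; first exact: cvg_cst.
  exact: (@cvg_comp _ _ _ (fun z => (z * c)%g) phi _ _ _ (@mulg_continuousr _ _ w) (@Cc_phi.1 _)).
have key w : W w -> mass (orb g) * mdist (orbit_bar g) (orbit_bar w) <= 2 * M * h w.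
  move=> Wg; set D := mdist (orbit_bar g) (orbit_bar w).
  have D0 : 0 <= D := mdist_ge0 _ _.
  have h0 : 0 <= h w by apply: sumr_ge0.
  have [->|Dn0] := eqVneq D 0; first by rewrite mulr0 !mulr_ge0.
  have Dp : 0 < D by rewrite lt_neqAle eq_sym Dn0.
  have BW := bar_weights properX CAT0X adm_all x0 (orb_pos g) (orb_pos w) (q := fun c => tau c x0) I.
  rewrite -/(orbit_bar g) -/(orbit_bar w) -/D !E// -sumrB in BW.
  rewrite -(ler_pM2r Dp); apply: (@le_trans _ _ ((mass (orb g) + mass (orb w)) * D ^+ 2)).
    by rewrite -mulrA -expr2 ler_wpM2r ?sqr_ge0// lerDl ltW.
  apply: (le_trans BW); rewrite /h mulr_sumr mulr_suml big_seq [leRHS]big_seq.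
  apply: ler_sum => c cs; rewrite -mulrBl; apply: (le_trans (ler_norm _)).
  rewrite normrM (mulrC (2 * M)) -mulrA; apply: ler_wpM2l => //.
  have n1 := near_orb _ _ Ww cs; have n2 := near_orb _ _ Wg cs.
  rewrite subr_sqr normrM mulrC; apply: ler_pM => //.
    by rewrite ger0_norm ?addr_ge0 ?mdist_ge0//; move: n1 n2; lra.
  rewrite ler_norml; apply/andP; split.
    by have := metric_triangle (orbit_bar g) (orbit_bar w) (tau c x0); rewrite -/D; lra.
  by have := metric_triangle (orbit_bar w) (orbit_bar g) (tau c x0); rewrite (metric_sym (orbit_bar w) (orbit_bar g)) -/D; lra.
apply/cvg_mdistP => e e0.
have M1 : 0 < 2 * M + 1 by rewrite ltr_wpDl// mulr_ge0.
have e1 : 0 < e * mass (orb g) / (2 * M + 1) by rewrite divr_gt0// mulr_gt0.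
have /cvgrPdist_lt/(_ _ e1) nh := ch.
apply: filterS2 nW nh => w Wg; have h0 : 0 <= h w by apply: sumr_ge0.
rewrite sub0r normrN ger0_norm// ltr_pdivlMr// => hh.
rewrite -(ltr_pM2l (l0 g)); apply: (le_lt_trans (key w Wg)).
rewrite (mulrC _ e); apply: le_lt_trans hh.
by rewrite mulrC ler_wpM2l// lerDl.
Qed.

End orbit_barycentre.

Lemma base_map_ex : X -> exists f : G -> X, cls Gamma tau [set 1%g] f.
Proof.
move=> x0; have [phi [Cphi phi0 phi_pos]] := cutoff_ex hG lcG Gamma1 GammaM GammaV cocompactGamma R.
exists (orbit_bar phi x0); split.
- exact: orbit_bar_continuous.
- by move=> g c; exact: orbit_bar_equi.
- by move=> n g ->; rewrite mul1g.
Qed.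

End base_map.

(** * Finite products *)

Section finite_products.
Context {n : nat} (G : 'I_n -> topGroupType).

Definition factor (i : 'I_n) (a : G i) : prod_group G := dfwith (1%g : prod_group G) i a.

Lemma factorE i a : factor a i = a. Proof. by rewrite /factor dfwithin. Qed.

Lemma factor_neq i j a : i != j -> @factor i a j = 1%g.
Proof. by move=> ij; rewrite /factor dfwithout. Qed.

Lemma factorM i (a b : G i) : factor (a * b)%g = (factor a * factor b)%g.
Proof.
apply: functional_extensionality_dep => j.
rewrite [RHS](_ : _ = factor a j * factor b j)%g//.
by have [<-|ij] := eqVneq i j; rewrite ?factorE// !factor_neq// mulg1.
Qed.

Lemma factor_comm i (x : prod_group G) (a : G i) : x i = 1%g -> (x * factor a)%g = (factor a * x)%g.
Proof.
move=> x1; apply: functional_extensionality_dep => j.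
rewrite [LHS](_ : _ = x j * factor a j)%g// [RHS](_ : _ = factor a j * x j)%g//.
by have [<-|ij] := eqVneq i j; [rewrite x1 mulg1 mul1g|rewrite factor_neq// mulg1 mul1g].
Qed.

Lemma factor_continuous i : continuous (@factor i).
Proof. exact: dfwith_continuous. Qed.

Lemma coord_continuous i : continuous (fun x : prod_group G => x i).
Proof. exact: (@proj_continuous _ (fun i => G i) i). Qed.

Lemma locally_compact_prod : (forall i, hausdorff_space (G i)) ->
  (forall i, locally_compact [set: G i]) -> locally_compact [set: prod_group G].
Proof.
move=> hG lcG x _; pose V i := projT1 (cid (lc_compact_nbhs (x i) (lcG i))).
have nV i : nbhs (x i) (V i) by rewrite /V; case: cid => ? [].
have cV i : compact (V i) by rewrite /V; case: cid => ? [].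
pose W := [set y : prod_group G | forall i, V i (y i)].
have cW : compact W by exact: (@tychonoff _ G).
exists W.
  rewrite /within /=.
  have : \forall y \near x, forall i, V i (y i).
    apply: (@filter_forall _ _ (fun i y => V i (y i)) (nbhs x)) => i; exact: (@coord_continuous i x _ (nV i)).
  by apply: filterS => y H _.
split=> //; apply: compact_closed => //.
exact: hausdorff_product.
Qed.

(** An index codes a function from the finitely many factors to [nat], which selects one compact set
    in each factor. *)
Lemma sigma_compact_prod : (forall i, sigma_compact (G i)) -> sigma_compact (prod_group G).
Proof.
move=> scG.
pose Ks i := projT1 (cid (scG i)).
have Ks_compact i m : compact (Ks i m) by rewrite /Ks; case: cid => ? [].
have Ks_cover i x : exists m, Ks i m x.
  rewrite /Ks; case: cid => C [_ /= CT].
  have [m _ Cx] : (\bigcup_m C m) x by rewrite CT.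
  by exists m.
pose code (m : nat) (i : 'I_n) : nat := if (choice.unpickle m : option {ffun 'I_n -> nat}) is Some f then f i else 0%N.
exists (fun m => [set x : prod_group G | forall i, Ks i (code m i) (x i)]); split.
  by move=> m; apply: (tychonoff (fun i => Ks_compact i (code m i))).
apply/seteqP; split=> // x _.
have fx i := Ks_cover i (x i).
exists (choice.pickle [ffun i => projT1 (cid (fx i))]) => // i.
by rewrite /code choice.pickleK ffunE; case: cid.
Qed.

End finite_products.

(** * Induction over the factors *)

Theorem corollary4 (R : realType) (n : nat) (G : 'I_n -> topGroupType)
    (hausdorffG : forall i, hausdorff_space (G i))
    (lcG : forall i, locally_compact [set: G i])
    (scG : forall i, sigma_compact (G i))
    (Gamma : set (prod_group G))
    (latticeGamma : lattice R Gamma)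
    (uniformGamma : cocompact Gamma)
    (irrGamma : irreducible Gamma)
    (X : metricType R) (properX : proper_space X) (CAT0X : CAT0 X)
    (H : set (isom_group X)) (subH : subgroup H) (closedH : closed H)
    (tau : prod_group G -> isom_group X)
    (tauH : forall x, Gamma x -> H (tau x))
    (tauM : forall x y, Gamma x -> Gamma y -> tau (x * y)%g = (tau x * tau y)%g)
    (tau_indec : indecomposable (tau @` Gamma))
    (tau_unbounded : unbounded (tau @` Gamma)) :
  exists ttau : prod_group G -> isom_group X,
    [/\ forall x, H (ttau x),
        forall x y, ttau (x * y)%g = (ttau x * ttau y)%g,
        continuous ttau
      & forall x, Gamma x -> ttau x = tau x].
Proof.
have [groupGamma discreteGamma [mu [mu_neq0 muI _]]] := latticeGamma.
have Gamma1 : Gamma 1%g by case: groupGamma => /set_mem.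
have GammaV a : Gamma a -> Gamma (a^-1)%g.
  by move=> Ga; apply/set_mem/(group_closedV groupGamma)/mem_set.
have GammaM a b : Gamma a -> Gamma b -> Gamma (a * b)%g.
  by move=> Ga Gb; apply/set_mem/(group_closedM groupGamma); exact/mem_set.
have hG : hausdorff_space (prod_group G) by exact: hausdorff_product.
have lG := locally_compact_prod hausdorffG lcG.
have sG := sigma_compact_prod scG.
pose I := haar mu.
have I_lin := haar_lin lG Gamma1 GammaM GammaV discreteGamma uniformGamma mu.
have I_mono := haar_mono lG Gamma1 GammaM GammaV discreteGamma uniformGamma mu.
have I_shift := haar_shift lG Gamma1 GammaM GammaV discreteGamma uniformGamma muI.
have I_gt0 := haar_gt0 hG lG Gamma1 GammaM GammaV discreteGamma uniformGamma mu_neq0 muI.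
have [phi [K2 [cK2 wphi phi1 smooth]]] := smoothing_weight_ex hG lG I_lin I_mono.
have [t cover_t] := countable_translates sG (weight_Cc wphi).1 phi1.
(* [N k] is the product of the factors of index below [k]. *)
pose N (k : nat) := [set x : prod_group G | forall j : 'I_n, (k <= j)%N -> x j = 1%g].
have Nconj k x s : N k x -> N k (s * x * s^-1)%g.
  move=> Nx j kj; rewrite [LHS](_ : _ = s j * x j * (s j)^-1)%g// Nx//.
  by rewrite mulg1 mulgV.
(* Either the extension is found, and it factors through the [k]-th coordinate, or a map invariant
   under one more factor exists. *)
have stage k f : (k < n)%N -> cls Gamma tau (N k) f ->
    (exists ttau : prod_group G -> isom_group X,
      [/\ forall x, H (ttau x),
        forall x y, ttau (x * y)%g = (ttau x * ttau y)%g,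
        continuous ttau
      & forall x, Gamma x -> ttau x = tau x]) \/ exists f', cls Gamma tau (N k.+1) f'.
  move=> kn cf; pose i := Ordinal kn; pose pr (x : prod_group G) := x i.
  have emM := @factorM _ G i.
  have prK (h : G i) : pr (factor h) = h by exact: factorE.
  have prM (x y : prod_group G) : pr (x * y)%g = (pr x * pr y)%g by [].
  have pr_cont : continuous pr by exact: coord_continuous.
  have em_cont := @factor_continuous _ G i.
  pose s j (u : prod_group G) := step pr (@factor _ G i) t u j.
  have cs j : continuous (s j) by exact: step_continuous.
  have b_ex j := displacement_bound hG lG Gamma1 GammaM GammaV uniformGamma cf cK2 (cs j).
  have b_ex' j : exists b : R, 0 <= b /\ forall u g, K2 u -> mdist (f g) (f (s j u * g)%g) <= b.
    by have [b b0 bP] := b_ex j; exists b.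
  have [b bP] := choice b_ex'.
  have [[r [rcl rM rcont rE]]|[f' cf' f'E]] := extension_or_invariant properX CAT0X hG lG Gamma1 GammaM GammaV
    uniformGamma prM emM prK pr_cont em_cont (@factor_comm _ G i) (Nconj k) I_lin I_mono I_shift I_gt0
    cf (fun j => (bP j).1) wphi cover_t smooth (fun j u g => (bP j).2 u g) tau_indec tau_unbounded
    (hausdorffG i) (lcG i) (irrGamma i) tauM.
  - left; exists (r \o pr); split.
    + move=> x; apply: closedH; apply: closure_subset (rcl (pr x)) => _ [a Ga <-].
      exact: tauH.
    + by move=> x y; rewrite /= prM rM.
    + by move=> x; apply: (@cvg_comp _ _ _ pr r _ _ _ (pr_cont x) (rcont (pr x))).
    + exact: rE.
  (* An element of [N k.+1] is the product of its [k]-th coordinate and an element of [N k]. *)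
  - right; exists f'; have [c1 c2 c3] := cf'; split=> // x g Nx.
    rewrite -(mulVKg (factor (pr x)) x) -mulgA f'E; apply: c3 => j kj.
    rewrite [LHS](_ : _ = (factor (pr x) j)^-1 * x j)%g//.
    have [<-|ij] := eqVneq i j; first by rewrite factorE mulVg.
    rewrite factor_neq// invg1 mul1g Nx// ltn_neqAle kj andbT.
    by move: ij; rewrite -val_eqE.
have [x0 unbx0] := tau_unbounded.
have [f0 [cf0 ef0 _]] := base_map_ex properX CAT0X hG lG Gamma1 GammaM GammaV discreteGamma uniformGamma tauM x0.
have cls0 : cls Gamma tau (N 0%N) f0.
  split=> // x g Nx; rewrite (_ : x = 1%g) ?mul1g//.
  by apply: functional_extensionality_dep => j; exact: Nx.
apply: contrapT => nex.
have cls_ex k : (k <= n)%N -> exists f, cls Gamma tau (N k) f.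
  elim: k => [_|k IH kn]; first by exists f0.
  by have [f cf] := IH (ltnW kn); have [/nex|] := stage k f kn cf.
(* [N n] is the whole group, so [f] is constant, and by equivariance its value is fixed by [tau] on
   [Gamma]; bounded orbits contradict [unbx0]. *)
have [f [_ ef nf]] := cls_ex n (leqnn n).
pose p := f 1%g.
have fixp c : Gamma c -> tau c p = p.
  move=> Gc; have E : f (1 * c)%g = p.
    by rewrite mul1g -[c]mulg1; apply: nf => j; rewrite leqNgt ltn_ord.
  rewrite -{1}E (ef _ _ Gc); exact: isom_invKV.
apply: unbx0; exists (2 * mdist x0 p) => _ _ [_ [a Ga <-] <-] [_ [a' Ga' <-] <-].
apply: (le_trans (metric_triangle _ p _)).
have da c : Gamma c -> mdist (tau c x0) p = mdist x0 p.
  by move=> Gc; rewrite -{1}(fixp c Gc) isom_mdist.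
by rewrite (metric_sym p) !da//; lra.
Qed.
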